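(* Let $\alpha > -1$ and let $\varphi \colon \mathbb{D} \to \mathbb{D}$ be an analytic self-map of the unit disk. Then the composition operator $C_\varphi \colon \mathfrak{B}^2_\alpha \to \mathfrak{B}^2_\alpha$ is decompactifiable if and only if $\|\varphi\|_\infty = 1$.
   Context: $\mathbb{D}$ is the open unit disk and $A$ the normalized area measure on $\mathbb{D}$. For $\alpha > -1$, the weighted Bergman space $\mathfrak{B}^2_\alpha$ is the space of analytic functions $f \colon \mathbb{D} \to \mathbb{C}$ with $\|f\|^2_{\mathfrak{B}^2_\alpha} = (\alpha+1)\int_{\mathbb{D}} |f(z)|^2 (1-|z|^2)^\alpha \, dA(z) < \infty$. The composition operator is $C_\varphi f = f \circ \varphi$ (it is always bounded on $\mathfrak{B}^2_\alpha$), and the weighted composition operator is $(M_w C_\varphi) f = w \, (f \circ \varphi)$. $\|\varphi\|_\infty = \sup_{z \in \mathbb{D}} |\varphi(z)|$. $C_\varphi \colon \mathfrak{B}^2_\alpha \to \mathfrak{B}^2_\alpha$ is called decompactifiable if there exists a weight $w \in \mathfrak{B}^2_\alpha$ such that $M_w C_\varphi \colon \mathfrak{B}^2_\alpha \to \mathfrak{B}^2_\alpha$ is bounded but not compact. *)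

(* Defs.v *)
From HB Require Import structures.
From mathcomp Require Import all_boot all_order all_algebra complex.
From mathcomp Require Import all_classical all_reals all_analysis measurable_realfun.
From mathcomp Require Import lra.

Set Implicit Arguments.
Unset Strict Implicit.
Unset Printing Implicit Defensive.

Import Order.TTheory GRing.Theory Num.Theory numFieldNormedType.Exports.
Import Normc.

Local Open Scope classical_set_scope.
Local Open Scope ring_scope.
Local Open Scope complex_scope.

Section disk.
Context {R : realType}.

Definition disk : set R[i] := [set z | normc z < 1].

(* Only the values of [f] on the disk matter: [derivable] at a point of the
   open set [disk] is a local condition.  The topology and the module structure
   of R[i] over itself are those of the regular module [R[i]^o]. *)
Definition holomorphic_disk (f : R[i] -> R[i]) : Prop :=
  forall z, disk z -> derivable (f : R[i]^o -> R[i]^o) z 1.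

Definition disk_supnorm (f : R[i] -> R[i]) : R :=
  sup [set normc (f z) | z in disk].

(* The area measure lives on R * R, identified with R[i] through [toC], and is
   normalized so that the disk has measure 1. *)
Definition toC (p : measurableTypeR R * measurableTypeR R) : R[i] :=
  p.1 +i* p.2.

Let invpi_ge0 : 0 <= (pi^-1 : R).
Proof. by rewrite invr_ge0 pi_ge0. Qed.

Definition area := mscale (NngNum invpi_ge0)
  ((@lebesgue_measure R) \x (@lebesgue_measure R))%E.

Definition bergman_sqnorm (alpha : R) (f : R[i] -> R[i]) : \bar R :=
  ((alpha + 1)%:E * \int[area]_(p in toC @^-1` disk)
     (normc (f (toC p)) ^+ 2 * (1 - normc (toC p) ^+ 2) `^ alpha)%:E)%E.

End disk.

Section measurability.
Context {R : realType}.
Notation mR := (measurableTypeR R).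

Lemma measurable_open_prod (U : set (R * R)) :
  open U -> measurable (U : set (mR * mR)).
Proof.
move=> oU.
pose box (q : (rat * rat) * (rat * rat)) : set (R * R) :=
  `]ratr q.1.1, ratr q.1.2[ `*` `]ratr q.2.1, ratr q.2.2[.
have -> : U = \bigcup_(q in [set q | box q `<=` U]) box q.
  apply/seteqP; split => [p Up|p [q qU /qU]//].
  have : nbhs p U by exact: open_nbhs_nbhs.
  case=> -[A B] /= [/nbhs_ballP[e /= e0 eA] /nbhs_ballP[d /= d0 dB]] ABU.
  have mid (x r : R) : 0 < r -> exists q : rat * rat,
      (x \in `]ratr q.1, ratr q.2[) /\
      [set` `](ratr q.1 : R), ratr q.2[] `<=` ball x r.
    move=> r0.
    have [q1] := @rat_in_itvoo R (x - r) x (ltac:(by rewrite ltrBlDr ltrDl)).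
    rewrite in_itv /= => /andP[q1l q1r].
    have [q2] := @rat_in_itvoo R x (x + r) (ltac:(by rewrite ltrDl)).
    rewrite in_itv /= => /andP[q2l q2r].
    exists (q1, q2); split; first by rewrite in_itv /= q1r q2l.
    move=> y /=; rewrite in_itv /= => /andP[y1 y2].
    rewrite /ball /= ltr_norml; lra.
  have [q1 [q1p q1A]] := mid p.1 e e0.
  have [q2 [q2p q2B]] := mid p.2 d d0.
  exists (q1, q2) => /=; last by split.
  move=> z [z1 z2]; apply: ABU; split => /=.
  - exact/eA/q1A.
  - exact/dB/q2B.
rewrite bigcup_mkcond; apply: countable_bigcupT_measurable => // q.
case: ifPn => _; last exact: measurable0.
by apply: measurableX; exact: measurable_itv.
Qed.

Lemma measurable_continuous_on_open (D : set (R * R)) (h : R * R -> R) :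
  open D -> (forall p, D p -> {for p, continuous h}) ->
  measurable_fun (D : set (mR * mR)) (h : mR * mR -> R).
Proof.
move=> oD ch; move=> mD.
apply: (measurability _ (RGenOInfty.measurableE R)) => //.
move=> _ [_ [x ->] <-]; apply: measurable_open_prod.
rewrite openE => p /= [Dp]; rewrite /= in_itv /= andbT => xh.
have nD : \forall q \near p, D q by exact: open_nbhs_nbhs.
have nh : \forall q \near p, x < h q by exact: (cvgr_gt (h p) (ch p Dp)).
apply: filter_app nD; apply: filter_app nh; near=> q => hq Dq.
by split => //=; rewrite in_itv /= andbT.
Unshelve. all: by end_near. Qed.

End measurability.

Section complex_topology.
Context {R : realType}.
Implicit Types (z : R[i]) (p : R * R).

Lemma complex_gt0E (e : R[i]) : 0 < e -> e = (complex.Re e)%:C /\ 0 < complex.Re e.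
Proof. by case: e => a b; rewrite ltcE /= => /andP[/eqP -> ->]. Qed.

Lemma normc_toC p : normc (toC p) <= `|p.1| + `|p.2|.
Proof.
case: p => a b; rewrite /toC /= -[leRHS]ger0_norm ?addr_ge0// -sqrtr_sqr.
rewrite ler_sqrt ?sqr_ge0// sqrrD !real_normK ?num_real//.
have := mulr_ge0 (normr_ge0 a) (normr_ge0 b); lra.
Qed.

Lemma toC_continuous : continuous (toC : R * R -> R[i]^o).
Proof.
move=> p; apply/cvgrPdist_lt => e /complex_gt0E[-> /= e0].
apply/(@nbhs_ballP R (R * R)%type p).
exists (complex.Re e / 2) => /=; first by rewrite divr_gt0.
move=> q [b1 b2].
have -> : toC p - toC q = toC (p - q) by [].
rewrite -[`|_|]/((normc (toC (p - q)))%:C) ltcR.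
apply: le_lt_trans (normc_toC _) _.
move: b1 b2; rewrite /ball /= => b1 b2; rewrite [ltRHS]splitr; exact: ltrD.
Qed.

Lemma normc_continuous : continuous (@normc R : R[i]^o -> R).
Proof.
move=> z; apply/(@cvgrPdist_lt R R _ (nbhs (z : R[i]^o))) => e e0.
apply/(@nbhs_ballP R[i] R[i]^o z); exists e%:C => /=; first by rewrite ltcR.
move=> y; rewrite /ball /= -[`|_|]/((normc (z - y))%:C) ltcR; apply: le_lt_trans.
rewrite ler_norml; apply/andP; split.
  rewrite lerBrDl addrC.
  have := @le_normcD R (y - z) z; rewrite subrK -[y - z]opprB normcN; lra.
have := @le_normcD R (z - y) y; rewrite subrK; lra.
Qed.

Lemma open_toC_disk : open ((toC : R * R -> R[i]) @^-1` disk).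
Proof.
have -> : (toC : R * R -> R[i]) @^-1` disk = (@normc R \o toC) @^-1` [set x : R | x < 1] by [].
apply: open_comp; last exact: open_lt.
by move=> p _; apply: (@continuous_comp _ R[i]^o R toC (@normc R)); [exact: toC_continuous|exact: normc_continuous].
Qed.

Lemma holomorphic_continuous (f : R[i] -> R[i]) p : holomorphic_disk f ->
  disk (toC p) -> {for p, continuous (fun q : R * R => normc (f (toC q)))}.
Proof.
move=> hf Dp; apply: (@continuous_comp _ R[i]^o R toC (fun z : R[i]^o => normc (f z)));
  first exact: toC_continuous.
apply: (@continuous_comp R[i]^o R[i]^o R (f : R[i]^o -> R[i]^o) (@normc R)).
  exact/differentiable_continuous/derivable1_diffP/hf.
exact: normc_continuous.
Qed.

End complex_topology.

Section bergman_norm.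
Context {R : realType} (alpha : R) (alpha_gtN1 : -1 < alpha).
Notation mR := (measurableTypeR R).
Implicit Types f g : R[i] -> R[i].

(* Elements of the Bergman space are represented by total functions that vanish
   off the disk, so that two elements are equal iff they agree on the disk. *)
Definition in_bergman f : Prop :=
  [/\ holomorphic_disk f, (bergman_sqnorm alpha f < +oo)%E &
      forall z, ~ disk z -> f z = 0].

Definition bergman_norm f : R := Num.sqrt (fine (bergman_sqnorm alpha f)).

Let weighted f (p : mR * mR) : R :=
  (normc (f (toC p)) * (1 - normc (toC p) ^+ 2) `^ (alpha / 2)).

Let gfun f : mR * mR -> R := weighted f \_ (toC @^-1` disk).

Let measurable_toC_disk : measurable ((toC : mR * mR -> R[i]) @^-1` disk).
Proof. by apply: measurable_open_prod; exact: open_toC_disk. Qed.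

Let measurable_gfun f : holomorphic_disk f -> measurable_fun setT (gfun f).
Proof.
move=> hf; apply/(measurable_restrictT (weighted f) measurable_toC_disk).
rewrite /weighted; apply: measurable_funM.
  apply: measurable_continuous_on_open; first exact: open_toC_disk.
  by move=> p Dp; exact: holomorphic_continuous.
apply: (measurableT_comp (measurable_powR _)).
apply: measurable_funB => //; apply: measurable_funX.
apply: measurable_continuous_on_open; first exact: open_toC_disk.
move=> p _; apply: (@continuous_comp _ R[i]^o R toC (@normc R)).
  exact: toC_continuous.
exact: normc_continuous.
Qed.

Let normc_ge0 (z : R[i]) : 0 <= normc z.
Proof. by case: z => a b; exact: sqrtr_ge0. Qed.

Let alpha1_gt0 : 0 < alpha + 1.
Proof. by rewrite -ltrBlDr sub0r. Qed.

Let N2 f := ('N[area]_(2%:E)[EFin \o gfun f])%E.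

Let sqnormE f : bergman_sqnorm alpha f =
  ((alpha + 1)%:E * \int[area]_p (gfun f p ^+ 2)%:E)%E.
Proof.
rewrite /bergman_sqnorm integral_mkcond; congr (_ * _)%E.
apply: eq_integral => p _; rewrite /gfun /patch; case: ifPn => // _; last first.
  by rewrite expr0n.
rewrite /weighted exprMn; congr (_ * _)%:E.
by rewrite -[RHS]powR_mulrn ?powR_ge0// -powRrM -mulrA mulVf ?mulr1.
Qed.

Let int_ge0 f : (0 <= \int[area]_p (gfun f p ^+ 2)%:E)%E.
Proof. by apply: integral_ge0 => p _; rewrite lee_fin sqr_ge0. Qed.

Let N2E f : N2 f = ((\int[area]_p (gfun f p ^+ 2)%:E) `^ 2^-1)%E.
Proof.
rewrite /N2 unlock; congr (_ `^ _)%E; apply: eq_integral => p _ /=.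
by rewrite powR_mulrn// real_normK// num_real.
Qed.

Let sqnorm_lty f : (bergman_sqnorm alpha f < +oo)%E <-> (N2 f < +oo)%E.
Proof.
rewrite sqnormE N2E; have := int_ge0 f.
case: (\int[area]_p _)%E => [r||]//= r0.
  by rewrite ?ltry; split.
by rewrite gt0_muley ?lte_fin// invr_eq0 pnatr_eq0; split.
Qed.

Let normE f : bergman_norm f = Num.sqrt (alpha + 1) * fine (N2 f).
Proof.
rewrite /bergman_norm sqnormE N2E; have := int_ge0 f.
case: (\int[area]_p _)%E => [r||]//= r0.
  by rewrite powR12_sqrt// -sqrtrM// ltW.
by rewrite gt0_muley ?lte_fin//= invr_eq0 pnatr_eq0 /= sqrtr0 mulr0.
Qed.

Let N2_ge0 f : (0 <= N2 f)%E.
Proof. exact: Lnorm_ge0. Qed.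

Let holomorphicD f g :
  holomorphic_disk f -> holomorphic_disk g -> holomorphic_disk (f \+ g).
Proof. by move=> hf hg z Dz; exact: derivableD (hf z Dz) (hg z Dz). Qed.

Let holomorphicZ (k : R[i]) f :
  holomorphic_disk f -> holomorphic_disk (fun z => k * f z).
Proof. by move=> hf z Dz; exact: (@derivableZ _ R[i]^o R[i]^o f k z 1 (hf z Dz)). Qed.

Let gfun_ge0 f p : 0 <= gfun f p.
Proof.
rewrite /gfun /patch; case: ifPn => // _.
by rewrite mulr_ge0 ?powR_ge0 ?normc_ge0.
Qed.

Let gfunD f g p : gfun (f \+ g) p <= gfun f p + gfun g p.
Proof.
rewrite /gfun /patch; case: ifPn => [_|_]; last by rewrite addr0.
by rewrite /weighted -mulrDl ler_wpM2r ?powR_ge0 ?le_normcD.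
Qed.

Let N2D f g : holomorphic_disk f -> holomorphic_disk g ->
  (N2 (f \+ g)%R <= N2 f + N2 g)%E.
Proof.
move=> hf hg; have h1 : 1 <= (2 : R) by rewrite ler1n.
apply: le_trans (minkowski_EFin area (measurable_gfun hf) (measurable_gfun hg) h1).
rewrite N2E unlock; apply: gt0_ler_poweR.
- by rewrite invr_ge0.
- by rewrite in_itv /= leey andbT.
- by rewrite in_itv /= leey andbT integral_ge0.
apply: ge0_le_integral => //.
- by move=> p _; rewrite lee_fin sqr_ge0.
- apply/measurable_EFinP; apply: measurable_funX; apply: measurable_gfun.
  exact: holomorphicD.
- apply/measurable_EFinP; apply: (measurableT_comp (measurable_powR _)).
  apply: measurableT_comp => //.
  by apply: measurable_funD; exact: measurable_gfun.
move=> p _; rewrite lee_fin powR_mulrn// ler_sqr ?nnegrE ?gfun_ge0//.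
by rewrite ger0_norm ?addr_ge0 ?gfun_ge0// gfunD.
Qed.

Let sqnormZ (k : R[i]) f : holomorphic_disk f ->
  bergman_sqnorm alpha (fun z => k * f z) =
  ((normc k ^+ 2)%:E * bergman_sqnorm alpha f)%E.
Proof.
move=> hf; rewrite !sqnormE muleCA; congr (_ * _)%E.
rewrite -ge0_integralZl//.
- apply: eq_integral => p _; rewrite -EFinM; congr (_%:E).
  rewrite -exprMn; congr (_ ^+ 2); rewrite /gfun /patch.
  by case: ifPn => _; rewrite ?mulr0// /weighted normcM mulrA.
- by apply/measurable_EFinP; apply: measurable_funX; exact: measurable_gfun.
- by move=> p _; rewrite lee_fin sqr_ge0.
- by rewrite lee_fin sqr_ge0.
Qed.

Lemma in_bergman0 : in_bergman (fun=> 0).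
Proof.
have h : holomorphic_disk (fun=> 0 : R[i]).
  by move=> z _; exact: (@derivable_cst _ R[i]^o R[i]^o).
split => //.
have -> : (fun=> 0 : R[i]) = (fun _ : R[i] => 0 * (0 : R[i])).
  by apply/funext => z; rewrite mul0r.
by rewrite (sqnormZ 0 h) normc0 expr0n mul0e ltry.
Qed.

Lemma in_bergmanD f g : in_bergman f -> in_bergman g -> in_bergman (f \+ g).
Proof.
move=> [hf ff f0] [hg fg g0]; split; first exact: holomorphicD.
  apply/sqnorm_lty; apply: le_lt_trans (N2D hf hg) _.
  by rewrite lte_add_pinfty//; apply/sqnorm_lty.
by move=> z Dz; rewrite /= f0// g0// addr0.
Qed.

Lemma in_bergmanZ (k : R[i]) f : in_bergman f -> in_bergman (fun z => k * f z).
Proof.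
move=> [hf ff f0]; split; first exact: holomorphicZ.
  rewrite sqnormZ//; apply: lte_mul_pinfty => //.
  by rewrite lee_fin sqr_ge0.
by move=> z Dz; rewrite f0// mulr0.
Qed.

Lemma bergman_normD f g : in_bergman f -> in_bergman g ->
  bergman_norm (f \+ g) <= bergman_norm f + bergman_norm g.
Proof.
move=> [hf ff f0] [hg fg g0]; rewrite !normE -mulrDr ler_wpM2l ?sqrtr_ge0//.
have Nf : N2 f \is a fin_num by rewrite ge0_fin_numE//; apply/sqnorm_lty.
have Ng : N2 g \is a fin_num by rewrite ge0_fin_numE//; apply/sqnorm_lty.
rewrite -fineD//; apply: fine_le; rewrite ?fin_numD ?Nf//; last exact: N2D.
by rewrite ge0_fin_numE//; apply: le_lt_trans (N2D hf hg) _; rewrite lte_add_pinfty// -?ge0_fin_numE.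
Qed.

Lemma bergman_normZ (k : R[i]) f : in_bergman f ->
  bergman_norm (fun z => k * f z) = normc k * bergman_norm f.
Proof.
move=> [hf ff f0]; rewrite /bergman_norm sqnormZ// fineM//; last first.
  rewrite ge0_fin_numE// sqnormE mule_ge0//.
  by rewrite lee_fin ltW.
by rewrite /= sqrtrM ?sqr_ge0// sqrtr_sqr ger0_norm ?normc_ge0.
Qed.

Lemma bergman_norm_eq0 f : in_bergman f -> bergman_norm f = 0 -> f = (fun=> 0).
Proof.
move=> [hf ff f0] nf0.
have Nf : N2 f \is a fin_num by rewrite ge0_fin_numE//; apply/sqnorm_lty.
have N0 : N2 f = 0%E.
  rewrite -(fineK Nf); congr (_%:E); apply/eqP; move/eqP: nf0.
  by rewrite normE mulf_eq0 sqrtr_eq0 leNgt alpha1_gt0.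
have mE : measurable_fun setT (EFin \o gfun f).
  by apply/measurable_EFinP; exact: measurable_gfun.
have := Lnorm_eq0_eq0 mE _ N0; rewrite lte_fin => /(_ (ltac:(by []))) ae0.
apply/funext => z; have [Dz|/f0//] := pselect (disk z).
apply/eqP; apply: contraT => fz0.
pose p := (complex.Re z, complex.Im z) : R * R.
have zE : toC p = z by rewrite /p; case: (z).
pose h (q : R * R) := normc (f (toC q)).
have hp : 0 < h p.
  rewrite lt_neqAle normc_ge0 andbT eq_sym; apply: contra fz0.
  by rewrite /h zE => /eqP/eq0_normc ->.
have Dp : disk (toC p) by rewrite zE.
have ch : {for p, continuous h} by exact: holomorphic_continuous.
have nD : nbhs p (toC @^-1` disk).
  by apply: open_nbhs_nbhs; split => //; exact: open_toC_disk.
have nh : nbhs p [set q | 0 < h q] by exact: (cvgr_gt (h p) ch).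
have [e /= e0 eU] := (@nbhs_ballP R (R * R)%type p _).1 (filterI nD nh).
have [A [mA A0 UA]] := ae0.
have boxA : (ball p.1 e `*` ball p.2 e : set (mR * mR)) `<=` A.
  move=> q [q1 q2]; apply: UA => /= /(_ I) /eqP; rewrite eqe.
  have [/= Dq hq] := eU q (conj q1 q2).
  rewrite /gfun /patch mem_set// /weighted mulf_eq0 gt_eqF//=.
  rewrite gt_eqF// powR_gt0// subr_gt0 -[ltRHS](expr1n _ 2).
  by rewrite ltrXn2r// ?normc_ge0.
have mbox : measurable (ball p.1 e `*` ball p.2 e : set (mR * mR)).
  by apply: measurableX; exact: measurable_ball.
have : (area (ball p.1 e `*` ball p.2 e : set (mR * mR)) <= 0)%E.
  by rewrite -A0; apply: le_measure; rewrite ?inE.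
rewrite leNgt => /negP; case.
rewrite /area /mscale /= product_measure1E; try exact: measurable_ball.
have bE (x : R) : lebesgue_measure (ball x e : set mR) = (e *+ 2)%:E.
  exact: lebesgue_measure_ball (ltW e0).
rewrite [X in (_ < _ * (X * _))%E]bE [X in (_ < _ * (_ * X))%E]bE.
by rewrite -!EFinM lte_fin !mulr_gt0 ?invr_gt0 ?pi_gt0 ?mulrn_wgt0.
Qed.

End bergman_norm.

Section bergman_space.
Context {R : realType} (alpha : R) (alpha_gtN1 : -1 < alpha).

Definition bergman_pred of -1 < alpha : {pred (R[i] -> R[i]^o)} :=
  fun f => `[< in_bergman alpha f >].

Lemma bergman_submod_closed : submod_closed (bergman_pred alpha_gtN1).
Proof.
split; first by apply/asboolP; exact: in_bergman0.
move=> k f g /asboolP hf /asboolP hg; apply/asboolP.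
exact: in_bergmanD (in_bergmanZ k hf) hg.
Qed.

HB.instance Definition _ := GRing.isSubmodClosed.Build R[i] (R[i] -> R[i]^o)
  (bergman_pred alpha_gtN1) bergman_submod_closed.

Record bergman := Bergman {
  bergman_fun :> R[i] -> R[i]^o ;
  bergman_funP : bergman_fun \in bergman_pred alpha_gtN1 }.

HB.instance Definition _ := [isSub for bergman_fun].
HB.instance Definition _ := [Choice of bergman by <:].
HB.instance Definition _ := [SubChoice_isSubLmodule of bergman by <:].

Let in_bergman_fun (f : bergman) : in_bergman alpha f.
Proof. exact/asboolP/(bergman_funP f). Qed.

Let norm (f : bergman) : R[i] := (bergman_norm alpha f)%:C.

Let norm_normD f g : norm (f + g) <= norm f + norm g.
Proof.
rewrite /norm -rmorphD lecR.
exact: (bergman_normD alpha_gtN1 (in_bergman_fun f) (in_bergman_fun g)).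
Qed.

Let norm_normZ (k : R[i]) f : norm (k *: f) = `|k| * norm f.
Proof.
rewrite /norm -[`|k|]/((normc k)%:C) -rmorphM; congr (_%:C).
exact: (bergman_normZ alpha_gtN1 k (in_bergman_fun f)).
Qed.

Let norm_eq0 f : norm f = 0 -> f = 0.
Proof.
move=> /(congr1 (@complex.Re R)) /= nf0; apply: val_inj => /=.
exact: (bergman_norm_eq0 alpha_gtN1 (in_bergman_fun f) nf0).
Qed.

HB.instance Definition _ :=
  Lmodule_isNormed.Build R[i] bergman norm_normD norm_normZ norm_eq0.

Lemma bergman_normE (f : bergman) : `|f| = (bergman_norm alpha f)%:C.
Proof. by []. Qed.

End bergman_space.

Section operators.
Context {R : realType}.

Definition bounded_operator (V W : normedModType R[i]) (T : V -> W) : Prop :=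
  exists M : R, forall f, `|T f| <= M%:C * `|f|.

Definition compact_operator (V W : normedModType R[i]) (T : V -> W) : Prop :=
  forall A : set V, bounded_set A -> precompact (T @` A).

Context (alpha : R) (alpha_gtN1 : -1 < alpha).
Local Notation B := (bergman alpha_gtN1).

(* [M_w C_phi] maps the Bergman space into itself, as the operator [T].  Such a
   [T] is unique since its values vanish off the disk. *)
Definition is_weighted_composition (w : R[i] -> R[i]) (phi : R[i] -> R[i])
    (T : {linear B -> B}) : Prop :=
  forall (f : B) z, disk z -> T f z = w z * f (phi z).

Definition decompactifiable (phi : R[i] -> R[i]) : Prop :=
  exists (w : B) (T : {linear B -> B}),
    [/\ is_weighted_composition w phi T, bounded_operator T &
        ~ compact_operator T].

End operators.

(* Main.v *)
Require Import Defs.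
From HB Require Import structures.
From mathcomp Require Import all_boot all_order all_algebra complex.
From mathcomp Require Import all_classical all_reals all_analysis measurable_realfun.
From mathcomp Require Import ring lra.

(** Write [W z = (1 - |z|^2)^alpha] and let [box_mass (|w|^2 W) x] be the integral
of [|w|^2 W] over the preimage under [phi] of the disc of radius [(1 - |x|)/2]
about [x].  The sub-mean value property of [|f|^2] and Tonelli's theorem show that
[M_w C_phi] is bounded as soon as [box_mass x = O((1 - |x|)^(alpha+2))], and testing
on the normalized kernels [(1 - conj x z)^-m] shows that it is not compact when
moreover [box_mass x >= e (1 - |x|)^(alpha+2)] for points [x] arbitrarily close to
the circle.  For [w = 1] the upper bound always holds: integrate the positive
harmonic function [Re (1 - conj x phi)^-1] over an annulus of width comparable to
[1 - |x|], which contains the preimage by the Schwarz-Pick lemma.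

Let [sup |phi| = 1].  If the lower bound holds for [w = 1], then [1] is the required
weight.  Otherwise every bounded weight has [box_mass x = o((1 - |x|)^(alpha+2))],
while kernels at points [z] with [|phi z|] close to [1], normalized to have
[sup_x box_mass x / (1 - |x|)^(alpha+2) = 1], have norm tending to [0]; a gliding
hump sum of such kernels is the required weight.

If [sup |phi| < 1], then on the range of [phi] the elements of a bounded set are
sums of power series with coefficients in a fixed product of squares, which is
compact by Tychonoff's theorem, and [M_w C_phi] is continuous on that product. *)

Set Implicit Arguments.
Unset Strict Implicit.
Unset Printing Implicit Defensive.

Import Order.TTheory GRing.Theory Num.Theory numFieldNormedType.Exports.
Import Normc.

Local Open Scope classical_set_scope.
Local Open Scope ring_scope.
Local Open Scope complex_scope.

(** * Complex derivatives *)

Section complex_basics.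
Context {R : realType}.
Local Notation C := R[i].
Implicit Types (z w : C) (f g : C -> C).

(** The smallness of the bumps comes from testing boundedness on a second kernel. With the weight
    [ker m z], the operator sends the kernel at [phi z] to a function with a peak of known size at
    [z]; point evaluation bounds this peak by the operator norm, hence by the supremum of the box
    mass quotients. This bounds the supremum from below, and after division by it the squared norm
    of the weight is [O((1 - |phi z|)^(alpha+2))]. The obstacle is to add infinitely many bumps
    without losing the upper bound on box masses. A bump of small norm has small box mass at every
    [x] away from the circle; being bounded, it also has box mass [o((1 - |x|)^(alpha+2))] near the
    circle, and this is where the failure of the weight [1] is used. So a bump matters only for
    [|x|] in one annulus. With disjoint annuli all bumps but one are negligible at each [x], and the
    sum keeps both the upper bound and a fixed part of every peak. *)

Lemma normc_ge0 z : 0 <= normc z.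
Proof. by case: z => a b; exact: sqrtr_ge0. Qed.

Lemma normc_real (x : R) : normc x%:C = `|x|.
Proof. by rewrite /= expr0n addr0 sqrtr_sqr. Qed.

Lemma normcX z n : normc (z ^+ n) = normc z ^+ n.
Proof. by elim: n => [|n ih]; rewrite ?expr0 ?normc1// !exprS normcM ih. Qed.

Lemma normcV z : normc z^-1 = (normc z)^-1.
Proof.
have [->|z0] := eqVneq z 0; first by rewrite invr0 normc0 invr0.
have nz0 : normc z != 0 by apply: contra_neq z0; exact: eq0_normc.
by apply: (mulfI nz0); rewrite -normcM mulfV// mulfV// normc1.
Qed.

Lemma normc_gt0 z : (0 < normc z) = (z != 0).
Proof.
apply/idP/idP => [|z0]; first by apply: contraTneq => ->; rewrite normc0 ltxx.
by rewrite lt_neqAle normc_ge0 andbT eq_sym; apply: contra_neq z0; exact: eq0_normc.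
Qed.

Lemma normcB z w : normc (z - w) = normc (w - z).
Proof. by rewrite -normcN opprB. Qed.

Lemma ler_normcB z w : normc z - normc w <= normc (z - w).
Proof. by rewrite lerBlDr; have := le_normcD (z - w) w; rewrite subrK. Qed.

Lemma normc_sum (I : Type) (r : seq I) (P : pred I) (F : I -> C) :
  normc (\sum_(i <- r | P i) F i) <= \sum_(i <- r | P i) normc (F i).
Proof.
elim/big_ind2 : _ => //; first by rewrite normc0.
by move=> x1 x2 y1 y2 h1 h2; apply: le_trans (le_normcD _ _) _; exact: lerD.
Qed.

Lemma ler_Re z : `|complex.Re z| <= normc z.
Proof. by case: z => a b /=; rewrite -sqrtr_sqr ler_sqrt ?addr_ge0 ?sqr_ge0// lerDl sqr_ge0. Qed.

Lemma ler_Im z : `|complex.Im z| <= normc z.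
Proof. by case: z => a b /=; rewrite -sqrtr_sqr ler_sqrt ?addr_ge0 ?sqr_ge0// lerDr sqr_ge0. Qed.

Lemma normc_leReIm z : normc z <= `|complex.Re z| + `|complex.Im z|.
Proof. by case: z => a b; exact: (normc_toC (a, b)). Qed.

Lemma normc_sqr z : normc z ^+ 2 = complex.Re z ^+ 2 + complex.Im z ^+ 2.
Proof. by case: z => a b /=; rewrite sqr_sqrtr// addr_ge0 ?sqr_ge0. Qed.

Lemma normc_conj z : normc (conjc z) = normc z.
Proof. by case: z => a b /=; rewrite sqrrN. Qed.

Lemma cvgCP (T : Type) (F : set_system T) {FF : Filter F} (f : T -> C^o) (l : C) :
  f @ F --> (l : C^o) <->
  forall e : R, 0 < e -> \forall t \near F, normc (f t - l) < e.
Proof.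
split=> [/cvgrPdist_lt h e e0|h].
  have := h e%:C; rewrite ltcR => /(_ e0); apply: filterS => t.
  by rewrite -[`|_|]/((normc (l - f t))%:C) ltcR normcB.
apply/cvgrPdist_lt => e /complex_gt0E[-> e0].
by apply: filterS (h _ e0) => t; rewrite -[`|_|]/((normc (l - f t))%:C) ltcR normcB.
Qed.

Lemma nbhsCP (z : C) (P : set C) :
  nbhs (z : C^o) P <-> exists2 r : R, 0 < r & forall w, normc (w - z) < r -> P w.
Proof.
split=> [/nbhs_ballP[e /= /complex_gt0E[ee e0] h]|[r r0 h]].
  exists (complex.Re e) => // w hw; apply: h; rewrite /ball/= ee.
  by rewrite -[`|_|]/((normc (z - w))%:C) ltcR normcB.
apply/nbhs_ballP; exists r%:C => /=; first by rewrite ltcR.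
by move=> w; rewrite /ball /= -[`|_|]/((normc (z - w))%:C) ltcR normcB => /h.
Qed.

Lemma continuousCP f z : {for z, continuous (f : C^o -> C^o)} <->
  forall e : R, 0 < e -> exists2 r : R, 0 < r &
    forall w, normc (w - z) < r -> normc (f w - f z) < e.
Proof.
split=> [/cvgCP h e e0|h]; first by have /nbhsCP := h _ e0.
by apply/(@cvgCP _ (nbhs (z : C^o))) => e e0; apply/nbhsCP; exact: h.
Qed.

(** Differentiability as a first-order expansion without a quotient: [h = 0] is allowed, and
    remainders of several functions can be added. *)
Definition has_cderiv f z (d : C) := forall e : R, 0 < e -> exists2 r : R, 0 < r &
  forall h, normc h < r -> normc (f (z + h) - f z - d * h) <= e * normc h.

Local Notation cderivable f z := (derivable (f : C^o -> C^o) (z : C^o) 1).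

Lemma cderivableP f z : cderivable f z <-> exists d, has_cderiv f z d.
Proof.
split=> [|[d hd]].
  move/cvg_ex => [d /cvgCP hd]; exists d => e e0.
  have /nbhsCP[r r0 hr] := hd e e0; exists r => // h hhr.
  have [->|h0] := eqVneq h 0.
    by rewrite addr0 mulr0 subr0 subrr normc0 mulr0.
  have := hr h; rewrite subr0 => /(_ hhr h0) /= /ltW.
  rewrite /shift /= -[(_ *: 1 : C)]/(h * 1) mulr1 addrC.
  set D := f (h + z) - f z; rewrite -[h^-1 *: D]/(h^-1 * D) => le.
  have -> : f (z + h) - f z - d * h = (h^-1 * D - d) * h.
    by rewrite mulrBl mulrAC mulVf// mul1r /D addrC [z + h]addrC; ring.
  rewrite normcM ler_wpM2r ?normc_ge0// addrC//.
apply/cvg_ex; exists d; apply/cvgCP => e e0.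
have e20 : 0 < e / 2 by rewrite divr_gt0.
have [r r0 hr] := hd _ e20; apply/nbhsCP; exists r => // h; rewrite subr0 => hhr h0.
rewrite /= /shift /= -[(_ *: 1 : C)]/(h * 1) mulr1.
set D := f (h + z) - f z; rewrite -[h^-1 *: D]/(h^-1 * D).
have -> : h^-1 * D - d = (f (z + h) - f z - d * h) / h.
  by rewrite /D [h + z]addrC mulrBl mulfK// [h^-1 * _]mulrC.
have h0' : 0 < normc h by rewrite normc_gt0.
rewrite normcM normcV ltr_pdivrMr//; apply: le_lt_trans (hr h hhr) _.
by rewrite ltr_pM2r// gtr_pMr// invf_lt1// ltr1n.
Qed.

Lemma cderivable_continuous f z :
  cderivable f z -> {for z, continuous (f : C^o -> C^o)}.
Proof. by move=> h; exact/differentiable_continuous/derivable1_diffP. Qed.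

Lemma cderivable_comp f g z :
  cderivable f z -> cderivable g (f z) -> cderivable (fun z => g (f z)) z.
Proof.
move=> /derivable1_diffP df /derivable1_diffP dg; apply/derivable1_diffP.
exact: (@differentiable_comp _ C^o C^o C^o f g z df dg).
Qed.

Lemma cderivableM f g z : cderivable f z -> cderivable g z ->
  cderivable (fun z => f z * g z) z.
Proof. exact: derivableM. Qed.

Lemma cderivableD f g z : cderivable f z -> cderivable g z ->
  cderivable (fun z => f z + g z) z.
Proof. exact: derivableD. Qed.

Lemma cderivableB f g z : cderivable f z -> cderivable g z ->
  cderivable (fun z => f z - g z) z.
Proof. exact: derivableB. Qed.

Lemma cderivableV f z : f z != 0 -> cderivable f z ->
  cderivable (fun z => (f z)^-1) z.
Proof. exact: derivableV. Qed.

Lemma cderivable_id z : cderivable id z.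
Proof. exact: (@derivable_id _ C^o). Qed.

Lemma cderivable_cst (c : C) z : cderivable (fun=> c) z.
Proof. exact: (@derivable_cst _ C^o C^o). Qed.

Lemma cderivableX f n z : cderivable f z -> cderivable (fun z => f z ^+ n) z.
Proof.
move=> h; elim: n => [|n ih]; first exact: cderivable_cst.
have -> : (fun z => f z ^+ n.+1) = (fun z => f z * f z ^+ n).
  by apply/funext => x; rewrite exprS.
exact: cderivableM.
Qed.

Lemma eq_cderivable f g z (r : R) : 0 < r ->
  (forall w, normc (w - z) < r -> f w = g w) -> cderivable f z -> cderivable g z.
Proof.
move=> r0 fg /cderivableP[d hd]; apply/cderivableP; exists d => e e0.
have [s s0 hs] := hd e e0; exists (Num.min r s); first by rewrite lt_min r0.
move=> h; rewrite lt_min => /andP[hr hss].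
rewrite -!fg ?subrr ?normc0//; first exact: hs.
by rewrite addrAC subrr add0r.
Qed.

Lemma continuousC_comp f g z : {for z, continuous (f : C^o -> C^o)} ->
  {for f z, continuous (g : C^o -> C^o)} ->
  {for z, continuous ((fun z => g (f z)) : C^o -> C^o)}.
Proof. exact: continuous_comp. Qed.

Lemma continuousCM (T : topologicalType) (f g : T -> C) x :
  {for x, continuous (f : T -> C^o)} -> {for x, continuous (g : T -> C^o)} ->
  {for x, continuous ((fun t => f t * g t) : T -> C^o)}.
Proof. by move=> cf cg; exact: (@continuousM _ T (f : T -> C^o) g x cf cg). Qed.

Lemma continuousCV (T : topologicalType) (f : T -> C) x : f x != 0 ->
  {for x, continuous (f : T -> C^o)} ->
  {for x, continuous ((fun t => (f t)^-1) : T -> C^o)}.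
Proof. by move=> f0 cf; exact: (@continuousV _ T (f : T -> C^o) x f0 cf). Qed.

Lemma continuousCX (T : topologicalType) (f : T -> C) n x :
  {for x, continuous (f : T -> C^o)} ->
  {for x, continuous ((fun t => f t ^+ n) : T -> C^o)}.
Proof.
move=> cf; elim: n => [|n ih]; first exact: (@cst_continuous T C^o).
have -> : (fun t => f t ^+ n.+1) = (fun t => f t * f t ^+ n).
  by apply/funext => t; rewrite exprS.
exact: continuousCM.
Qed.

End complex_basics.
Notation cderivable f z := (derivable (f : _^o -> _^o) (z : _^o) 1).

(** * Integrals of complex-valued functions *)

Section complex_integral.
Context {R : realType}.
Local Notation C := R[i].
Local Notation leb := (@lebesgue_measure R).
Implicit Types (g h : R -> C) (a b c : R).

Definition ccontR g a b :=
  forall t, a <= t <= b -> {for t, continuous (g : R -> C^o)}.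

Definition cint g a b : C :=
  (\int[leb]_(t in `[a, b]) complex.Re (g t)) +i*
  (\int[leb]_(t in `[a, b]) complex.Im (g t)).

Lemma ReC_continuous : continuous (@complex.Re R : C^o -> R).
Proof.
move=> z; apply/(@cvgrPdist_lt R R _ (nbhs (z : C^o))) => e e0.
apply/nbhsCP; exists e => // w h; apply: le_lt_trans h.
by rewrite normcB -raddfB; exact: ler_Re.
Qed.

Lemma ImC_continuous : continuous (@complex.Im R : C^o -> R).
Proof.
move=> z; apply/(@cvgrPdist_lt R R _ (nbhs (z : C^o))) => e e0.
apply/nbhsCP; exists e => // w h; apply: le_lt_trans h.
by rewrite normcB -raddfB; exact: ler_Im.
Qed.

Lemma cont_integrable (u : R -> R) a b :
  (forall t, a <= t <= b -> {for t, continuous u}) ->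
  leb.-integrable `[a, b] (EFin \o u).
Proof.
move=> h; apply: continuous_compact_integrable; first exact: segment_compact.
by apply: continuous_in_subspaceT => t; rewrite inE/= in_itv/=; exact: h.
Qed.

Lemma ccontR_Re g a b : ccontR g a b ->
  forall t, a <= t <= b -> {for t, continuous (fun t => complex.Re (g t))}.
Proof.
move=> h t /h ct; apply: (@continuous_comp R C^o R g (@complex.Re R)) => //.
exact: ReC_continuous.
Qed.

Lemma ccontR_Im g a b : ccontR g a b ->
  forall t, a <= t <= b -> {for t, continuous (fun t => complex.Im (g t))}.
Proof.
move=> h t /h ct; apply: (@continuous_comp R C^o R g (@complex.Im R)) => //.
exact: ImC_continuous.
Qed.

Lemma ccontR_intRe g a b : ccontR g a b ->
  leb.-integrable `[a, b] (EFin \o (fun t => complex.Re (g t))).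
Proof. by move=> h; apply: cont_integrable; exact: ccontR_Re. Qed.

Lemma ccontR_intIm g a b : ccontR g a b ->
  leb.-integrable `[a, b] (EFin \o (fun t => complex.Im (g t))).
Proof. by move=> h; apply: cont_integrable; exact: ccontR_Im. Qed.

Lemma ccontRB g h a b : ccontR g a b -> ccontR h a b ->
  ccontR (fun t => g t - h t) a b.
Proof.
move=> cg ch t tab.
exact: (@continuousB _ C^o R (g : R -> C^o) h t (cg t tab) (ch t tab)).
Qed.

Lemma ccontRD g h a b : ccontR g a b -> ccontR h a b ->
  ccontR (fun t => g t + h t) a b.
Proof.
move=> cg ch t tab.
exact: (@continuousD _ C^o R (g : R -> C^o) h t (cg t tab) (ch t tab)).
Qed.

Lemma ccontRM g h a b : ccontR g a b -> ccontR h a b ->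
  ccontR (fun t => g t * h t) a b.
Proof.
move=> cg ch t tab.
exact: (@continuousM _ R (g : R -> C^o) h t (cg t tab) (ch t tab)).
Qed.

Lemma ccontR_cst (k : C) a b : ccontR (fun=> k) a b.
Proof. by move=> t _; exact: (@cst_continuous R C^o). Qed.

Lemma eq_cint g h a b : (forall t, a <= t <= b -> g t = h t) ->
  cint g a b = cint h a b.
Proof.
move=> gh; congr (_ +i* _); apply: eq_Rintegral => t; rewrite inE/= in_itv/= => /gh->//.
Qed.

Lemma cintB g h a b : ccontR g a b -> ccontR h a b ->
  cint (fun t => g t - h t) a b = cint g a b - cint h a b.
Proof.
move=> cg ch.
rewrite -[RHS]/((_ - _) +i* (_ - _)); congr (_ +i* _).
  rewrite -RintegralB//; [|exact: ccontR_intRe..].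
  by apply: eq_Rintegral => t _; rewrite raddfB.
rewrite -RintegralB//; [|exact: ccontR_intIm..].
by apply: eq_Rintegral => t _; rewrite raddfB.
Qed.

Lemma cintD g h a b : ccontR g a b -> ccontR h a b ->
  cint (fun t => g t + h t) a b = cint g a b + cint h a b.
Proof.
move=> cg ch.
rewrite -[RHS]/((_ + _) +i* (_ + _)); congr (_ +i* _).
  rewrite -RintegralD//; [|exact: ccontR_intRe..].
  by apply: eq_Rintegral => t _; rewrite raddfD.
rewrite -RintegralD//; [|exact: ccontR_intIm..].
by apply: eq_Rintegral => t _; rewrite raddfD.
Qed.

Lemma cintZ (k : C) g a b : ccontR g a b ->
  cint (fun t => k * g t) a b = k * cint g a b.
Proof.
move=> cg; case: k => x y.
have iR := ccontR_intRe cg; have iI := ccontR_intIm cg.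
have iZ (r : R) (u : R -> R) : leb.-integrable `[a, b] (EFin \o u) ->
    leb.-integrable `[a, b] (EFin \o (fun t => r * u t)).
  by move=> iu; exact: (@integrableZl _ _ _ leb `[a, b]%classic (measurable_itv _) r (EFin \o u) iu).
rewrite -[RHS]/((x * _ - y * _) +i* (x * _ + y * _)); congr (_ +i* _).
  rewrite -!RintegralZl// -RintegralB//; [|exact: iZ..].
  by apply: eq_Rintegral => t _; case: (g t).
rewrite -!RintegralZl// -RintegralD//; [|exact: iZ..].
by apply: eq_Rintegral => t _; case: (g t).
Qed.

Lemma Rint_itv_cst (r : R) a b : a <= b -> \int[leb]_(t in `[a, b]) r = r * (b - a).
Proof. by move=> ab; rewrite Rintegral_cst//= lebesgue_measure_itv/= lte_fin; move: ab; rewrite le_eqVlt => /predU1P[->|->//]; rewrite ltxx subrr. Qed.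

Lemma cint_cst (k : C) a b : a <= b -> cint (fun=> k) a b = k * (b - a)%:C.
Proof.
move=> ab; rewrite /cint !Rint_itv_cst//; case: k => x y /=.
by apply/eqP; rewrite eq_complex /=; apply/andP; split; apply/eqP; ring.
Qed.

Lemma cint_split g a b c : a <= c -> c <= b -> ccontR g a b ->
  cint g a b = cint g a c + cint g c b.
Proof.
move=> ac cb cg.
have H (u : R -> R) : leb.-integrable `[a, b] (EFin \o u) ->
    \int[leb]_(t in `[a, b]) u t =
    \int[leb]_(t in `[a, c]) u t + \int[leb]_(t in `[c, b]) u t.
  move=> iu; have := @Rintegral_itvB R u (BLeft a) (BRight b) c iu.
  rewrite !bnd_simp => /(_ ac cb).
  rewrite Rintegral_itv_obnd_cbnd; last first.
    by apply: integrableS iu => //; apply: subset_itvr; rewrite bnd_simp.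
  by move=> <-; rewrite addrC subrK.
rewrite -[RHS]/((_ + _) +i* (_ + _)); congr (_ +i* _); apply: H.
  exact: ccontR_intRe.
exact: ccontR_intIm.
Qed.

Lemma Rint_normr (u v : R -> R) a b :
  (forall t, a <= t <= b -> {for t, continuous u}) ->
  (forall t, a <= t <= b -> {for t, continuous v}) ->
  (forall t, a <= t <= b -> `|u t| <= v t) ->
  `|\int[leb]_(t in `[a, b]) u t| <= \int[leb]_(t in `[a, b]) v t.
Proof.
move=> cu cv uv; have iu := cont_integrable cu.
apply: le_trans (le_normr_Rintegral _ iu) _ => //; apply: le_Rintegral => //.
- exact: (integrable_norm iu).
- exact: cont_integrable.
Qed.

(** Real and imaginary parts are bounded separately, whence the factor 2; it is the 2 of [fcoef_le]
    and one of the two factors 2 in the 4 of [caratheodory]. *)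
Lemma cint_norm_le g (v : R -> R) a b : ccontR g a b ->
  (forall t, a <= t <= b -> {for t, continuous v}) ->
  (forall t, a <= t <= b -> normc (g t) <= v t) ->
  normc (cint g a b) <= 2 * \int[leb]_(t in `[a, b]) v t.
Proof.
move=> cg cv gv; apply: le_trans (normc_leReIm _) _.
rewrite mulr_natl mulr2n; apply: lerD; apply: Rint_normr => //.
- exact: ccontR_Re.
- by move=> t /gv; exact/le_trans/ler_Re.
- exact: ccontR_Im.
- by move=> t /gv; exact/le_trans/ler_Im.
Qed.

Lemma cint_le g (M : R) a b : a <= b -> ccontR g a b ->
  (forall t, a <= t <= b -> normc (g t) <= M) ->
  normc (cint g a b) <= 2 * (M * (b - a)).
Proof.
move=> ab cg gM; rewrite -Rint_itv_cst//.
by apply: (@cint_norm_le g (fun=> M)) => // t _; exact: cst_continuous.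
Qed.

Lemma cint_conj g a b : ccontR g a b ->
  cint (fun t => conjc (g t)) a b = conjc (cint g a b).
Proof.
move=> cg; rewrite /cint /=; congr (_ +i* _).
  by apply: eq_Rintegral => t _; case: (g t).
rewrite -mulN1r -RintegralZl//; last exact: ccontR_intIm.
by apply: eq_Rintegral => t _; rewrite mulN1r; case: (g t).
Qed.

Lemma lebesgue_measure_shift (p : R) (A : set R) : measurable A ->
  leb ((fun x => x + p) @^-1` A) = leb A.
Proof.
have mp : measurable_fun setT (fun x : measurableTypeR R => x + p : measurableTypeR R).
  exact: measurable_funD.
pose phi : {mfun measurableTypeR R >-> measurableTypeR R} :=
  HB.pack (fun x : measurableTypeR R => x + p : measurableTypeR R)
    (isMeasurableFun.Build _ _ _ _ _ mp).
move=> mA; apply/esym.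
apply: (@lebesgue_measure_unique R (pushforward leb phi)) => //= _ [[a b]] _ <-.
rewrite /pushforward.
have -> : phi @^-1` `]a, b] = `]a - p, b - p]%classic.
  by apply/seteqP; split => x /=; rewrite !in_itv/= ltrBlDr lerBrDr.
by rewrite !lebesgue_measure_itv/= !lte_fin ltrBlDr subrK -!EFinB; congr (if _ then _%:E else _); ring.
Qed.

Lemma Rint_shift (u : R -> R) p a b :
  (forall t, a <= t <= b -> {for t + p, continuous u}) ->
  \int[leb]_(t in `[a + p, b + p]) u t = \int[leb]_(t in `[a, b]) u (t + p).
Proof.
move=> cu; congr fine.
have cu' t : a + p <= t <= b + p -> {for t, continuous u}.
  by move=> abt; rewrite -[t](subrK p); apply: cu; rewrite lerBrDr lerBlDr.
have iu := cont_integrable cu'.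
have E : (fun x => x + p) @^-1` `[a + p, b + p] = `[a, b]%classic.
  by apply/seteqP; split => x /=; rewrite !in_itv/= !lerD2r.
have mp : measurable_fun setT (fun x : measurableTypeR R => x + p : measurableTypeR R).
  exact: measurable_funD.
(* Extension by zero makes the integrand measurable on the whole line, as the change of variables
   requires. *)
pose v : R -> \bar R := (EFin \o u) \_ `[(a + p)%R, (b + p)%R].
transitivity (\int[leb]_(x in `[a, b]) (v \o (fun y : R => (y + p)%R)) x)%E; last first.
  by apply: eq_integral => x; rewrite -{1}E inE /= => hx; rewrite /v /patch/= mem_set.
rewrite -E -(@integral_pushforward _ _ _ _ _ _ mp leb `[a + p, b + p]
  ((EFin \o u) \_ `[a + p, b + p])).
- rewrite [LHS](@eq_integral _ _ _ leb _ ((EFin \o u) \_ `[a + p, b + p])); last first.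
    by move=> x xab; rewrite /patch xab.
  by apply: eq_measure_integral => A mA _; exact/esym/lebesgue_measure_shift.
- by apply/(measurable_restrictT _ (measurable_itv _)); exact: (measurable_int _ iu).
- rewrite E; apply: (@eq_integrable _ _ _ leb _ _ (EFin \o (fun t => u (t + p)))) => //.
    by move=> x; rewrite -{1}E inE /= => hx; rewrite /patch/= mem_set//.
  apply: cont_integrable => t tab; apply: (@continuous_comp R R R (fun t => t + p) u).
    by apply: cvgD; [exact: cvg_id|exact: cvg_cst].
  exact: cu.
- exact: measurable_itv.
Qed.

Lemma cint_shift g p a b : ccontR g (a + p) (b + p) ->
  cint g (a + p) (b + p) = cint (fun t => g (t + p)) a b.
Proof.
move=> cg; rewrite /cint; congr (_ +i* _); apply: Rint_shift => t tab.
  by apply: (ccontR_Re cg); rewrite !lerD2r.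
by apply: (ccontR_Im cg); rewrite !lerD2r.
Qed.

(** The intervals [[a, a + p]] and [[0, p]] share [[0, a + p]], and the remaining pieces [[a, 0]]
    and [[a + p, p]] are translates by [p]. *)
Lemma cint_period g p a : - p <= a <= 0 ->
  (forall t, {for t, continuous (g : R -> C^o)}) ->
  (forall t, g (t + p) = g t) -> cint g a (a + p) = cint g 0 p.
Proof.
move=> /andP[pa a0] cg gp.
have cgab x y : ccontR g x y by move=> t _; exact: cg.
rewrite (@cint_split _ _ _ 0)//; last by rewrite -lerBlDr sub0r.
rewrite [RHS](@cint_split _ _ _ (a + p))//; [|by rewrite -lerBlDr sub0r|by rewrite gerDr].
rewrite addrC; congr (_ + _); have := @cint_shift g p a 0.
rewrite add0r => -> //.
by apply: eq_cint => t _; rewrite gp.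
Qed.

End complex_integral.

(** * The complex exponential and integrals over rectangles *)

Section complex_exponential.
Context {R : realType}.
Local Notation C := R[i].
Implicit Types (z w : C).

Definition cexp z : C :=
  (expR (complex.Re z) * cos (complex.Im z)) +i*
  (expR (complex.Re z) * sin (complex.Im z)).

Lemma cexpD z w : cexp (z + w) = cexp z * cexp w.
Proof.
case: z w => [a b] [c d]; rewrite /cexp /= expRD cosD sinD.
by apply/eqP; rewrite eq_complex /=; apply/andP; split; apply/eqP; ring.
Qed.

Lemma normc_cexp z : normc (cexp z) = expR (complex.Re z).
Proof.
case: z => a b; rewrite /cexp /= !exprMn -mulrDr cos2Dsin2 mulr1.
by rewrite sqrtr_sqr ger0_norm// expR_ge0.
Qed.

Lemma cexp_neq0 z : cexp z != 0.
Proof. by rewrite -normc_gt0 normc_cexp expR_gt0. Qed.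

Lemma cexp_period (x y : R) : cexp (x +i* (y + pi *+ 2)) = cexp (x +i* y).
Proof. by rewrite /cexp /= cosD2pi sinD2pi. Qed.

Lemma is_derive_expand (u : R -> R) (x du e : R) : is_derive x 1 u du -> 0 < e ->
  exists2 r : R, 0 < r & forall h : R, `|h| < r -> `|u (x + h) - u x - du * h| <= e * `|h|.
Proof.
move=> [hd <-] e0; have /cvgrPdist_lt/(_ e e0) := hd.
move=> /nbhs_ballP[r /= r0 H]; exists r => // h hr.
have [->|h0] := eqVneq h 0; first by rewrite addr0 mulr0 subr0 subrr normr0 mulr0.
have := H h; rewrite /ball/= sub0r normrN => /(_ hr h0) /ltW.
rewrite /shift /= -[_ *: (_ - _)]/(h^-1 * (u (h *: 1 + x) - u x)) -[h *: 1]/(h * 1) mulr1 => hh.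
have -> : u (x + h) - u x - 'D_1 u x * h = - (('D_1 u x - h^-1 * (u (h + x) - u x)) * h).
  by rewrite mulrBl mulrAC mulVf// mul1r opprB [h + x]addrC.
by rewrite normrN normrM ler_wpM2r.
Qed.

Lemma cexp_deriv0 : has_cderiv (@cexp) 0 1.
Proof.
(* 9 = 4 + 5, the constants of [T1] and [T2]; the cap 1 serves to get [expR a <= 3]. *)
move=> e e0; pose k : R := Num.min 1 (e / 9).
have k0 : 0 < k by rewrite lt_min ltr01 divr_gt0.
have [k1 ke] : k <= 1 /\ k <= e / 9 by rewrite /k !ge_min !lexx orbT.
clearbody k.
have [r1 r10 h1] := is_derive_expand (is_derive_expR 0) k0.
have [r2 r20 h2] := is_derive_expand (is_derive_cos 0) k0.
have [r3 r30 h3] := is_derive_expand (is_derive_sin 0) k0.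
exists (Num.min (Num.min r1 r2) (Num.min r3 k)).
  by rewrite !lt_min r10 r20 r30.
move=> [a b]; rewrite !lt_min => /andP[/andP[hr1 hr2] /andP[hr3 hk]].
have na : `|a| <= normc (a +i* b) := ler_Re (a +i* b).
have nb : `|b| <= normc (a +i* b) := ler_Im (a +i* b).
have := h1 a (le_lt_trans na hr1); rewrite add0r expR0 mul1r => s1.
have := h2 b (le_lt_trans nb hr2).
rewrite add0r cos0 sin0 oppr0 mul0r subr0 => s2.
have := h3 b (le_lt_trans nb hr3); rewrite add0r cos0 sin0 mul1r subr0 => s3.
have ak := le_lt_trans na hk.
rewrite add0r mul1r.
have -> : cexp (a +i* b) - cexp 0 - (a +i* b) =
  (expR a * (cos b - 1) + (expR a - 1 - a)) +i* (expR a * (sin b - b) + (expR a - 1) * b).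
  rewrite /cexp /= expR0 cos0 sin0.
  by apply/eqP; rewrite eq_complex /=; apply/andP; split; apply/eqP; ring.
apply: le_trans (normc_toC (_, _)) _ => /=.
set N := normc _ in na nb hk *.
have N0 : 0 <= N by exact: normc_ge0.
have ka : k * `|a| <= `|a| by rewrite ler_piMl.
have E1 : `|expR a - 1| <= 2 * `|a|.
  have -> : expR a - 1 = (expR a - 1 - a) + a by ring.
  by apply: le_trans (ler_normD _ _) _; lra.
have E3 : expR a <= 3.
  by have := ler_norm (expR a - 1); lra.
have ea := expR_ge0 a.
have T1 : `|expR a * (cos b - 1) + (expR a - 1 - a)| <= 4 * (k * N).
  apply: le_trans (ler_normD _ _) _; rewrite normrM (ger0_norm ea).
  have := ler_pM ea (normr_ge0 _) E3 s2.
  have := ler_wpM2l (ltW k0) nb; have := ler_wpM2l (ltW k0) na; lra.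
have T2 : `|expR a * (sin b - b) + (expR a - 1) * b| <= 5 * (k * N).
  apply: le_trans (ler_normD _ _) _; rewrite !normrM (ger0_norm ea).
  have := ler_pM ea (normr_ge0 _) E3 s3.
  have q1 : `|expR a - 1| <= 2 * k by lra.
  have := ler_pM (normr_ge0 _) (normr_ge0 b) q1 nb.
  have := ler_wpM2l (ltW k0) nb; lra.
have h9 : 9 * (k * N) <= e * N by rewrite mulrA ler_wpM2r//; lra.
by apply: (le_trans (lerD T1 T2)); apply: le_trans h9; lra.
Qed.

Lemma cexp_cderivable z : cderivable cexp z.
Proof.
apply/cderivableP; exists (cexp z) => e e0.
have nz : 0 < normc (cexp z) by rewrite normc_gt0 cexp_neq0.
have [r r0 hr] := cexp_deriv0 (divr_gt0 e0 nz); exists r => // h /hr.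
have c0 : cexp 0 = 1 by rewrite /cexp /= expR0 cos0 sin0 mulr1 mulr0.
rewrite add0r mul1r c0 => H.
have -> : cexp (z + h) - cexp z - cexp z * h = cexp z * (cexp h - 1 - h).
  by rewrite cexpD; ring.
rewrite normcM -[e](divfK (lt0r_neq0 nz)) [_ * normc (cexp z)]mulrC -mulrA.
by rewrite ler_pM2l.
Qed.

Lemma exists_arg z : exists2 t : R, - pi <= t <= pi & z = (normc z)%:C * cexp (0 +i* t).
Proof.
have [->|z0] := eqVneq z 0.
  by exists 0; [rewrite oppr_le0 pi_ge0|rewrite normc0 mul0r].
have n0 : 0 < normc z by rewrite normc_gt0.
pose x := complex.Re z / normc z.
have x1 : -1 <= x <= 1.
  rewrite -ler_norml normrM normfV (ger0_norm (normc_ge0 _)).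
  by rewrite ler_pdivrMr// mul1r ler_Re.
have [a0 ap] := (acos_ge0 x1, acos_lepi x1).
have sq : normc z * Num.sqrt (1 - x ^+ 2) = `|complex.Im z|.
  rewrite -{1}[normc z]ger0_norm ?normc_ge0// -sqrtr_sqr -sqrtrM ?sqr_ge0//.
  rewrite -sqrtr_sqr; congr Num.sqrt; rewrite mulrBr mulr1 /x expr_div_n.
  by rewrite mulrC divfK ?expf_neq0 ?gt_eqF// normc_sqr addrC addKr.
have cx : normc z * cos (acos x) = complex.Re z.
  by rewrite acosK ?in_itv// mulrC divfK ?gt_eqF.
have p0 := @pi_ge0 R.
have [i0|i0] := leP 0 (complex.Im z).
  exists (acos x); first by lra.
  apply/eqP; rewrite /cexp /= expR0 !mul1r sin_acos// eq_complex /=.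
  by rewrite !mul0r subr0 addr0 cx sq ger0_norm// !eqxx.
exists (- acos x); first by lra.
apply/eqP; rewrite /cexp /= expR0 !mul1r cosN sinN sin_acos// eq_complex /=.
by rewrite !mul0r subr0 addr0 cx mulrN sq ltr0_norm// opprK !eqxx.
Qed.

Lemma cos_eq1 (t : R) : - (pi *+ 2) < t < pi *+ 2 -> cos t = 1 -> t = 0.
Proof.
move=> /andP[t1 t2] ct; apply/eqP; apply: contraT => t0.
wlog tp : t t0 t1 t2 ct / 0 < t => [H|].
  have [/(H _ t0 t1 t2 ct)//|] := ltP 0 t; rewrite le_eqVlt (negbTE t0) /= => tn.
  by apply: (H (- t)); rewrite ?oppr_eq0 ?cosN ?oppr_gt0 ?ltrN2 1?ltrNl.
(* Half angle: [cos t = 1 - 2 sin(t/2)^2], and [t/2] lies strictly between 0 and [pi]. *)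
have : 0 < sin (t / 2) by apply: sin_gt0_pi; rewrite divr_gt0//= ltr_pdivrMr// mulr_natr.
have := cos_mulr2n (t / 2); have -> : (t / 2) *+ 2 = t by rewrite -mulr_natr divfK.
rewrite ct cos2sin2 => h s0.
by have : 0 < sin (t / 2) ^+ 2; [rewrite exprn_gt0|lra].
Qed.

Lemma cexp_inj (x y u v : R) : `|y - v| < pi *+ 2 -> cexp (x +i* y) = cexp (u +i* v) ->
  x = u /\ y = v.
Proof.
move=> yv E.
have xu : x = u.
  by have := congr1 (@normc R) E; rewrite !normc_cexp => /expR_inj.
split=> //; move: E; rewrite /cexp /= xu => -[].
have e0 : expR u != 0 by rewrite gt_eqF// expR_gt0.
move=> /(mulfI e0) c /(mulfI e0) s.
have : cos (y - v) = 1 by rewrite cosB c s -!expr2 cos2Dsin2.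
by move=> /cos_eq1 H; apply/eqP; rewrite -subr_eq0 H// -ltr_norml.
Qed.

End complex_exponential.

(** * Boundary integrals over rectangles *)

Section goursat.
Context {R : realType}.
Local Notation C := R[i].
Implicit Types (F G : C -> C) (a b c d x y : R).

Definition rectcont F a b c d := forall x y, a <= x <= b -> c <= y <= d ->
  {for (x +i* y : C^o), continuous (F : C^o -> C^o)}.

(** The counterclockwise boundary integral with opposite sides paired: [dz] is [dx] on the
    horizontal sides and [i dy] on the vertical ones. *)
Definition rectint F a b c d : C :=
  cint (fun x => F (x +i* c) - F (x +i* d)) a b +
  (0 +i* 1) * cint (fun y => F (b +i* y) - F (a +i* y)) c d.

Lemma horiz_continuous y : continuous (fun x : R => (x +i* y : C^o)).
Proof.
move=> x; apply/(@cvgCP R R (nbhs x)) => e e0; apply/nbhs_ballP; exists e => // w.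
move=> xw; apply: le_lt_trans (normc_leReIm _) _ => /=.
by rewrite subrr normr0 addr0 distrC.
Qed.

Lemma vert_continuous x : continuous (fun y : R => (x +i* y : C^o)).
Proof.
move=> y; apply/(@cvgCP R R (nbhs y)) => e e0; apply/nbhs_ballP; exists e => // w.
move=> xw; apply: le_lt_trans (normc_leReIm _) _ => /=.
by rewrite subrr normr0 add0r distrC.
Qed.

Lemma rectcont_h F a b c d y : rectcont F a b c d -> c <= y <= d ->
  ccontR (fun x => F (x +i* y)) a b.
Proof.
move=> h yc x xab; apply: (@continuous_comp R C^o C^o (fun x => x +i* y) F).
  exact: horiz_continuous.
exact: h.
Qed.

Lemma rectcont_v F a b c d x : rectcont F a b c d -> a <= x <= b ->
  ccontR (fun y => F (x +i* y)) c d.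
Proof.
move=> h xab y yc; apply: (@continuous_comp R C^o C^o (fun y => x +i* y) F).
  exact: vert_continuous.
exact: h.
Qed.

Lemma rectcontS F a b c d a' b' c' d' : a <= a' -> b' <= b -> c <= c' -> d' <= d ->
  rectcont F a b c d -> rectcont F a' b' c' d'.
Proof.
move=> aa bb cc dd h x y /andP[x1 x2] /andP[y1 y2]; apply: h; apply/andP; split.
- exact: le_trans aa x1.
- exact: le_trans x2 bb.
- exact: le_trans cc y1.
- exact: le_trans y2 dd.
Qed.

Lemma rectint_splitx F a b c d m : a <= m <= b -> c <= d -> rectcont F a b c d ->
  rectint F a b c d = rectint F a m c d + rectint F m b c d.
Proof.
move=> /andP[am mb] cd h; rewrite /rectint (@cint_split _ _ a b m)//; last first.
  by apply: ccontRB; apply: rectcont_h h _; rewrite lexx cd.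
rewrite addrACA -mulrDr -cintD; last 2 first.
- by apply: ccontRB; apply: rectcont_v h _; rewrite ?am ?lexx ?(le_trans am mb).
- by apply: ccontRB; apply: rectcont_v h _; rewrite ?am ?lexx ?(le_trans am mb).
by congr (_ + _ * _); apply: eq_cint => t _; ring.
Qed.

Lemma rectint_splity F a b c d m : c <= m <= d -> a <= b -> rectcont F a b c d ->
  rectint F a b c d = rectint F a b c m + rectint F a b m d.
Proof.
move=> /andP[cm md] ab h; rewrite /rectint (@cint_split _ _ c d m)//; last first.
  by apply: ccontRB; apply: rectcont_v h _; rewrite lexx ab.
rewrite mulrDr addrACA -cintD; last 2 first.
- by apply: ccontRB; apply: rectcont_h h _; rewrite ?cm ?lexx ?(le_trans cm md).
- by apply: ccontRB; apply: rectcont_h h _; rewrite ?cm ?lexx ?(le_trans cm md).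
by congr (_ + _); apply: eq_cint => t _; ring.
Qed.

(** For the affine function the horizontal sides give [B * i(c - d) * (b - a)], and the vertical
    ones the opposite. *)
Lemma rectint_affine (A B : C) F a b c d : a <= b -> c <= d -> rectcont F a b c d ->
  rectint (fun z => F z - (A + B * z)) a b c d = rectint F a b c d.
Proof.
move=> ab cd h; rewrite /rectint.
have -> : cint (fun x => F (x +i* c) - (A + B * (x +i* c)) - (F (x +i* d) - (A + B * (x +i* d)))) a b =
  cint (fun x => F (x +i* c) - F (x +i* d)) a b - (B * (0 +i* (c - d))) * (b - a)%:C.
  rewrite -cint_cst// -cintB.
  - apply: eq_cint => t _; rewrite -[0 +i* (c - d)]/(0 +i* (c - d)).
    have -> : (0 +i* (c - d) : C) = (t +i* c) - (t +i* d).
      by apply/eqP; rewrite eq_complex /= subrr !eqxx.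
    ring.
  - by apply: ccontRB; apply: rectcont_h h _; rewrite lexx cd.
  - exact: ccontR_cst.
have -> : cint (fun y => F (b +i* y) - (A + B * (b +i* y)) - (F (a +i* y) - (A + B * (a +i* y)))) c d =
  cint (fun y => F (b +i* y) - F (a +i* y)) c d - (B * (b - a)%:C) * (d - c)%:C.
  rewrite -cint_cst// -cintB.
  - apply: eq_cint => t _.
    have -> : ((b - a)%:C : C) = (b +i* t) - (a +i* t).
      by apply/eqP; rewrite eq_complex /= subrr !eqxx.
    ring.
  - by apply: ccontRB; apply: rectcont_v h _; rewrite lexx ab.
  - exact: ccontR_cst.
have -> : (0 +i* (c - d) : C) = - ((0 +i* 1) * (d - c)%:C).
  by apply/eqP; rewrite eq_complex /=; apply/andP; split; apply/eqP; ring.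
ring.
Qed.

Lemma rectint_le F a b c d (M : R) : a <= b -> c <= d -> rectcont F a b c d ->
  (forall x y, a <= x <= b -> c <= y <= d -> normc (F (x +i* y)) <= M) ->
  normc (rectint F a b c d) <= 4 * M * ((b - a) + (d - c)).
Proof.
move=> ab cd h hM; apply: le_trans (le_normcD _ _) _; rewrite normcM.
have -> : normc (0 +i* 1 : C) = 1 by rewrite /= expr0n expr1n add0r sqrtr1.
have B (z w : C) : normc z <= M -> normc w <= M -> normc (z - w) <= M + M.
  by move=> zM wM; apply: le_trans (le_normcD _ _) _; rewrite normcN lerD.
have H1 : normc (cint (fun x => F (x +i* c) - F (x +i* d)) a b) <= 2 * ((M + M) * (b - a)).
  apply: cint_le => //; first by apply: ccontRB; apply: rectcont_h h _; rewrite lexx cd.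
  by move=> t tab; apply: B; apply: hM; rewrite ?lexx ?cd.
have H2 : normc (cint (fun y => F (b +i* y) - F (a +i* y)) c d) <= 2 * ((M + M) * (d - c)).
  apply: cint_le => //; first by apply: ccontRB; apply: rectcont_v h _; rewrite lexx ab.
  by move=> t tcd; apply: B; apply: hM; rewrite ?lexx ?ab.
rewrite mul1r; lra.
Qed.

End goursat.

(** * Cauchy's theorem *)

Section cauchy_theorem.
Context {R : realType}.
Local Notation C := R[i].
Implicit Types (F : C -> C) (a b c d x y : R).

Lemma diskE (z : C) : disk z = (normc z < 1) :> Prop.
Proof. by []. Qed.

Lemma exists_pow2_gt (x : R) : exists n, x < 2 ^+ n.
Proof.
exists (Num.bound `|x|); apply: le_lt_trans (ler_norm x) _.
apply: lt_trans (archi_boundP (normr_ge0 x)) _.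
by rewrite -natrX ltr_nat ltn_expl.
Qed.

(** The four quarters add up to the whole, so one of them carries at least a quarter of its norm. *)
Lemma rectint_quarter F a b c d : a <= b -> c <= d -> rectcont F a b c d ->
  exists q : (R * R) * (R * R),
    [/\ [/\ a <= q.1.1, q.1.1 <= q.1.2, q.1.2 <= b & q.1.2 - q.1.1 = (b - a) / 2],
        [/\ c <= q.2.1, q.2.1 <= q.2.2, q.2.2 <= d & q.2.2 - q.2.1 = (d - c) / 2] &
        normc (rectint F a b c d) <= 4 * normc (rectint F q.1.1 q.1.2 q.2.1 q.2.2)].
Proof.
move=> ab cd h; pose m := (a + b) / 2; pose n := (c + d) / 2.
have [am mb] : a <= m /\ m <= b by rewrite /m; lra.
have [cn nd] : c <= n /\ n <= d by rewrite /n; lra.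
have [e1 e2] : m - a = (b - a) / 2 /\ b - m = (b - a) / 2 by rewrite /m; split; field.
have [e3 e4] : n - c = (d - c) / 2 /\ d - n = (d - c) / 2 by rewrite /n; split; field.
have E : rectint F a b c d = rectint F a m c n + rectint F a m n d +
    (rectint F m b c n + rectint F m b n d).
  rewrite (@rectint_splitx _ _ _ _ _ _ m) ?am//.
  by congr (_ + _); rewrite (@rectint_splity _ _ _ _ _ _ n) ?cn//; exact: rectcontS h.
have := le_normcD (rectint F a m c n + rectint F a m n d) (rectint F m b c n + rectint F m b n d).
rewrite -E; set I := normc (rectint F a b c d) => le1.
have le2 := le_normcD (rectint F a m c n) (rectint F a m n d).
have le3 := le_normcD (rectint F m b c n) (rectint F m b n d).
have [h0|h1] := leP I (4 * normc (rectint F a m c n)).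
  by exists ((a, m), (c, n)); split; [split|split|exact: h0].
have [h0|h2] := leP I (4 * normc (rectint F a m n d)).
  by exists ((a, m), (n, d)); split; [split|split|exact: h0].
have [h0|h3] := leP I (4 * normc (rectint F m b c n)).
  by exists ((m, b), (c, n)); split; [split|split|exact: h0].
have h4 : I <= 4 * normc (rectint F m b n d) by lra.
exists ((m, b), (n, d)); split; last exact: h4.
- by split.
- by split.
Qed.

Lemma nested_intervals (u v : nat -> R) :
  (forall n, [/\ u n <= u n.+1, u n <= v n & v n.+1 <= v n]) ->
  exists x, forall n, u n <= x <= v n.
Proof.
move=> h.
have um : {homo u : m n / (m <= n)%N >-> m <= n}.
  by apply: homo_leq => [//|x y z|n]; [exact: le_trans|by case: (h n)].
have vm : {homo v : m n / (m <= n)%N >-> n <= m}.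
  by apply: (homo_leq (r := fun x y => y <= x)) => [//|x y z xy yz|n]; [exact: le_trans yz xy|by case: (h n)].
have uv m n : u m <= v n.
  apply: le_trans (um _ _ (leq_maxl m n)) _; apply: le_trans (vm _ _ (leq_maxr m n)).
  by case: (h (maxn m n)).
exists (sup (range u)) => n; apply/andP; split.
  apply: sup_upper_bound; last by exists n.
  by split; [exists (u 0%N); exists 0%N|exists (v 0%N) => _ [m _ <-]].
by apply: ge_sup; [exists (u 0%N); exists 0%N|move=> _ [m _ <-]].
Qed.

(** Bisection: the chosen quarters shrink to a point near which [F] is affine up to [e |h|], the
    affine part integrates to zero, and yet the n-th rectangle must carry [eta / 4^n]. *)
Lemma goursat F a b c d : a <= b -> c <= d ->
  (forall x y, a <= x <= b -> c <= y <= d -> cderivable F (x +i* y)) ->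
  rectint F a b c d = 0.
Proof.
move=> ab cd dF.
have cF : rectcont F a b c d.
  by move=> x y xab ycd; apply: cderivable_continuous; exact: dF.
apply/eqP; apply: contraT; rewrite -normc_gt0; set eta := normc _ => eta0.
pose valid (q : (R * R) * (R * R)) :=
  [/\ a <= q.1.1, q.1.1 <= q.1.2, q.1.2 <= b &
  [/\ c <= q.2.1, q.2.1 <= q.2.2 & q.2.2 <= d]].
pose rel (q q' : (R * R) * (R * R)) :=
  [/\ [/\ q.1.1 <= q'.1.1, q'.1.1 <= q'.1.2, q'.1.2 <= q.1.2 & q'.1.2 - q'.1.1 = (q.1.2 - q.1.1) / 2],
      [/\ q.2.1 <= q'.2.1, q'.2.1 <= q'.2.2, q'.2.2 <= q.2.2 & q'.2.2 - q'.2.1 = (q.2.2 - q.2.1) / 2] &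
      normc (rectint F q.1.1 q.1.2 q.2.1 q.2.2) <= 4 * normc (rectint F q'.1.1 q'.1.2 q'.2.1 q'.2.2)].
(* Outside [valid] the successor is arbitrary, so that [choice] yields a total map to iterate. *)
have ex q : exists q', valid q -> rel q q'.
  have [[v1 v2 v3 [v4 v5 v6]]|nv] := pselect (valid q); last by exists q.
  by have [q' hq'] := rectint_quarter v2 v5 (rectcontS v1 v3 v4 v6 cF); exists q'.
have [f hf] := choice ex.
pose q n := iter n f ((a, b), (c, d)).
have vq n : valid (q n).
  elim: n => [|n ih]; first by split => //; split.
  have [[r1 r2 r3 r4] [s1 s2 s3 s4] _] := hf _ ih; case: ih => v1 v2 v3 [v4 v5 v6].
  by split; [exact: le_trans v1 r1| |exact: le_trans r3 v3|split; [exact: le_trans v4 s1| |exact: le_trans s3 v6]].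
have rq n : rel (q n) (q n.+1) by exact/hf/vq.
have wx n : (q n).1.2 - (q n).1.1 = (b - a) / 2 ^+ n.
  elim: n => [|n ih]; first by rewrite expr0 divr1.
  have [[_ _ _ ->] _ _] := rq n; rewrite ih exprS; field; rewrite expf_neq0//.
have wy n : (q n).2.2 - (q n).2.1 = (d - c) / 2 ^+ n.
  elim: n => [|n ih]; first by rewrite expr0 divr1.
  have [_ [_ _ _ ->] _] := rq n; rewrite ih exprS; field; rewrite expf_neq0//.
have wI n : eta <= 4 ^+ n * normc (rectint F (q n).1.1 (q n).1.2 (q n).2.1 (q n).2.2).
  elim: n => [|n ih]; first by rewrite expr0 mul1r.
  have [_ _ r] := rq n; apply: le_trans ih _; by rewrite exprSr -mulrA ler_wpM2l.
have [x hx] : exists x, forall n, (q n).1.1 <= x <= (q n).1.2.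
  by apply: nested_intervals => n; have [[r1 r2 r3 _] _ _] := rq n; have [] := vq n.
have [y hy] : exists y, forall n, (q n).2.1 <= y <= (q n).2.2.
  by apply: nested_intervals => n; have [_ [r1 r2 r3 _] _] := rq n; have [_ _ _ []] := vq n.
have [D hD] := (cderivableP _ _).1 (dF x y (hx 0%N) (hy 0%N)).
(* [L / 2^n] bounds the diameter of the n-th rectangle, and [e = eta / (8 (L^2 + 1))] makes the
   final estimate [4 e L^2] smaller than [eta]. *)
pose L := (b - a) + (d - c); have L0 : 0 <= L by rewrite /L; lra.
have L1 : 0 < 8 * (L ^+ 2 + 1) by have := sqr_ge0 L; lra.
have [r r0 hr] := hD _ (divr_gt0 eta0 L1); set e := eta / _ in hr.
have e0 : 0 < e by exact: divr_gt0.
have [n hn] := exists_pow2_gt (L / r).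
have p2 : 0 < (2 : R) ^+ n by rewrite exprn_gt0.
pose l := L / 2 ^+ n.
have lr : l < r by rewrite /l ltr_pdivrMr// mulrC -ltr_pdivrMr.
have l0 : 0 <= l by rewrite divr_ge0// ltW.
have [v1 v2 v3 [v4 v5 v6]] := vq n.
have cn : rectcont F (q n).1.1 (q n).1.2 (q n).2.1 (q n).2.2 by exact: rectcontS cF.
pose A := F (x +i* y) - D * (x +i* y).
have le : normc (rectint F (q n).1.1 (q n).1.2 (q n).2.1 (q n).2.2) <= 4 * (e * l) * l.
  rewrite -(rectint_affine A D v2 v5 cn).
  apply: le_trans (@rectint_le _ _ _ _ _ _ (e * l) v2 v5 _ _) _.
  - move=> u v hu hv; apply: (@continuousB _ C^o C^o (F : C^o -> C^o) (fun z => A + D * z)).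
      exact: cn.
    apply: cderivable_continuous; apply: cderivableD; first exact: cderivable_cst.
    by apply: cderivableM; [exact: cderivable_cst|exact: cderivable_id].
  - move=> u v hu hv; pose h := (u +i* v) - (x +i* y).
    have hl : normc h <= l.
      apply: le_trans (normc_leReIm _) _ => /=.
      have -> : l = ((q n).1.2 - (q n).1.1) + ((q n).2.2 - (q n).2.1).
        by rewrite wx wy /l /L mulrDl.
      apply: lerD; rewrite ler_norml.
        by move: (hx n) hu => /andP[? ?] /andP[? ?]; lra.
      by move: (hy n) hv => /andP[? ?] /andP[? ?]; lra.
    have := hr h (le_lt_trans hl lr).
    have -> : (x +i* y) + h = u +i* v by rewrite /h addrC subrK.
    have -> : F (u +i* v) - F (x +i* y) - D * h = F (u +i* v) - (A + D * (u +i* v)).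
      by rewrite /A /h; ring.
    by move/le_trans; apply; rewrite ler_pM2l.
  by rewrite wx wy -mulrDl.
suff : eta < eta by rewrite ltxx.
apply: le_lt_trans (wI n) _.
apply: le_lt_trans (ler_wpM2l (exprn_ge0 n _) le) _ => //.
have -> : 4 ^+ n * (4 * (e * l) * l) = 4 * e * L ^+ 2.
  have -> : (4 : R) ^+ n = 2 ^+ n * 2 ^+ n by rewrite -exprMn; congr (_ ^+ _); ring.
  by rewrite /l; field; rewrite gt_eqF.
have -> : eta = e * (8 * (L ^+ 2 + 1)) by rewrite /e divfK// gt_eqF.
by have := mulr_ge0 (ltW e0) (sqr_ge0 L); lra.
Qed.

(** A square of half-side [k] is cut out around the exceptional point: the four surrounding
    rectangles integrate to zero by [goursat], and since continuity bounds [F] near the point, the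
    square contributes at most [16 M k]. *)
Lemma goursat_except F a b c d px py : a < px < b -> c < py < d ->
  rectcont F a b c d ->
  (forall x y, a <= x <= b -> c <= y <= d -> (x != px) || (y != py) ->
     cderivable F (x +i* y)) ->
  rectint F a b c d = 0.
Proof.
move=> /andP[apx pxb] /andP[cpy pyd] cF dF.
apply/eqP; apply: contraT; rewrite -normc_gt0; set eta := normc _ => eta0.
have [|r r0 hr] := (continuousCP F (px +i* py)).1 _ 1 ltr01.
  by apply: cF; rewrite !ltW.
pose M := normc (F (px +i* py)) + 1.
have M0 : 0 < M by have := normc_ge0 (F (px +i* py)); rewrite /M; lra.
have hM z : normc (z - (px +i* py)) < r -> normc (F z) <= M.
  by move=> /hr; have := ler_normcB (F z) (F (px +i* py)); rewrite /M; lra.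
have [k [k0 kr kM [ka kb kc kd]]] : exists k : R, [/\ 0 < k, 2 * k < r, 16 * M * k < eta &
    [/\ k <= px - a, k <= b - px, k <= py - c & k <= d - py]].
  exists (Num.min (Num.min (r / 3) (eta / (17 * M)))
    (Num.min (Num.min (px - a) (b - px)) (Num.min (py - c) (d - py)))).
  set k := Num.min _ _; split.
  - by rewrite !lt_min !divr_gt0 ?mulr_gt0//= !subr_gt0 apx pxb cpy pyd.
  - have : k <= r / 3 by rewrite /k !ge_min lexx. lra.
  - have : k <= eta / (17 * M) by rewrite /k !ge_min lexx orbT.
    by rewrite ler_pdivlMr ?mulr_gt0//; have := mulr_gt0 M0 eta0; lra.
  - by split; rewrite /k !ge_min lexx ?orbT.
have E : rectint F a b c d = rectint F (px - k) (px + k) (py - k) (py + k).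
  have G u v s t : a <= u -> u <= v -> v <= b -> c <= s -> s <= t -> t <= d ->
      [|| v < px, px < u, t < py | py < s] -> rectint F u v s t = 0.
    move=> au uv vb cs st td H; apply: goursat => // x y /andP[ux xv] /andP[sy yt].
    apply: dF; rewrite ?(le_trans au ux) ?(le_trans xv vb) ?(le_trans cs sy) ?(le_trans yt td)//.
    by case/or4P: H => H; apply/orP; [left|left|right|right]; apply/eqP; lra.
  rewrite (@rectint_splitx _ _ _ _ _ _ (px - k))//; [|lra|lra].
  rewrite (@G a (px - k)) ?add0r; [|lra|lra|lra|lra|lra|lra|by apply/or4P/Or41; lra].
  rewrite (@rectint_splitx _ _ _ _ _ _ (px + k))//; [|lra|lra|]; last first.
    by apply: rectcontS cF; lra.
  rewrite (@G (px + k) b) ?addr0; [|lra|lra|lra|lra|lra|lra|by apply/or4P/Or42; lra].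
  rewrite (@rectint_splity _ _ _ _ _ _ (py - k))//; [|lra|lra|]; last first.
    by apply: rectcontS cF; lra.
  rewrite (@G (px - k) (px + k) c) ?add0r; [|lra|lra|lra|lra|lra|lra|by apply/or4P/Or43; lra].
  rewrite (@rectint_splity _ _ _ _ _ _ (py + k))//; [|lra|lra|]; last first.
    by apply: rectcontS cF; lra.
  by rewrite (@G (px - k) (px + k) (py + k)) ?addr0; [by []|lra|lra|lra|lra|lra|lra|apply/or4P/Or44; lra].
suff : eta < eta by rewrite ltxx.
apply: le_lt_trans kM; rewrite /eta E.
apply: le_trans (@rectint_le _ _ _ _ _ _ M _ _ _ _) _; [lra|lra| | |].
- by apply: rectcontS cF; lra.
- move=> x y xk yk; apply: hM; apply: le_lt_trans (normc_leReIm _) _ => /=.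
  apply: le_lt_trans kr; rewrite [_ * k]mulr_natl mulr2n.
  by apply: lerD; rewrite ler_norml; lra.
lra.
Qed.

End cauchy_theorem.

(** * Cauchy's theorem on circles *)

Section cauchy_circle.
Context {R : realType}.
Local Notation C := R[i].
Implicit Types (F : C -> C) (a b c d x y : R).

(* The curve [exp (ln r + i t)]: integrals over circles are integrals over vertical
   segments after substituting the exponential, so that Goursat's theorem on
   rectangles suffices. *)
Definition circ (r t : R) : C := cexp (ln r +i* t).

Lemma normc_circ (r t : R) : 0 < r -> normc (circ r t) = r.
Proof. by move=> r0; rewrite normc_cexp /= lnK// posrE. Qed.

Lemma circ_neq0 (r t : R) : circ r t != 0.
Proof. exact: cexp_neq0. Qed.

Lemma circ_continuous r : continuous (circ r : R -> C^o).
Proof.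
move=> t; apply: (@continuous_comp R C^o C^o (fun t => ln r +i* t) cexp).
  exact: vert_continuous.
by apply: cderivable_continuous; exact: cexp_cderivable.
Qed.

(** The exponential maps a rectangle whose height is one period onto the annulus [k <= |z| <= r].
    Its horizontal sides cancel, so both circles give the same integral, and the one of radius [k]
    tends to 0 because of the factor [circ]. The point [z0] is meant for the removable singularity
    of a difference quotient. *)
Lemma cauchy_circle (Q : C -> C) z0 (r : R) : 0 < r -> r < 1 -> normc z0 < r ->
  (forall z, disk z -> {for z, continuous (Q : C^o -> C^o)}) ->
  (forall z, disk z -> z != z0 -> cderivable Q z) ->
  cint (fun t => Q (circ r t) * circ r t) 0 (pi *+ 2) = 0.
Proof.
move=> r0 r1 z0r cQ dQ.
pose F z := Q (cexp z) * cexp z.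
have dk x y : x < 0 -> disk (cexp (x +i* y)).
  by move=> x0; rewrite diskE normc_cexp expR_lt1.
have cF x y : x < 0 -> {for (x +i* y : C^o), continuous (F : C^o -> C^o)}.
  move=> x0; have ce := cderivable_continuous (@cexp_cderivable R (x +i* y)).
  apply: continuousCM; last exact: ce.
  by apply: continuousC_comp; [exact: ce|apply: cQ; exact: dk].
have dF x y : x < 0 -> cexp (x +i* y) != z0 -> cderivable F (x +i* y).
  move=> x0 ne; have ce := @cexp_cderivable R (x +i* y).
  apply: cderivableM; last exact: ce.
  by apply: cderivable_comp; [exact: ce|apply: dQ; [exact: dk|exact: ne]].
have [th /andP[th1 th2] z0E] := exists_arg z0.
have p0 := @pi_gt0 R.
have s0 : ln r < 0 by rewrite ln_lt0// r0.
pose g t := F (ln r +i* t).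
have cg t : {for t, continuous (g : R -> C^o)}.
  apply: (@continuous_comp R C^o C^o (fun t => ln r +i* t) F); first exact: vert_continuous.
  exact: cF.
(* The period is centred at the argument of [z0], which puts the logarithm of [z0] inside the
   rectangle. *)
rewrite -[LHS]/(cint g 0 (pi *+ 2)) -(@cint_period _ g (pi *+ 2) (th - pi))//; last first.
- by move=> t; rewrite /g /F cexp_period.
- by rewrite mulr2n; lra.
apply/eqP; apply: contraT; rewrite -normc_gt0; set eta := normc _ => eta0.
have [|rho rho0 hrho] := (continuousCP Q 0).1 _ 1 ltr01.
  by apply: cQ; rewrite diskE normc0.
pose M := normc (Q 0) + 1.
have M0 : 0 < M by have := normc_ge0 (Q 0); rewrite /M; lra.
have hM z : normc z < rho -> normc (Q z) <= M.
  by rewrite -{1}[z]subr0 => /hrho; have := ler_normcB (Q z) (Q 0); rewrite /M; lra.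
have [k [k0 kr krho kz keta]] : exists k : R, [/\ 0 < k, k < r, k < rho,
    z0 != 0 -> k < normc z0 & 2 * (M * k * (pi *+ 2)) < eta].
  (* [z0 = 0] has no logarithm and puts no constraint on [k]; the value 1 is then a dummy. *)
  pose zz := if z0 == 0 then 1 else normc z0.
  have zz0 : 0 < zz by rewrite /zz; case: eqVneq => // zn0; rewrite normc_gt0.
  have pp0 : 0 < M * (pi : R) by exact: mulr_gt0.
  exists (Num.min (Num.min r rho) (Num.min zz (eta / (3 * (M * pi)))) / 2).
  set k := Num.min _ _.
  have k0 : 0 < k by rewrite /k !lt_min r0 rho0 zz0 divr_gt0// mulr_gt0.
  split.
  - by lra.
  - have : k <= r by rewrite /k !ge_min lexx. lra.
  - have : k <= rho by rewrite /k !ge_min lexx orbT. lra.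
  - move=> zn0; have : k <= normc z0 by rewrite /k /zz (negbTE zn0) !ge_min lexx !orbT. lra.
  - have : k <= eta / (3 * (M * pi)) by rewrite /k !ge_min lexx !orbT.
    by rewrite ler_pdivlMr ?mulr_gt0// [pi *+ 2]mulr2n; have := mulr_gt0 pp0 k0; lra.
have lk : ln k < ln r by rewrite ltr_ln.
have cc : rectcont F (ln k) (ln r) (th - pi) (th + pi).
  by move=> x y /andP[_ xr] _; apply: cF; exact: le_lt_trans xr s0.
have I0 : rectint F (ln k) (ln r) (th - pi) (th + pi) = 0.
  have [z00|zn0] := eqVneq z0 0.
    apply: goursat; [lra|lra|].
    move=> x y /andP[_ xr] _; apply: dF; first exact: le_lt_trans xr s0.
    by rewrite z00 cexp_neq0.
  have nz0 : 0 < normc z0 by rewrite normc_gt0.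
  apply: (@goursat_except R F _ _ _ _ (ln (normc z0)) th); [|lra|by []|].
    by rewrite !ltr_ln ?posrE// z0r kz.
  move=> x y /andP[_ xr] /andP[y1 y2] ne; apply: dF; first exact: le_lt_trans xr s0.
  apply/eqP => E.
  have : cexp (x +i* y) = cexp (ln (normc z0) +i* th).
    rewrite E {1}z0E.
    have -> : (ln (normc z0) +i* th : C) = (ln (normc z0))%:C + (0 +i* th).
      by apply/eqP; rewrite eq_complex /= addr0 add0r !eqxx.
    rewrite cexpD; congr (_ * _).
    by rewrite /cexp /= cos0 sin0 lnK ?posrE// mulr1 mulr0.
  move=> /cexp_inj[]; first by rewrite ltr_norml mulr2n; lra.
  by move=> xE yE; move: ne; rewrite xE yE !eqxx.
move: I0; rewrite /rectint (@eq_cint _ _ (fun=> 0)); last first.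
  move=> t _; have -> : th + pi = (th - pi) + pi *+ 2 by rewrite mulr2n; ring.
  by rewrite /F cexp_period subrr.
rewrite cint_cst; last exact: ltW.
rewrite mul0r add0r => /eqP; rewrite mulf_eq0 => /orP[/eqP[/eqP]|].
  by rewrite oner_eq0.
rewrite cintB; [|by apply: rectcont_v cc _; lra..].
rewrite subr_eq0 => /eqP gE; suff : eta < eta by rewrite ltxx.
have pE : th - pi + pi *+ 2 = th + pi by rewrite mulr2n; ring.
rewrite {1}/eta pE /g gE; apply: le_lt_trans keta.
have -> : (pi *+ 2 : R) = (th + pi) - (th - pi) by rewrite mulr2n; ring.
apply: cint_le; [lra|by apply: rectcont_v cc _; lra|].
move=> t _; have kE : normc (cexp (ln k +i* t)) = k.
  by rewrite normc_cexp /= lnK// posrE.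
rewrite /F normcM kE ler_pM2r; last exact: k0.
by apply: hM; rewrite kE; exact: krho.
Qed.

End cauchy_circle.

(** * Taylor coefficients *)

Section taylor.
Context {R : realType}.
Local Notation C := R[i].
Local Notation twopi := (pi *+ 2 : R).

Lemma twopi_gt0 : 0 < twopi.
Proof. by rewrite pmulrn_rgt0 ?pi_gt0. Qed.

Lemma itwopi_ge0 : 0 <= twopi^-1.
Proof. by rewrite invr_ge0 ltW// twopi_gt0. Qed.

Lemma mulcC (z : C) : z * conjc z = (normc z ^+ 2)%:C.
Proof.
rewrite normc_sqr; case: z => a b; apply/eqP; rewrite eq_complex /=.
by apply/andP; split; apply/eqP; ring.
Qed.

Lemma conjcM (z w : C) : conjc (z * w) = conjc z * conjc w.
Proof.
case: z w => [a b] [c d]; apply/eqP; rewrite eq_complex /=.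
by apply/andP; split; apply/eqP; ring.
Qed.

Lemma conjc0 : conjc (0 : C) = 0.
Proof. by apply/eqP; rewrite eq_complex /= oppr0 !eqxx. Qed.

Lemma conjcX (z : C) n : conjc (z ^+ n) = conjc z ^+ n.
Proof.
elim: n => [|n ih]; last by rewrite !exprS conjcM ih.
by apply/eqP; rewrite eq_complex /= oppr0 !eqxx.
Qed.

Lemma ReD_conj (z : C) : z + conjc z = (2 * complex.Re z)%:C.
Proof.
by case: z => a b; apply/eqP; rewrite eq_complex /=; apply/andP; split; apply/eqP; ring.
Qed.

Lemma cint_sum (I : Type) (s : seq I) (G : I -> R -> C) a b :
  (forall i, ccontR (G i) a b) -> a <= b ->
  ccontR (fun t => \sum_(i <- s) G i t) a b /\
  cint (fun t => \sum_(i <- s) G i t) a b = \sum_(i <- s) cint (G i) a b.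
Proof.
move=> cG ab; elim: s => [|i s [ih1 ih2]].
  have E : (fun t => \sum_(i <- [::]) G i t) = fun=> 0.
    by apply/funext => t; rewrite big_nil.
  by rewrite E big_nil cint_cst// mul0r; split=> //; exact: ccontR_cst.
have E : (fun t => \sum_(j <- i :: s) G j t) = fun t => G i t + \sum_(j <- s) G j t.
  by apply/funext => t; rewrite big_cons.
rewrite E big_cons -ih2 -(cintD (cG i) ih1).
by split; [exact: ccontRD (cG i) ih1|].
Qed.

Variable r : R.
Hypotheses (r0 : 0 < r) (r1 : r < 1).

(** The n-th Taylor coefficient as a Cauchy integral: since [dz = i z dt] on the circle,
    [z^-(n+1) dz / (2 i pi)] becomes [z^-n dt / (2 pi)]. *)
Definition fcoef (f : C -> C) (n : nat) : C :=
  (twopi^-1)%:C * cint (fun t => f (circ r t) / circ r t ^+ n) 0 twopi.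

Lemma circ_disk t : disk (circ r t).
Proof. by rewrite diskE normc_circ. Qed.

Definition diskcont (f : C -> C) :=
  forall z, disk z -> {for z, continuous (f : C^o -> C^o)}.

Lemma circ_ccont f a b : diskcont f -> ccontR (fun t => f (circ r t)) a b.
Proof.
move=> cf t _; apply: (@continuous_comp R C^o C^o (circ r) f).
  exact: circ_continuous.
by apply: cf; exact: circ_disk.
Qed.

Lemma circV_ccont n a b : ccontR (fun t => (circ r t ^+ n)^-1) a b.
Proof.
move=> t _; apply: continuousCV; first by rewrite expf_neq0// circ_neq0.
by apply: continuousCX; exact: circ_continuous.
Qed.

Lemma circ_bounded f : diskcont f ->
  exists M : R, forall t, 0 <= t <= twopi -> normc (f (circ r t)) <= M.
Proof.
move=> cf; have cn : {within `[0, twopi], continuous (fun t => normc (f (circ r t)))}.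
  apply: continuous_in_subspaceT => t _.
  apply: (@continuous_comp R C^o R (fun t => f (circ r t)) (@normc R)).
    by apply: (@circ_ccont f t t cf); rewrite lexx.
  exact: normc_continuous.
have [c _ hc] := EVT_max (ltW twopi_gt0) cn.
by exists (normc (f (circ r c))) => t t02; apply: hc; rewrite in_itv.
Qed.

Lemma conj_circ t : conjc (circ r t) = (r ^+ 2)%:C / circ r t.
Proof.
apply: (mulfI (circ_neq0 r t)); rewrite mulcC normc_circ//.
by rewrite mulrC divfK// circ_neq0.
Qed.

Lemma cint_circX n : cint (fun t => circ r t ^+ n.+1) 0 twopi = 0.
Proof.
have := @cauchy_circle R (fun z => z ^+ n) 0 r r0 r1.
rewrite normc0 => /(_ r0) <-.
- by apply: eq_cint => t _; rewrite exprSr.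
- by move=> z _; apply: cderivable_continuous; apply: cderivableX; exact: cderivable_id.
- by move=> z _ _; apply: cderivableX; exact: cderivable_id.
Qed.

Lemma conj_circX t n : conjc (circ r t ^+ n) = ((r ^+ 2) ^+ n)%:C / circ r t ^+ n.
Proof. by rewrite conjcX conj_circ expr_div_n [((r ^+ 2) ^+ n)%:C]rmorphXn. Qed.

Lemma circXV t n : (circ r t ^+ n)^-1 = (((r ^+ 2) ^+ n)^-1)%:C * conjc (circ r t ^+ n).
Proof.
rewrite conj_circX mulrA -rmorphM mulVf ?mul1r ?rmorph1 ?mul1r//.
by rewrite !expf_neq0// gt_eqF.
Qed.

Lemma cint_circXV n : cint (fun t => (circ r t ^+ n.+1)^-1) 0 twopi = 0.
Proof.
under eq_fun do rewrite circXV.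
have c : ccontR (fun t => circ r t ^+ n.+1) 0 twopi.
  by move=> t _; apply: continuousCX; exact: circ_continuous.
have cc : ccontR (fun t => conjc (circ r t ^+ n.+1)) 0 twopi.
  under [X in ccontR X]eq_fun do rewrite conj_circX.
  by apply: ccontRM; [exact: ccontR_cst|exact: circV_ccont].
by rewrite cintZ// cint_conj// cint_circX conjc0 mulr0.
Qed.

Lemma holo_cont f : holomorphic_disk f -> diskcont f.
Proof. by move=> hf z /hf h; exact: cderivable_continuous. Qed.

Lemma fcoef_le f M n : diskcont f ->
  (forall t, 0 <= t <= twopi -> normc (f (circ r t)) <= M) ->
  normc (fcoef f n) <= 2 * M / r ^+ n.
Proof.
move=> cf fM; have tp := twopi_gt0; have rn : 0 < r ^+ n by rewrite exprn_gt0.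
rewrite /fcoef normcM normc_real (ger0_norm itwopi_ge0).
rewrite [leLHS]mulrC ler_pdivrMr//.
have -> : 2 * M / r ^+ n * twopi = 2 * (M / r ^+ n * (twopi - 0)) by rewrite subr0; ring.
apply: cint_le; [exact: ltW| |].
  by apply: ccontRM; [exact: circ_ccont|exact: circV_ccont].
move=> t t0; rewrite normcM normcV normcX normc_circ//.
by rewrite ler_pM2r ?invr_gt0//; exact: fM.
Qed.

(** With [q = z / w], the difference quotient [Q] at [z] satisfies [(f w - f z) * \sum_(n <= N) q^n
    = Q w * w * (1 - q^(N+1))]. Integrated over the circle, the left side is [2 pi] times the Taylor
    polynomial minus [f z], the integral of [Q w * w] vanishes by [cauchy_circle], and the rest
    decays geometrically. *)
Lemma taylor_remainder f z : holomorphic_disk f -> normc z < r ->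
  exists K, forall N, normc (f z - \sum_(n < N.+1) fcoef f n * z ^+ n) <=
    K * (normc z / r) ^+ N.+1.
Proof.
move=> hf zr; have cf := holo_cont hf; have tp := twopi_gt0.
have dz : disk z by rewrite diskE; exact: lt_trans zr r1.
have [d hd] := (cderivableP _ _).1 (hf z dz).
pose Q w := if w == z then d else (f w - f z) / (w - z).
have dQ w : disk w -> w != z -> cderivable Q w.
  move=> dw wz; have wz0 : 0 < normc (w - z) by rewrite normc_gt0 subr_eq0.
  apply: (@eq_cderivable _ (fun w => (f w - f z) / (w - z)) Q w _ wz0).
    move=> v hv; rewrite /Q; case: eqVneq => // vz.
    by move: hv; rewrite vz normcB ltxx.
  apply: cderivableM.
    by apply: cderivableB; [exact: hf|exact: cderivable_cst].
  apply: cderivableV; first by rewrite subr_eq0.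
  by apply: cderivableB; [exact: cderivable_id|exact: cderivable_cst].
have cQ : diskcont Q.
  move=> w dw; have [->|wz] := eqVneq w z; last exact/cderivable_continuous/dQ.
  apply/continuousCP => e e0; have [s s0 hs] := hd (e / 2) (divr_gt0 e0 (ltr0n _ 2)).
  exists s => // v vs; rewrite /Q eqxx; case: eqVneq => [_|vz]; first by rewrite subrr normc0.
  have vz0 : v - z != 0 by rewrite subr_eq0.
  have vz0' : 0 < normc (v - z) by rewrite normc_gt0.
  have -> : (f v - f z) / (v - z) - d = (f (z + (v - z)) - f z - d * (v - z)) / (v - z).
    by rewrite [z + _]addrC subrK [RHS]mulrBl mulfK.
  rewrite normcM normcV ltr_pdivrMr//; apply: le_lt_trans (hs _ vs) _.
  by rewrite ltr_pM2r// gtr_pMr// invf_lt1// ltr1n.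
have cQQ : diskcont (fun w => Q w * w).
  move=> w dw; apply: (@continuousCM R C^o); first exact: cQ.
  by apply: cderivable_continuous; exact: cderivable_id.
have [K hK] := circ_bounded cQQ.
exists (2 * K) => N.
have cz t : circ r t - z != 0.
  rewrite subr_eq0; apply: contraTneq zr => <-.
  by rewrite normc_circ// ltxx.
pose q t := z / circ r t.
have E : cint (fun t => (f (circ r t) - f z) * \sum_(n < N.+1) q t ^+ n) 0 twopi =
   twopi%:C * (\sum_(n < N.+1) fcoef f n * z ^+ n - f z).
  have c1 (n : nat) : ccontR (fun t => f (circ r t) / circ r t ^+ n) 0 twopi.
    by apply: ccontRM; [exact: circ_ccont|exact: circV_ccont].
  have c2 (n : nat) : ccontR (fun t => (circ r t ^+ n)^-1) 0 twopi by exact: circV_ccont.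
  pose G (n : 'I_N.+1) t := z ^+ n * (f (circ r t) / circ r t ^+ n) -
     (z ^+ n * f z) * (circ r t ^+ n)^-1.
  have cG n : ccontR (G n) 0 twopi.
    by apply: ccontRB; apply: ccontRM; [exact: ccontR_cst|exact: c1|exact: ccontR_cst|exact: c2].
  have [_] := cint_sum (index_enum 'I_N.+1) cG (ltW tp).
  rewrite (@eq_cint _ (fun t => (f (circ r t) - f z) * \sum_(n < N.+1) q t ^+ n)
    (fun t => \sum_(n < N.+1) G n t)) => [->|]; last first.
    move=> t _; rewrite mulr_sumr; apply: eq_bigr => n _.
    by rewrite /G /q expr_div_n; ring.
  (* Only the power [n = 0] of the kernel has a nonzero integral, so [f z] is subtracted once. *)
  have H (n : nat) : cint (fun t => z ^+ n * (f (circ r t) / circ r t ^+ n) -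
      (z ^+ n * f z) * (circ r t ^+ n)^-1) 0 twopi =
      twopi%:C * (fcoef f n * z ^+ n) - (if n == 0 then twopi%:C * f z else 0).
    rewrite cintB; [|by apply: ccontRM; [exact: ccontR_cst|]..].
    rewrite (cintZ _ (c1 n)) (cintZ _ (c2 n)); congr (_ - _).
      rewrite /fcoef mulrA mulrA -rmorphM mulfV; last by rewrite gt_eqF.
      by rewrite rmorph1 mul1r mulrC.
    case: n => [|n]; last by rewrite cint_circXV mulr0.
    rewrite (@eq_cint _ _ (fun=> 1)); last by move=> t _; rewrite expr0 invr1.
    by rewrite cint_cst ?ltW// subr0 !mul1r mulrC.
  rewrite (eq_bigr (fun n : 'I_N.+1 => twopi%:C * (fcoef f n * z ^+ n) -
    (if (n : nat) == 0%N then twopi%:C * f z else 0))); last by move=> n _; exact: H.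
  rewrite sumrB -mulr_sumr mulrBr; congr (_ - _).
  by rewrite big_ord_recl /= big1 ?addr0.
have F : cint (fun t => (f (circ r t) - f z) * \sum_(n < N.+1) q t ^+ n) 0 twopi =
    - cint (fun t => Q (circ r t) * circ r t * q t ^+ N.+1) 0 twopi.
  have c1 : ccontR (fun t => Q (circ r t) * circ r t) 0 twopi by exact: (@circ_ccont (fun w => Q w * w) 0 twopi cQQ).
  have c2 : ccontR (fun t => q t ^+ N.+1) 0 twopi.
    move=> t _; apply: continuousCX; apply: continuousCM; first exact: (@cst_continuous R C^o).
    by apply: continuousCV; [exact: circ_neq0|exact: circ_continuous].
  have c0 := @cauchy_circle R Q z r r0 r1 zr cQ dQ.
  have c12 := ccontRM c1 c2.
  have -> : - cint (fun t => Q (circ r t) * circ r t * q t ^+ N.+1) 0 twopi =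
      cint (fun t => Q (circ r t) * circ r t) 0 twopi -
      cint (fun t => Q (circ r t) * circ r t * q t ^+ N.+1) 0 twopi.
    by rewrite c0 add0r.
  rewrite -(cintB c1 c12).
  apply: eq_cint => t _.
  have cn := circ_neq0 r t; have cz1 := cz t.
  rewrite /Q; case: eqVneq => [cE|_]; first by move: cz1; rewrite cE subrr eqxx.
  have q1 : 1 - q t != 0.
    rewrite /q -[1](mulfV cn) -mulrBl mulf_neq0// invr_neq0//.
  have S : 1 - q t ^+ N.+1 = (1 - q t) * \sum_(n < N.+1) q t ^+ n.
    by rewrite -[LHS]opprB subrX1 -mulNr opprB.
  have qE : circ r t * (1 - q t) = circ r t - z by rewrite /q mulrBr mulr1 mulrC divfK.
  rewrite -[X in _ = X - _]mulr1 -mulrBr S -qE; set X := \sum_(n < N.+1) _.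
  by field; rewrite q1 cn.
have -> : f z - \sum_(n < N.+1) fcoef f n * z ^+ n =
   (twopi^-1)%:C * cint (fun t => Q (circ r t) * circ r t * q t ^+ N.+1) 0 twopi.
  rewrite -[cint _ _ _]opprK -F E mulrN mulrA -rmorphM mulVf ?gt_eqF// rmorph1 mul1r.
  by rewrite opprB.
rewrite normcM normc_real (ger0_norm itwopi_ge0) [leLHS]mulrC ler_pdivrMr//.
have -> : 2 * K * (normc z / r) ^+ N.+1 * twopi =
  2 * (K * (normc z / r) ^+ N.+1 * (twopi - 0)) by rewrite subr0; ring.
apply: cint_le; [exact: ltW| |].
  apply: ccontRM; first exact: (@circ_ccont (fun w => Q w * w) 0 twopi cQQ).
  move=> t _; apply: continuousCX; apply: continuousCM; first exact: (@cst_continuous R C^o).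
  by apply: continuousCV; [exact: circ_neq0|exact: circ_continuous].
move=> t t0; rewrite normcM normcX /q normcM normcV normc_circ//.
by apply: ler_wpM2r; [rewrite exprn_ge0// divr_ge0 ?normc_ge0 ?ltW|exact: hK].
Qed.

Lemma fcoef0 f : holomorphic_disk f -> fcoef f 0 = f 0.
Proof.
move=> hf; have [|K hK] := @taylor_remainder f 0 hf; first by rewrite normc0.
have := hK 0%N; rewrite big_ord1 expr0 mulr1 normc0 mul0r expr0n mulr0 => h.
by apply/esym/eqP; rewrite -subr_eq0; apply/eqP/eq0_normc/le_anti; rewrite h normc_ge0.
Qed.

(** The integral of [f w * w^(n+1)] is zero, and on the circle [w^-(n+1)] is a multiple of the
    conjugate of [w^(n+1)]; so the conjugate of [f] can be added in the coefficient integral. This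
    replaces [f] by [2 Re f], which is its own modulus and has mean [2 Re f(0)]. *)
Lemma caratheodory f n : holomorphic_disk f ->
  (forall z, disk z -> 0 <= complex.Re (f z)) ->
  normc (fcoef f n.+1) <= 4 * complex.Re (f 0) / r ^+ n.+1.
Proof.
move=> hf f0; have cf := holo_cont hf; have tp := twopi_gt0.
have rn : 0 < r ^+ n.+1 by rewrite exprn_gt0.
have c1 m : ccontR (fun t => f (circ r t) / circ r t ^+ m) 0 twopi.
  by apply: ccontRM; [exact: circ_ccont|exact: circV_ccont].
have c2 : ccontR (fun t => f (circ r t) * circ r t ^+ n.+1) 0 twopi.
  apply: ccontRM; first exact: circ_ccont.
  by move=> t _; apply: continuousCX; exact: circ_continuous.
have z0 : cint (fun t => f (circ r t) * circ r t ^+ n.+1) 0 twopi = 0.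
  have := @cauchy_circle R (fun z => f z * z ^+ n) 0 r r0 r1.
  rewrite normc0 => /(_ r0) <-.
  - by apply: eq_cint => t _; rewrite -mulrA -exprSr.
  - move=> z dz; apply: (@continuousCM R C^o); first exact: cf.
    by apply: cderivable_continuous; apply: cderivableX; exact: cderivable_id.
  - move=> z dz _; apply: cderivableM; first exact: hf.
    by apply: cderivableX; exact: cderivable_id.
pose u t := complex.Re (f (circ r t)).
have cu t : {for t, continuous u}.
  apply: (@continuous_comp R C^o R (fun t => f (circ r t)) (@complex.Re R)).
    apply: (@continuous_comp R C^o C^o (circ r) f).
      exact: circ_continuous.
    by apply: cf; exact: circ_disk.
  exact: ReC_continuous.
have cu2 : ccontR (fun t => (2 * u t)%:C) 0 twopi.
  move=> t _; apply/(@cvgCP R R (nbhs t)) => e e0.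
  have e20 : 0 < e / 2 by rewrite divr_gt0.
  have /cvgrPdist_lt/(_ _ e20) := cu t.
  apply: filterS => s; rewrite -rmorphB normc_real -mulrBr normrM distrC gtr0_norm//.
  lra.
have E : cint (fun t => f (circ r t) / circ r t ^+ n.+1) 0 twopi =
    cint (fun t => (2 * u t)%:C / circ r t ^+ n.+1) 0 twopi.
  have -> : cint (fun t => (2 * u t)%:C / circ r t ^+ n.+1) 0 twopi =
     cint (fun t => f (circ r t) / circ r t ^+ n.+1 -
      - (((r ^+ 2) ^+ n.+1)^-1)%:C * conjc (f (circ r t) * circ r t ^+ n.+1)) 0 twopi.
    apply: eq_cint => t _; rewrite /u -ReD_conj mulrDl mulNr opprK; congr (_ + _).
    by rewrite circXV conjcM; ring.
  have cc : ccontR (fun t => conjc (f (circ r t) * circ r t ^+ n.+1)) 0 twopi.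
    have -> : (fun t => conjc (f (circ r t) * circ r t ^+ n.+1)) =
      (fun t => ((2 * u t)%:C - f (circ r t)) * conjc (circ r t ^+ n.+1)).
      by apply/funext => t; rewrite /u -ReD_conj addrC addKr conjcM.
    apply: ccontRM; last first.
      under [X in ccontR X]eq_fun do rewrite conj_circX.
      by apply: ccontRM; [exact: ccontR_cst|exact: circV_ccont].
    apply: ccontRB; last exact: circ_ccont.
    exact: cu2.
  have cd : ccontR (fun t => - (((r ^+ 2) ^+ n.+1)^-1)%:C * conjc (f (circ r t) * circ r t ^+ n.+1)) 0 twopi.
    by apply: ccontRM; [exact: ccontR_cst|exact: cc].
  rewrite cintB; [|exact: c1|exact: cd].
  by rewrite (cintZ _ cc) (cint_conj c2) z0 conjc0 mulr0 subr0.
rewrite /fcoef E normcM normc_real (ger0_norm itwopi_ge0).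
rewrite [leLHS]mulrC ler_pdivrMr//.
have I0 : \int[lebesgue_measure]_(t in `[0, twopi]) u t = twopi * complex.Re (f 0).
  rewrite -fcoef0// /fcoef.
  have -> : cint (fun t => f (circ r t) / circ r t ^+ 0) 0 twopi = cint (fun t => f (circ r t)) 0 twopi.
    by apply: eq_cint => t _; rewrite expr0 divr1.
  rewrite /cint /= mul0r subr0 mulrA mulfV ?mul1r// gt_eqF//.
have cv t : {for t, continuous (fun t => 2 / r ^+ n.+1 * u t)}.
  by apply: continuousM; [exact: cst_continuous|exact: cu].
have c3 : ccontR (fun t => (2 * u t)%:C / circ r t ^+ n.+1) 0 twopi.
  by apply: ccontRM; [exact: cu2|exact: circV_ccont].
apply: le_trans (@cint_norm_le _ _ (fun t => 2 / r ^+ n.+1 * u t) 0 twopi c3 _ _) _.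
- by move=> t _; exact: cv.
- move=> t _; rewrite normcM normcV normcX normc_circ// normc_real.
  rewrite ger0_norm ?mulr_ge0 ?f0//; last exact: circ_disk.
  by rewrite mulrAC.
rewrite RintegralZl//; last by apply: cont_integrable => t _; exact: cu.
by rewrite I0 le_eqVlt; apply/orP; left; apply/eqP; field; rewrite gt_eqF.
Qed.

End taylor.

(** * Series of holomorphic functions *)

Section series_tools.
Context {R : realType}.
Local Notation C := R[i].

Lemma exists_pow_small (K q e : R) : 0 <= q < 1 -> 0 < e ->
  exists N, forall n, (N <= n)%N -> K * q ^+ n < e.
Proof.
move=> /andP[q0 q1] e0.
have q1' : `|q| < 1 by rewrite ger0_norm.
have k0 : 0 < `|K| + 1 by have := normr_ge0 K; lra.
have /cvgrPdist_lt/(_ _ (divr_gt0 e0 k0))[N _ hN] := cvg_expr q1'.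
exists N => n /hN; rewrite sub0r normrN ger0_norm ?exprn_ge0// ltr_pdivlMr// mulrC.
apply: le_lt_trans; rewrite ler_wpM2r ?exprn_ge0//.
by have := ler_norm K; lra.
Qed.

Lemma geo_sum_le (q : R) N : 0 <= q < 1 -> \sum_(n < N) q ^+ n <= (1 - q)^-1.
Proof.
move=> /andP[q0 q1]; have d0 : 0 < 1 - q by lra.
rewrite -[leRHS]mul1r ler_pdivlMr// mulrC.
have -> : (1 - q) * \sum_(n < N) q ^+ n = 1 - q ^+ N.
  by rewrite -[RHS]opprB subrX1 -mulNr opprB.
by have := exprn_ge0 N q0; lra.
Qed.

Definition csums (u : nat -> C) (l : C) := forall e : R, 0 < e ->
  exists N0, forall N, (N0 <= N)%N -> normc (\sum_(k < N) u k - l) < e.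

Lemma csums_le u l (B : R) : csums u l -> (forall N, normc (\sum_(k < N) u k) <= B) ->
  normc l <= B.
Proof.
move=> h hB; apply/ler_addgt0Pr => e e0; have [N hN] := h e e0.
have := hN N (leqnn N); have := hB N.
rewrite normcB; have := ler_normcB l (\sum_(k < N) u k); lra.
Qed.

Lemma csumsD u v l m : csums u l -> csums v m -> csums (fun k => u k + v k) (l + m).
Proof.
move=> hu hv e e0; have e2 : 0 < e / 2 by rewrite divr_gt0.
have [N1 h1] := hu _ e2; have [N2 h2] := hv _ e2.
exists (maxn N1 N2) => N; rewrite geq_max => /andP[n1 n2].
rewrite big_split /= opprD addrACA; apply: le_lt_trans (le_normcD _ _) _.
by have := h1 N n1; have := h2 N n2; lra.
Qed.

Lemma csumsZ (c : C) u l : csums u l -> csums (fun k => c * u k) (c * l).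
Proof.
move=> hu e e0; have c0 : 0 < normc c + 1 by have := normc_ge0 c; lra.
have [N h] := hu _ (divr_gt0 e0 c0); exists N => n /h.
rewrite ltr_pdivlMr// -mulr_sumr -mulrBr normcM mulrC; apply: le_lt_trans.
by rewrite ler_wpM2r ?normc_ge0//; lra.
Qed.

Lemma csumsB u v l m : csums u l -> csums v m -> csums (fun k => u k - v k) (l - m).
Proof.
move=> hu hv; have := csumsD hu (csumsZ (-1) hv); rewrite mulN1r.
by congr csums; apply/funext => k; rewrite mulN1r.
Qed.

Lemma rsums_exists (u : nat -> R) (B : R) : (forall N, \sum_(k < N) `|u k| <= B) ->
  exists l : R, forall e : R, 0 < e -> exists N0, forall N, (N0 <= N)%N ->
    `|\sum_(k < N) u k - l| < e.
Proof.
move=> hB; have c1 : cvgn [normed series u].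
  apply: nondecreasing_is_cvgn.
    by apply: nondecreasing_series => n _ _; exact: normr_ge0.
  by exists B => _ [n _ <-]; have := hB n; rewrite -(big_mkord xpredT (fun k => `|u k|)).
have c2 : cvgn (series u) by exact: normed_cvg.
exists (limn (series u)) => e e0.
have /cvgrPdist_lt/(_ e e0)[N _ hN] : series u @ \oo --> limn (series u) by exact: c2.
by exists N => n /hN; rewrite distrC /series /= big_mkord.
Qed.

Lemma csums_exists (u : nat -> C) (B : R) : (forall N, \sum_(k < N) normc (u k) <= B) ->
  exists2 l, csums u l & normc l <= B.
Proof.
move=> hB.
have [|x hx] := @rsums_exists (fun k => complex.Re (u k)) B.
  by move=> N; apply: le_trans (hB N); apply: ler_sum => k _; exact: ler_Re.
have [|y hy] := @rsums_exists (fun k => complex.Im (u k)) B.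
  by move=> N; apply: le_trans (hB N); apply: ler_sum => k _; exact: ler_Im.
have c : csums u (x +i* y).
  move=> e e0; have e2 : 0 < e / 2 by rewrite divr_gt0.
  have [N1 h1] := hx _ e2; have [N2 h2] := hy _ e2.
  exists (maxn N1 N2) => N; rewrite geq_max => /andP[n1 n2].
  apply: le_lt_trans (normc_leReIm _) _; rewrite !raddfB !raddf_sum /=.
  by have := h1 N n1; have := h2 N n2; lra.
exists (x +i* y) => //; apply: (csums_le c) => N.
exact: le_trans (normc_sum _ _ _) (hB N).
Qed.

Lemma csums_unique u l m : csums u l -> csums u m -> l = m.
Proof.
move=> hl hm; apply/eqP; rewrite -subr_eq0; apply/eqP/eq0_normc/le_anti.
rewrite normc_ge0 andbT; apply: (csums_le (csumsB hl hm)) => N.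
by rewrite big1 ?normc0// => k _; rewrite subrr.
Qed.

(** Quadratic remainders with summable constants add up. The sum gets a remainder of the same kind,
    so the lemma applies both to a power series and to a series of power series. *)
Lemma csums_derive (f : nat -> C -> C) (F : C -> C) (d : nat -> C) (c : nat -> R)
    (z : C) (s B K : R) : 0 < s ->
  (forall h, normc h < s -> csums (fun k => f k (z + h)) (F (z + h))) ->
  (forall k h, normc h < s -> normc (f k (z + h) - f k z - d k * h) <= c k * normc h ^+ 2) ->
  (forall N, \sum_(k < N) normc (d k) <= B) -> (forall N, \sum_(k < N) c k <= K) ->
  exists2 D, normc D <= B &
    forall h, normc h < s -> normc (F (z + h) - F z - D * h) <= K * normc h ^+ 2.
Proof.
move=> s0 fF fc dB cK; have [D hD nD] := csums_exists dB; exists D => // h hs.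
have Fz : csums (fun k => f k z) (F z).
  by have := fF 0; rewrite normc0 => /(_ s0); rewrite addr0.
have S := csumsB (csumsB (fF h hs) Fz) (csumsZ h hD).
rewrite mulrC; apply: (csums_le S) => N.
apply: le_trans (normc_sum _ _ _) _.
apply: (@le_trans _ _ (\sum_(k < N) c k * normc h ^+ 2)).
  by apply: ler_sum => k _; rewrite [h * _]mulrC; exact: fc.
by rewrite -mulr_suml ler_wpM2r// exprn_ge0// normc_ge0.
Qed.

Lemma second_order_cderivable (F : C -> C) z D (K s : R) : 0 < s ->
  (forall h, normc h < s -> normc (F (z + h) - F z - D * h) <= K * normc h ^+ 2) ->
  cderivable F z.
Proof.
move=> s0 H; apply/cderivableP; exists D => e e0.
have k0 : 0 < `|K| + 1 by have := normr_ge0 K; lra.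
exists (Num.min s (e / (`|K| + 1))); first by rewrite lt_min s0 divr_gt0.
move=> h; rewrite lt_min => /andP[hs]; rewrite ltr_pdivlMr// => hK.
apply: le_trans (H h hs) _; rewrite expr2 mulrA ler_wpM2r ?normc_ge0//.
have := ler_norm K; have := normc_ge0 h => h0 kk.
have := ler_wpM2r h0 kk; lra.
Qed.

(** The factor [s ^+ 2] clears the denominator of the usual bound [n^2 s^(n-2) |h|^2], which keeps
    the induction uniform in [n]. *)
Lemma expr_second_order (z h : C) (s : R) n : normc z <= s -> normc (z + h) <= s ->
  s ^+ 2 * normc ((z + h) ^+ n - z ^+ n - n%:R * z ^+ n.-1 * h) <=
    n%:R ^+ 2 * s ^+ n * normc h ^+ 2.
Proof.
move=> zs zhs; have s0 := le_trans (normc_ge0 z) zs.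
elim: n => [|n ih]; first by rewrite !expr0 subrr !mul0r subr0 normc0 mulr0 expr0n /= !mul0r.
have E : (z + h) ^+ n.+1 - z ^+ n.+1 - n.+1%:R * z ^+ n.+1.-1 * h =
    (z + h) * ((z + h) ^+ n - z ^+ n - n%:R * z ^+ n.-1 * h) + n%:R * z ^+ n.-1 * h ^+ 2.
  by case: n {ih} => [|n] /=; rewrite ?expr1 ?expr0 ?exprS -?natr1; ring.
rewrite E; apply: le_trans (ler_wpM2l (sqr_ge0 s) (le_normcD _ _)) _.
rewrite mulrDr normcM (normcM _ (h ^+ 2)) (normcM n%:R) !normcX.
have nn : normc (n%:R : C) = n%:R.
  have -> : (n%:R : C) = (n%:R : R)%:C by rewrite rmorph_nat.
  by rewrite normc_real ger0_norm.
rewrite nn.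
have h2 : 0 <= normc h ^+ 2 by exact: sqr_ge0.
have T1 : s ^+ 2 * (normc (z + h) * normc ((z + h) ^+ n - z ^+ n - n%:R * z ^+ n.-1 * h))
    <= s * (n%:R ^+ 2 * s ^+ n * normc h ^+ 2).
  rewrite mulrCA; apply: ler_pM => //; [exact: normc_ge0|].
  by rewrite mulr_ge0 ?sqr_ge0 ?normc_ge0.
have T2 : s ^+ 2 * (n%:R * normc z ^+ n.-1 * normc h ^+ 2) <= n%:R * s ^+ n.+1 * normc h ^+ 2.
  case: n {ih E nn T1} => [|n] /=; first by rewrite !mul0r mulr0.
  have -> : s ^+ n.+2 = s ^+ 2 * s ^+ n by rewrite -exprD.
  have : normc z ^+ n <= s ^+ n by rewrite lerXn2r ?nnegrE ?normc_ge0.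
  move=> hz; have := ler_wpM2l (mulr_ge0 (ler0n _ n.+1) (mulr_ge0 (sqr_ge0 s) h2)) hz.
  lra.
have sn : 0 <= s ^+ n.+1 * normc h ^+ 2 by rewrite mulr_ge0// exprn_ge0.
have e1 : s * (n%:R ^+ 2 * s ^+ n * normc h ^+ 2) = n%:R ^+ 2 * (s ^+ n.+1 * normc h ^+ 2).
  by rewrite [s ^+ n.+1]exprS; ring.
apply: le_trans (lerD T1 T2) _; rewrite e1 -!mulrA -natr1.
move: sn; set X := _ * normc h ^+ 2 => sn.
have := mulr_ge0 (ler0n R n) sn; lra.
Qed.

Lemma nat_le_pow (t : R) n : 0 < t -> n%:R * t <= (1 + t) ^+ n.
Proof.
move=> t0; elim: n => [|n ih]; first by rewrite mul0r expr0.
rewrite exprS -natr1; have : 1 <= (1 + t) ^+ n by rewrite exprn_ege1//; lra.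
by move=> h; have := ler_wpM2r (ltW t0) h; lra.
Qed.

(* The constant depends only on the radii, so it also serves sums of power series. *)
Lemma power_series_second_order (s r : R) : 0 < s -> s < r ->
  exists2 K, 0 <= K & forall (a : nat -> C) (M : R) (F : C -> C),
    (forall n, normc (a n) <= M / r ^+ n) ->
    (forall z, normc z < r -> csums (fun n => a n * z ^+ n) (F z)) ->
    forall z, normc z < s -> exists2 D, normc D <= M * K &
      forall h, normc h < s - normc z -> normc (F (z + h) - F z - D * h) <= M * K * normc h ^+ 2.
Proof.
move=> s0 sr; have r0 := lt_trans s0 sr.
pose q := s / r; have q0 : 0 < q by rewrite divr_gt0.
have q1 : q < 1 by rewrite /q ltr_pdivrMr// mul1r.
(* Room for the polynomial factor: [n t <= (1 + t)^n] gives [n^2 q^n <= Q^n / t^2], where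
   [Q = q (1 + t)^2] is still below 1. *)
have [t t0 qt] : exists2 t, 0 < t & q * (1 + t) ^+ 2 < 1.
  exists ((1 - q) / 4); first by lra.
  have -> : q * (1 + (1 - q) / 4) ^+ 2 = 1 - (1 - q) * (1 - q * (9 - q) / 16) by field.
  have : 0 < (1 - q) * (1 - q * (9 - q) / 16).
    apply: mulr_gt0; first by lra.
    have : q * (9 - q) < 9 by nra.
    lra.
  lra.
pose Q := q * (1 + t) ^+ 2.
have Q0 : 0 <= Q by rewrite /Q mulr_ge0 ?sqr_ge0// ltW.
have n2 n : n%:R ^+ 2 * q ^+ n <= Q ^+ n / t ^+ 2.
  rewrite ler_pdivlMr ?exprn_gt0//.
  have -> : Q ^+ n = ((1 + t) ^+ n) ^+ 2 * q ^+ n by rewrite /Q exprMn -!exprM mulnC mulrC.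
  rewrite mulrAC -exprMn; apply: ler_wpM2r; first by apply: exprn_ge0; exact: ltW.
  have nt0 : 0 <= n%:R * t by rewrite mulr_ge0// ltW.
  have t1 : 0 <= (1 + t) ^+ n by apply: exprn_ge0; lra.
  by rewrite lerXn2r ?nnegrE//; exact: nat_le_pow.
pose K0 := (t ^+ 2)^-1 * (1 - Q)^-1.
have K00 : 0 <= K0.
  by rewrite mulr_ge0 ?invr_ge0 ?sqr_ge0// subr_ge0 ltW.
exists (K0 / s + K0 / s ^+ 2).
  by rewrite addr_ge0// divr_ge0// ?sqr_ge0// ltW.
move=> a M F aM aF z zs.
have M0 : 0 <= M by have := aM 0%N; rewrite expr0 divr1; exact: le_trans (normc_ge0 _).
have S2 N : \sum_(n < N) (n%:R ^+ 2 * q ^+ n) <= K0.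
  apply: le_trans (ler_sum _ (fun (n : 'I_N) _ => n2 n)) _.
  rewrite -mulr_suml mulrC /K0 ler_wpM2l ?invr_ge0 ?sqr_ge0//.
  by apply: geo_sum_le; rewrite Q0.
pose d n := a n * (n%:R * z ^+ n.-1).
have nn n : normc (n%:R : C) = n%:R.
  have -> : (n%:R : C) = (n%:R : R)%:C by rewrite rmorph_nat.
  by rewrite normc_real ger0_norm.
have dn n : normc (d n) <= M / s * (n%:R ^+ 2 * q ^+ n).
  rewrite /d !normcM nn normcX; case: n => [|n] /=; first by rewrite !mul0r mulr0 expr0n mul0r mulr0.
  have -> : M / s * (n.+1%:R ^+ 2 * q ^+ n.+1) = (M / r ^+ n.+1) * (n.+1%:R ^+ 2 * s ^+ n).
    by rewrite /q expr_div_n exprS [s ^+ n.+1]exprS; field; rewrite !gt_eqF ?exprn_gt0.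
  apply: ler_pM; [exact: normc_ge0|by rewrite mulr_ge0// exprn_ge0// normc_ge0|exact: aM|].
  apply: ler_pM => //; first by rewrite exprn_ge0// normc_ge0.
    by rewrite expr2 ler_peMl// ler1n.
  by rewrite lerXn2r ?nnegrE ?normc_ge0 ?ltW.
have sz : 0 < s - normc z by lra.
have [||||D D1 D2] := @csums_derive (fun n z => a n * z ^+ n) F d
    (fun n => M / s ^+ 2 * (n%:R ^+ 2 * q ^+ n)) z (s - normc z) (M / s * K0) (M / s ^+ 2 * K0) sz.
- move=> h hz; apply: aF; apply: le_lt_trans (le_normcD _ _) _; lra.
- move=> n h hz; have zh : normc (z + h) <= s by apply: le_trans (le_normcD _ _) _; lra.
  have := expr_second_order n (ltW zs) zh => E.
  have -> : a n * (z + h) ^+ n - a n * z ^+ n - d n * h =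
     a n * ((z + h) ^+ n - z ^+ n - n%:R * z ^+ n.-1 * h) by rewrite /d; ring.
  rewrite normcM.
  have -> : M / s ^+ 2 * (n%:R ^+ 2 * q ^+ n) * normc h ^+ 2 =
     M / r ^+ n * (n%:R ^+ 2 * s ^+ n * normc h ^+ 2 / s ^+ 2).
    by rewrite /q expr_div_n; field; rewrite !gt_eqF ?exprn_gt0.
  apply: ler_pM; [exact: normc_ge0|exact: normc_ge0|exact: aM|].
  by rewrite ler_pdivlMr ?exprn_gt0// mulrC.
- move=> N; apply: le_trans (ler_sum _ (fun (n : 'I_N) _ => dn n)) _.
  rewrite -mulr_sumr; apply: ler_wpM2l; last exact: S2.
  by rewrite mulr_ge0// invr_ge0 ltW.
- move=> N; rewrite -mulr_sumr; apply: ler_wpM2l; last exact: S2.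
  by rewrite mulr_ge0// invr_ge0 sqr_ge0.
have MK1 : 0 <= M / s * K0.
  by apply: mulr_ge0 => //; apply: mulr_ge0 => //; rewrite invr_ge0 ltW.
have MK2 : 0 <= M / s ^+ 2 * K0.
  by apply: mulr_ge0 => //; apply: mulr_ge0 => //; rewrite invr_ge0 sqr_ge0.
exists D; first by apply: le_trans D1 _; rewrite mulrDr; lra.
move=> h hz; apply: le_trans (D2 h hz) _; rewrite ler_wpM2r ?sqr_ge0//.
by rewrite mulrDr; lra.
Qed.

End series_tools.

(** * The Weierstrass theorem and the Schwarz-Pick lemma *)

Section taylor_consequences.
Context {R : realType}.
Local Notation C := R[i].
Implicit Types (f : C -> C) (r : R).

Lemma ratio_lt1 (z : C) r : 0 < r -> normc z < r -> 0 <= normc z / r < 1.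
Proof.
by move=> r0 zr; rewrite divr_ge0 ?normc_ge0 ?(ltW r0)//= ltr_pdivrMr// mul1r.
Qed.

Lemma taylor_csums f r z : 0 < r -> r < 1 -> holomorphic_disk f -> normc z < r ->
  csums (fun n => fcoef r f n * z ^+ n) (f z).
Proof.
move=> r0 r1 hf zr e e0; have [K hK] := taylor_remainder r0 r1 hf zr.
have [N hN] := exists_pow_small K (ratio_lt1 r0 zr) e0.
exists N.+1 => -[//|n] /ltnW Nn; rewrite normcB; apply: le_lt_trans (hK n) _.
exact: hN.
Qed.

Lemma taylor_tail f r z (M : R) N : 0 < r -> r < 1 -> holomorphic_disk f -> normc z < r ->
  (forall n, normc (fcoef r f n) <= M / r ^+ n) ->
  normc (f z - \sum_(n < N) fcoef r f n * z ^+ n) <= M * (normc z / r) ^+ N / (1 - normc z / r).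
Proof.
move=> r0 r1 hf zr aM; have /andP[q0 q1] := ratio_lt1 r0 zr; set q := normc z / r in q0 q1 *.
have M0 : 0 <= M by have := aM 0%N; rewrite expr0 divr1; exact: le_trans (normc_ge0 _).
have cz := taylor_csums r0 r1 hf zr.
apply/ler_addgt0Pr => e e0; have [L hL] := cz e e0.
have [L' NL LL] : exists2 L', (N <= L')%N & (L <= L')%N.
  by exists (maxn N L); rewrite ?leq_maxl ?leq_maxr.
rewrite -(subnKC NL) in LL; set k := (L' - N)%N in LL.
have := hL _ LL; rewrite big_split_ord /= => h1.
set S := \sum_(n < N) _ in h1 *; set T := \sum_(i < k) _ in h1.
have hT : normc T <= M * q ^+ N / (1 - q).
  apply: le_trans (normc_sum _ _ _) _.
  apply: (@le_trans _ _ (\sum_(i < k) M * q ^+ N * q ^+ i)).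
    apply: ler_sum => i _; rewrite normcM normcX -mulrA -exprD.
    have -> : M * q ^+ (N + i) = M / r ^+ (N + i) * normc z ^+ (N + i).
      by rewrite /q expr_div_n; ring.
    by rewrite ler_wpM2r ?exprn_ge0 ?normc_ge0.
  rewrite -mulr_sumr ler_wpM2l ?mulr_ge0 ?exprn_ge0//.
  by apply: geo_sum_le; rewrite q0.
have -> : f z - S = T - (S + T - f z) by ring.
apply: le_trans (le_normcD _ _) _; rewrite normcN; apply: lerD => //; exact: ltW.
Qed.

Lemma power_series_cderivable (a : nat -> C) (M r : R) (F : C -> C) z :
  (forall n, normc (a n) <= M / r ^+ n) ->
  (forall z, normc z < r -> csums (fun n => a n * z ^+ n) (F z)) ->
  normc z < r -> cderivable F z.
Proof.
move=> aM aF zr; pose s := (normc z + r) / 2.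
have z0 := normc_ge0 z.
have [s0 sr zs] : [/\ 0 < s, s < r & normc z < s] by rewrite /s; split; lra.
have [K K0 H] := power_series_second_order s0 sr.
have [D _ hD] := H _ _ _ aM aF z zs.
apply: (second_order_cderivable _ hD); lra.
Qed.

(** Weierstrass: the bounds [M k] at radius [r] give Cauchy estimates for the coefficients of [f k],
    hence quadratic remainders on a smaller disc with a single constant [K] for all [k], and
    [csums_derive] sums them. *)
Lemma holo_sum (f : nat -> C -> C) (F : C -> C) :
  (forall k, holomorphic_disk (f k)) ->
  (forall r, 0 < r < 1 -> exists2 M : nat -> R,
     forall k z, normc z <= r -> normc (f k z) <= M k &
     exists B, forall N, \sum_(k < N) M k <= B) ->
  (forall z, disk z -> csums (fun k => f k z) (F z)) ->
  holomorphic_disk F.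
Proof.
move=> hf fM fF z; rewrite diskE => z1; have z0 := normc_ge0 z.
pose t := 1 - normc z; pose s := normc z + t / 3; pose r := normc z + 2 * t / 3.
have t0 : 0 < t by rewrite /t; lra.
have [s0 sr r1 zs] : [/\ 0 < s, s < r, r < 1 & normc z < s] by rewrite /s /r /t; split; lra.
have r0 := lt_trans s0 sr.
have [K K0 H] := power_series_second_order s0 sr.
have [|M hM [B hB]] := fM r; first by rewrite r0.
have ex k : exists D, normc D <= 2 * M k * K /\ forall h, normc h < s - normc z ->
    normc (f k (z + h) - f k z - D * h) <= 2 * M k * K * normc h ^+ 2.
  have [n|x xr|D D1 D2] := H (fcoef r (f k)) (2 * M k) (f k) _ _ z zs.
  - apply: fcoef_le => //; first exact: holo_cont.
    by move=> x _; apply: hM; rewrite normc_circ.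
  - exact: taylor_csums.
  - by exists D.
have [d hd] := choice ex.
have S N : \sum_(k < N) 2 * M k * K <= 2 * B * K.
  by rewrite -mulr_suml -mulr_sumr ler_wpM2r// ler_wpM2l.
have sz : 0 < s - normc z by lra.
have [||||D _ hD] := @csums_derive _ f F d (fun k => 2 * M k * K) z (s - normc z)
  (2 * B * K) (2 * B * K) sz.
- move=> h hz; apply: fF; rewrite diskE; apply: le_lt_trans (le_normcD _ _) _; lra.
- by move=> k h hz; exact: (hd k).2.
- by move=> N; apply: le_trans (S N); apply: ler_sum => k _; exact: (hd k).1.
- exact: S.
exact: second_order_cderivable sz hD.
Qed.

Lemma Re_inv (w : C) : complex.Re w^-1 = complex.Re w / normc w ^+ 2.
Proof.
have [->|w0] := eqVneq w 0; first by rewrite invr0 mul0r.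
have -> : w^-1 = ((normc w ^+ 2)^-1)%:C * conjc w.
  apply: (mulfI w0); rewrite mulfV// mulrCA mulcC -rmorphM mulVf ?rmorph1//.
  by rewrite expf_neq0// gt_eqF// normc_gt0.
by case: w {w0} => a b /=; rewrite mul0r subr0 mulrC.
Qed.

Lemma ReV_ge0 (w : C) : 0 <= complex.Re w -> 0 <= complex.Re w^-1.
Proof. by move=> h; rewrite Re_inv divr_ge0// sqr_ge0. Qed.

(** The coefficient bounds of [caratheodory] sum to [4 |f(0)| / (1 - |z| / r)]; with [r] midway
    between [|z|] and 1 the denominator is at least [(1 - |z|) / 2]. *)
Lemma positive_real_part_growth f z : holomorphic_disk f ->
  (forall z, disk z -> 0 <= complex.Re (f z)) -> disk z ->
  normc (f z) * (1 - normc z) <= 8 * normc (f 0).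
Proof.
move=> hf f0; rewrite diskE => z1; pose r := (1 + normc z) / 2.
have z0 := normc_ge0 z.
have [r0 r1 zr] : [/\ 0 < r, r < 1 & normc z < r] by rewrite /r; split; lra.
have aM n : normc (fcoef r f n) <= 4 * normc (f 0) / r ^+ n.
  case: n => [|n].
    by rewrite expr0 divr1 fcoef0// ler_peMl ?normc_ge0//; lra.
  apply: le_trans (caratheodory r0 r1 n hf f0) _.
  rewrite ler_wpM2r ?invr_ge0 ?exprn_ge0 ?(ltW r0)// ler_wpM2l//.
  exact: le_trans (ler_norm _) (ler_Re _).
have /andP[q0 q1] := ratio_lt1 r0 zr.
have := taylor_tail 0 r0 r1 hf zr aM; rewrite big_ord0 subr0 expr0 mulr1 => H.
have d0 : 0 < 1 - normc z / r by lra.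
rewrite ler_pdivlMr// in H.
have H2 : 1 - normc z <= 2 * (1 - normc z / r).
  have -> : 1 - normc z / r = (r - normc z) / r by field; rewrite gt_eqF.
  rewrite mulrA ler_pdivlMr// /r; nra.
have := ler_wpM2l (normc_ge0 (f z)) H2; lra.
Qed.

(** Rotate by [c] so that [c * phi z] is positive. Then [1 / (1 - c * phi)] has positive real part,
    modulus [1 / (1 - |phi z|)] at [z] and at most [1 / (1 - |phi 0|)] at 0, and the growth bound
    compares these two values. *)
Lemma schwarz_pick (phi : C -> C) : holomorphic_disk phi ->
  (forall z, disk z -> disk (phi z)) ->
  exists2 K : R, 0 < K & forall z, disk z -> 1 - normc z <= K * (1 - normc (phi z)).
Proof.
move=> hp sp.
have d0 : disk (0 : C) by rewrite diskE normc0.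
have p0 : 0 < 1 - normc (phi 0) by have := sp _ d0; rewrite diskE; lra.
exists (8 / (1 - normc (phi 0))); first by rewrite divr_gt0.
move=> z dz; have [phz|phz] := eqVneq (phi z) 0.
  rewrite phz normc0 subr0 mulr1; have := normc_ge0 z.
  rewrite ler_pdivlMr//; have := normc_ge0 (phi 0) => a b.
  have : disk z by []. rewrite diskE => c; nra.
have nz : 0 < normc (phi z) by rewrite normc_gt0.
pose c := conjc (phi z) / (normc (phi z))%:C.
have c1 : normc c = 1.
  by rewrite normcM normcV normc_conj normc_real ger0_norm ?mulfV ?gt_eqF// ltW.
have pc w : disk w -> normc (c * phi w) < 1.
  by move=> /sp; rewrite diskE normcM c1 mul1r.
have dn w : disk w -> 0 < complex.Re (1 - c * phi w).
  move=> /pc h; rewrite raddfB /= subr_gt0; apply: le_lt_trans h.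
  exact: le_trans (ler_norm _) (ler_Re _).
have dn0 w : disk w -> 1 - c * phi w != 0.
  by move=> /dn; apply: contraTneq => ->; rewrite ltxx.
pose f w := (1 - c * phi w)^-1.
have hf : holomorphic_disk f.
  move=> w dw; apply: cderivableV; first exact: dn0.
  apply: cderivableB; first exact: cderivable_cst.
  by apply: cderivableM; [exact: cderivable_cst|exact: hp].
have := positive_real_part_growth hf (fun w dw => ReV_ge0 (ltW (dn w dw))) dz.
have cz : c * phi z = (normc (phi z))%:C.
  by rewrite /c mulrAC [conjc _ * _]mulrC mulcC -fmorphV -rmorphM expr2 mulfK// gt_eqF.
have pz : 0 < 1 - normc (phi z) by have := sp _ dz; rewrite diskE; lra.
have -> : normc (f z) = (1 - normc (phi z))^-1.
  by rewrite /f cz -(rmorph1 (real_complex R)) -rmorphB normcV normc_real gtr0_norm.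
rewrite mulrC ler_pdivrMr// => H; apply: le_trans H _.
rewrite ler_wpM2r ?(ltW pz)// ler_wpM2l// /f normcV lef_pV2 ?posrE//; last first.
  by rewrite normc_gt0 dn0.
have := ler_normcB 1 (c * phi 0); rewrite normc1 normcM c1 mul1r.
by [].
Qed.

Definition zeta_root (N : nat) : C := cexp (0 +i* ((pi *+ 2) / N%:R)).

Lemma zeta_rootX N n : zeta_root N ^+ n = cexp (0 +i* (n%:R * ((pi *+ 2) / N%:R))).
Proof.
rewrite /zeta_root; set t := _ / _; elim: n => [|n ih].
  by rewrite expr0 mul0r /cexp /= expR0 cos0 sin0 mulr1 mulr0.
rewrite exprS ih -cexpD; congr cexp; apply/eqP; rewrite eq_complex /= addr0 eqxx /=.
by apply/eqP; rewrite -natr1; ring.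
Qed.

Lemma sum_zeta_root N n : (0 < n < N)%N -> \sum_(k < N) (zeta_root N ^+ k) ^+ n = 0.
Proof.
move=> /andP[n0 nN]; have N0 : (0 < N)%N by exact: leq_ltn_trans nN.
have N0' : 0 < N%:R :> R by rewrite ltr0n.
have tp := @twopi_gt0 R.
have e0 : cexp (0 +i* 0) = 1 :> C by rewrite /cexp /= expR0 cos0 sin0 mulr1 mulr0.
have w1 : zeta_root N ^+ n - 1 != 0.
  rewrite subr_eq0; apply/eqP; rewrite zeta_rootX -e0 => /cexp_inj[].
    rewrite subr0 ger0_norm; last by rewrite mulr_ge0// divr_ge0// ltW.
    by rewrite mulrCA gtr_pMr// ltr_pdivrMr// mul1r ltr_nat.
  move=> _ /eqP; rewrite mulf_eq0 mulf_eq0 invr_eq0 !pnatr_eq0 (gtn_eqF n0) (gtn_eqF N0).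
  by rewrite orbF (gt_eqF tp).
apply: (mulfI w1); rewrite mulr0.
under eq_bigr do rewrite -exprM mulnC exprM.
rewrite -subrX1 -exprM mulnC exprM zeta_rootX mulrCA mulfV ?gt_eqF// mulr1.
have -> : (0 +i* (pi *+ 2) : C) = 0 +i* (0 + pi *+ 2) by rewrite add0r.
by rewrite cexp_period e0 expr1n subrr.
Qed.

Lemma normc_zeta_root N k : normc (zeta_root N ^+ k) = 1.
Proof. by rewrite normcX normc_cexp /= expR0 expr1n. Qed.

(** Averaging over the N-th roots of unity kills the monomials of degrees 1 to [N - 1], so the
    average differs from [f 0] by Taylor tails only. *)
Lemma zeta_root_mean f r z (M : R) N : 0 < r -> r < 1 -> holomorphic_disk f ->
  normc z < r -> (forall n, normc (fcoef r f n) <= M / r ^+ n) -> (0 < N)%N ->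
  normc (\sum_(k < N) f (zeta_root N ^+ k * z) / N%:R - f 0) <=
    M * (normc z / r) ^+ N / (1 - normc z / r).
Proof.
move=> r0 r1 hf zr aM N0; have NN : (N%:R : C) != 0 by rewrite pnatr_eq0 -lt0n.
have NR : 0 < N%:R :> R by rewrite ltr0n.
pose P k := \sum_(n < N) fcoef r f n * (zeta_root N ^+ k * z) ^+ n.
have hP : \sum_(k < N) P k / N%:R = f 0.
  rewrite -mulr_suml /P exchange_big /=; apply: (mulIf NN); rewrite divfK//.
  case: N N0 NN NR @P => // N _ NN NR P; rewrite big_ord_recl /= [X in _ + X]big1 ?addr0.
    under eq_bigr do rewrite expr0 mulr1.
    by rewrite sumr_const card_ord fcoef0// mulr_natr.
  move=> n _; rewrite -mulr_sumr.
  under eq_bigr do rewrite exprMn.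
  by rewrite -mulr_suml sum_zeta_root ?mul0r ?mulr0//= ltnS.
rewrite -hP -sumrB; apply: le_trans (normc_sum _ _ _) _.
have nN : normc (N%:R : C) = N%:R.
  have -> : (N%:R : C) = (N%:R : R)%:C by rewrite rmorph_nat.
  by rewrite normc_real ger0_norm.
apply: (@le_trans _ _ (\sum_(k < N) (M * (normc z / r) ^+ N / (1 - normc z / r) / N%:R))).
  apply: ler_sum => k _; rewrite -mulrBl normcM normcV nN ler_pM2r ?invr_gt0//.
  have nz : normc (zeta_root N ^+ k * z) = normc z by rewrite normcM normc_zeta_root mul1r.
  by have := @taylor_tail f r (zeta_root N ^+ k * z) M N r0 r1 hf; rewrite nz; apply.
by rewrite sumr_const card_ord -[leLHS]mulr_natr divfK// gt_eqF.
Qed.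

End taylor_consequences.

(** * Integration over the plane *)

Section plane_integral.
Context {R : realType}.
Local Notation C := R[i].
Local Notation mR := (measurableTypeR R).
Local Notation leb := (@lebesgue_measure R).
Local Notation leb2 := ((@lebesgue_measure R) \x (@lebesgue_measure R))%E.
Implicit Types (h : C -> R).

Lemma ge0_integral_affine (u : R -> \bar R) (r a : R) : 0 < r ->
  measurable_fun [set: mR] u -> (forall x, 0 <= u x)%E ->
  (\int[leb]_x u x = r%:E * \int[leb]_x u (r * x + a)%R)%E.
Proof.
move=> r0 mu u0.
have mphi : measurable_fun setT (fun x : mR => r * x + a : mR).
  by apply: measurable_funD => //; exact: measurable_funM.
pose phi : {mfun mR >-> mR} :=
  HB.pack (fun x : mR => r * x + a : mR) (isMeasurableFun.Build _ _ _ _ _ mphi).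
pose pf := measure_function_pushforward__canonical__measure_function_Measure leb mphi.
pose k : {nonneg R} := NngNum (ltW r0).
have E A : measurable A -> leb A = mscale k pf A.
  move=> mA; apply: (@lebesgue_measure_unique R (mscale k pf)) => // _ [[c d]] _ <-.
  rewrite -[RHS]/(k%:num%:E * leb ((fun x : R => (r * x + a)%R) @^-1` `]c, d]%classic))%E.
  have -> : (fun x : R => r * x + a) @^-1` `]c, d] = `](c - a) / r, (d - a) / r]%classic.
    by apply/seteqP; split => x /=; rewrite !in_itv/= ltr_pdivrMr// ler_pdivlMr// ltrBlDr lerBrDr mulrC.
  rewrite !lebesgue_measure_itv/= !lte_fin ltr_pM2r ?invr_gt0// ltrD2r.
  case: ifPn => _; last by rewrite mule0.
  by rewrite -!EFinB -EFinM; congr (_%:E); field; rewrite gt_eqF.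
rewrite (@eq_measure_integral _ _ _ _ (mscale k pf) leb); last by move=> A mA _; exact: E.
rewrite ge0_integral_mscale//; congr (_ * _)%E.
by rewrite (ge0_integral_pushforward mphi).
Qed.

(** The translation may depend on the other coordinate: by Tonelli this covers scalings,
    translations and shears together. *)
Lemma ge0_integral2_affine1 (g : mR * mR -> \bar R) (r : R) (a : R -> R) : 0 < r ->
  measurable_fun [set: mR] (a : mR -> mR) ->
  measurable_fun setT g -> (forall p, 0 <= g p)%E ->
  (\int[leb2]_p g p = r%:E * \int[leb2]_p g (r * p.1 + a p.2, p.2)%R)%E.
Proof.
move=> r0 ma mg g0.
have mg' : measurable_fun setT (fun p : mR * mR => g (r * p.1 + a p.2, p.2)).
  apply: (measurableT_comp mg); apply: measurable_fun_pair => //.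
  apply: measurable_funD; first by apply: measurable_funM.
  exact: measurableT_comp.
rewrite fubini_tonelli2// fubini_tonelli2// -ge0_integralZl//; last 3 first.
- exact: measurable_fun_fubini_tonelli_G.
- by move=> y _; apply: integral_ge0 => x _.
- by rewrite lee_fin ltW.
apply: eq_integral => y _; rewrite /fubini_G.
rewrite (@ge0_integral_affine (fun x => g (x, y)) r (a y))//.
exact: measurableT_comp.
Qed.

Lemma ge0_integral2_affine2 (g : mR * mR -> \bar R) (r : R) (a : R -> R) : 0 < r ->
  measurable_fun [set: mR] (a : mR -> mR) ->
  measurable_fun setT g -> (forall p, 0 <= g p)%E ->
  (\int[leb2]_p g p = r%:E * \int[leb2]_p g (p.1, r * p.2 + a p.1)%R)%E.
Proof.
move=> r0 ma mg g0.
have mg' : measurable_fun setT (fun p : mR * mR => g (p.1, r * p.2 + a p.1)).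
  apply: (measurableT_comp mg); apply: measurable_fun_pair => //.
  apply: measurable_funD; first by apply: measurable_funM.
  exact: measurableT_comp.
rewrite fubini_tonelli1// fubini_tonelli1// -ge0_integralZl//; last 3 first.
- exact: measurable_fun_fubini_tonelli_F.
- by move=> y _; apply: integral_ge0 => x _.
- by rewrite lee_fin ltW.
apply: eq_integral => y _; rewrite /fubini_F.
rewrite (@ge0_integral_affine (fun x => g (y, x)) r (a y))//.
exact: measurableT_comp.
Qed.

(* The plane integral is taken against the unnormalized Lebesgue measure on [R * R]. *)
Definition mC h := measurable_fun setT (h \o toC : mR * mR -> R).
Definition plint h : \bar R := (\int[leb2]_p (h (toC p))%:E)%E.

Lemma mC_E h : mC h -> measurable_fun setT (fun p : mR * mR => (h (toC p))%:E).
Proof. by move=> mh; apply/measurable_EFinP. Qed.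

Lemma mC_cst (c : R) : mC (fun=> c).
Proof. exact: measurable_cst. Qed.

Lemma mCD h k : mC h -> mC k -> mC (fun z => h z + k z).
Proof. exact: measurable_funD. Qed.

Lemma mCB h k : mC h -> mC k -> mC (fun z => h z - k z).
Proof. exact: measurable_funB. Qed.

Lemma mCM h k : mC h -> mC k -> mC (fun z => h z * k z).
Proof. exact: measurable_funM. Qed.

Lemma mCX h n : mC h -> mC (fun z => h z ^+ n).
Proof. exact: measurable_funX. Qed.

Lemma mC_sum (I : Type) (s : seq I) (h : I -> C -> R) :
  (forall i, mC (h i)) -> mC (fun z => \sum_(i <- s) h i z).
Proof. by move=> mh; apply: measurable_sum => i; exact: mh. Qed.

Lemma mC_powR h (a : R) : mC h -> mC (fun z => h z `^ a).
Proof. by move=> mh; exact: (measurableT_comp (measurable_powR a) mh). Qed.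

Definition ind (b : bool) : R := if b then 1 else 0.

Lemma ind_ge0 b : 0 <= ind b. Proof. by case: b. Qed.
Lemma ind_le1 b : ind b <= 1. Proof. by case: b. Qed.

Lemma measurable_ind d (T : measurableType d) (b : T -> bool) :
  measurable_fun setT b -> measurable_fun setT (fun x => ind (b x)).
Proof. by move=> mb; exact: measurable_fun_ifT. Qed.

Lemma mC_ind_lt h k : mC h -> mC k -> mC (fun z => ind (h z < k z)).
Proof. by move=> mh mk; apply: measurable_ind; exact: measurable_fun_ltr. Qed.

Lemma mC_continuous h : continuous (h : C^o -> R) -> mC h.
Proof.
move=> ch; apply: measurable_continuous_on_open; first exact: openT.
move=> p _; apply: (@continuous_comp _ C^o R toC h); first exact: toC_continuous.
exact: ch.
Qed.

Lemma mC_normc : mC (@normc R).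
Proof. by apply: mC_continuous; exact: normc_continuous. Qed.

Lemma mC_normcB (w : C) : mC (fun z => normc (z - w)).
Proof.
apply: mC_continuous => z.
apply: (@continuous_comp C^o C^o R (fun z => z - w) (@normc R)); last exact: normc_continuous.
by apply: cderivable_continuous; apply: cderivableB; [exact: cderivable_id|exact: cderivable_cst].
Qed.

(** Functions on the disc are uncontrolled outside it, hence the cutoff that makes them measurable
    on the whole plane. *)
Lemma mC_disk h : (forall z, disk z -> {for z, continuous (h : C^o -> R)}) ->
  mC (fun z => ind (normc z < 1) * h z).
Proof.
move=> ch.
have mD : measurable ((toC : mR * mR -> C) @^-1` disk).
  by apply: measurable_open_prod; exact: open_toC_disk.
have mh : measurable_fun ((toC : mR * mR -> C) @^-1` disk) (h \o toC : mR * mR -> R).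
  apply: measurable_continuous_on_open; first exact: open_toC_disk.
  move=> p Dp; apply: (@continuous_comp _ C^o R toC h); first exact: toC_continuous.
  exact: ch.
have := (measurable_restrictT _ mD).1 mh; congr measurable_fun.
apply/funext => p.
have E : (p \in toC @^-1` disk) = (normc (toC p) < 1).
  by apply/idP/idP => [/set_mem|h1]; [|exact: mem_set].
rewrite /patch E -[RHS]/(ind (normc (toC p) < 1) * h (toC p)) /ind.
by case: (normc (toC p) < 1); rewrite ?mul1r ?mul0r.
Qed.

Lemma plint_ge0 h : (forall z, 0 <= h z) -> (0 <= plint h)%E.
Proof. by move=> h0; apply: integral_ge0 => p _; rewrite lee_fin. Qed.

Lemma plint_le h k : mC h -> mC k -> (forall z, 0 <= h z) -> (forall z, h z <= k z) ->
  (plint h <= plint k)%E.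
Proof.
move=> mh mk h0 hk; apply: ge0_le_integral => //.
- by move=> p _; rewrite lee_fin.
- exact: mC_E.
- exact: mC_E.
- by move=> p _; rewrite lee_fin.
Qed.

Lemma plintD h k : mC h -> mC k -> (forall z, 0 <= h z) -> (forall z, 0 <= k z) ->
  plint (fun z => h z + k z) = (plint h + plint k)%E.
Proof.
move=> mh mk h0 k0; rewrite /plint -ge0_integralD//.
- by move=> p _; rewrite lee_fin.
- exact: mC_E.
- by move=> p _; rewrite lee_fin.
- exact: mC_E.
Qed.

Lemma plintZ (c : R) h : mC h -> (forall z, 0 <= h z) -> 0 <= c ->
  plint (fun z => c * h z) = (c%:E * plint h)%E.
Proof.
move=> mh h0 c0; rewrite /plint -ge0_integralZl//.
- exact: mC_E.
- by move=> p _; rewrite lee_fin.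
Qed.

Lemma plint_sum (I : Type) (s : seq I) (h : I -> C -> R) :
  (forall i, mC (h i)) -> (forall i z, 0 <= h i z) ->
  plint (fun z => \sum_(i <- s) h i z) = (\sum_(i <- s) plint (h i))%E.
Proof.
move=> mh h0; elim: s => [|i s ih].
  rewrite big_nil /plint; under eq_integral do rewrite big_nil.
  exact: integral0.
rewrite big_cons -ih -plintD//; last 2 first.
- exact: mC_sum.
- by move=> z; exact: sumr_ge0.
by congr plint; apply/funext => z; rewrite big_cons.
Qed.

Lemma plint_shift h (w : C) : mC h -> (forall z, 0 <= h z) ->
  plint (fun z => h (z + w)) = plint h.
Proof.
move=> mh h0; case: w => a b; rewrite /plint.
have mh' := mC_E mh.
rewrite [RHS](@ge0_integral2_affine1 _ 1 (fun=> a))//; last first.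
  by move=> p; rewrite lee_fin.
rewrite mul1e [RHS](@ge0_integral2_affine2 _ 1 (fun=> b))//; last 2 first.
- apply: (measurableT_comp mh'); apply: measurable_fun_pair => //.
  by apply: measurable_funD => //; exact: measurable_funM.
- by move=> p; rewrite lee_fin.
by rewrite mul1e; apply: eq_integral => -[x y] _ /=; rewrite /toC /= !mul1r.
Qed.

Lemma plint_scale h (r : R) : 0 < r -> mC h -> (forall z, 0 <= h z) ->
  ((r ^+ 2)%:E * plint (fun z => h (r%:C * z)%R) = plint h)%E.
Proof.
move=> r0 mh h0; rewrite /plint; have mh' := mC_E mh.
rewrite [RHS](@ge0_integral2_affine1 _ r (fun=> 0))//; last first.
  by move=> p; rewrite lee_fin.
rewrite [X in (_ = _ * X)%E](@ge0_integral2_affine2 _ r (fun=> 0))//; last 2 first.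
- apply: (measurableT_comp mh'); apply: measurable_fun_pair => //.
  by apply: measurable_funD => //; exact: measurable_funM.
- by move=> p; rewrite lee_fin.
rewrite muleA -EFinM -expr2; congr (_ * _)%E.
apply: eq_integral => -[x y] _ /=; rewrite /toC /=; congr ((h _)%:E).
by apply/eqP; rewrite eq_complex /= !mul0r subr0 !addr0 !eqxx.
Qed.

Lemma mC_mul h (u : C) : mC h -> mC (fun z => h (u * z)).
Proof.
move=> mh; case: u => c s.
have := measurableT_comp mh (_ : measurable_fun setT
  (fun p : mR * mR => (c * p.1 - s * p.2, c * p.2 + s * p.1) : mR * mR)).
apply; apply: measurable_fun_pair.
  by apply: measurable_funB; apply: measurable_funM.
by apply: measurable_funD; apply: measurable_funM.
Qed.

(* A rotation is a product of three shears, each preserving the product measure. *)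
Lemma plint_rot h (u : C) : normc u = 1 -> mC h -> (forall z, 0 <= h z) ->
  plint (fun z => h (u * z)) = plint h.
Proof.
(* The slope of the shears has denominator [1 + Re u]; the excluded rotation [-1] is the square of
   [i]. *)
wlog : h u / complex.Re u != -1 => [H|].
  have [u1|] := eqVneq (complex.Re u) (-1); last exact: H.
  move=> nu mh h0.
  have -> : u = (0 +i* 1) * (0 +i* 1).
    have := normc_sqr u; rewrite nu u1 expr1n sqrrN expr1n => /eqP.
    rewrite eq_sym -subr_eq0 addrAC subrr add0r sqrf_eq0 => /eqP i0.
    by apply/eqP; rewrite eq_complex u1 i0 /=; apply/andP; split; apply/eqP; ring.
  have r0 : complex.Re (0 +i* 1 : C) != -1 by rewrite /= eq_sym oppr_eq0 oner_eq0.
  have n1 : normc (0 +i* 1 : C) = 1 by rewrite /= expr0n expr1n add0r sqrtr1.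
  rewrite -(H _ _ r0 n1 mh h0) -(H (fun z => h ((0 +i* 1) * z)) _ r0 n1)//.
    by congr plint; apply/funext => z; rewrite mulrA.
  exact: mC_mul.
case: u => c s /= c1 nu mh h0; have mh' := mC_E mh.
have cs : c ^+ 2 + s ^+ 2 = 1.
  by have := normc_sqr (c +i* s); rewrite /= nu expr1n.
have c10 : 1 + c != 0 by apply: contra c1; rewrite addrC addr_eq0.
(* For [u = exp(i t)] this is [- tan(t / 2)]: the rotation is a shear of slope [a] in [x], one of
   slope [s] in [y], and again one of slope [a] in [x]. *)
pose a := - s / (1 + c).
have msh (x : R) : measurable_fun [set: mR] ((fun y => x * y) : mR -> mR).
  exact: measurable_funM.
rewrite /plint [RHS](@ge0_integral2_affine1 _ 1 (fun y => a * y))//; last first.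
  by move=> p; rewrite lee_fin.
have mh1 : measurable_fun setT (fun p : mR * mR => (h (toC (1 * p.1 + a * p.2, p.2)))%:E).
  apply: (measurableT_comp mh'); apply: measurable_fun_pair => //.
  by apply: measurable_funD; exact: measurable_funM.
rewrite mul1e [RHS](@ge0_integral2_affine2 _ 1 (fun y => s * y))//; last first.
  by move=> p; rewrite lee_fin.
have mh2 : measurable_fun setT (fun p : mR * mR =>
    (h (toC (1 * p.1 + a * (1 * p.2 + s * p.1), 1 * p.2 + s * p.1)))%:E).
  apply: (measurableT_comp mh1 (g := fun p : mR * mR => (p.1, 1 * p.2 + s * p.1) : mR * mR)).
  apply: measurable_fun_pair => //.
  by apply: measurable_funD; exact: measurable_funM.
rewrite mul1e [RHS](@ge0_integral2_affine1 _ 1 (fun y => a * y))//; last first.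
  by move=> p; rewrite lee_fin.
rewrite mul1e; apply: eq_integral => -[x y] _ /=; rewrite /toC /=; congr ((h _)%:E).
have sE : s ^+ 2 = (1 - c) * (1 + c) by rewrite -[s ^+ 2](addrK (c ^+ 2)) [s ^+ 2 + _]addrC cs; ring.
have e1 : 1 + a * s = c.
  have -> : a * s = - (s ^+ 2 / (1 + c)) by rewrite /a; ring.
  by rewrite sE mulfK//; ring.
have e2 : 2 * a + a ^+ 2 * s = - s.
  have -> : 2 * a + a ^+ 2 * s = a * (1 + (1 + a * s)) by ring.
  by rewrite e1 /a divfK.
apply/eqP; rewrite eq_complex /=; apply/andP; split; apply/eqP.
  have -> : 1 * (1 * x + a * y) + a * (1 * y + s * (1 * x + a * y)) =
    (1 + a * s) * x + (2 * a + a ^+ 2 * s) * y by ring.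
  by rewrite e1 e2; ring.
have -> : 1 * y + s * (1 * x + a * y) = (1 + a * s) * y + s * x by ring.
by rewrite e1; ring.
Qed.

(** Domination is by a partial sum whose length depends on [z]; the full series lives in the
    extended reals, where it may diverge. *)
Lemma plint_series (h : C -> R) (g : nat -> C -> R) (B : R) :
  mC h -> (forall k, mC (g k)) -> (forall z, 0 <= h z) -> (forall k z, 0 <= g k z) ->
  (forall z, exists N, h z <= \sum_(k < N) g k z) ->
  (forall N, \sum_(k < N) plint (g k) <= B%:E)%E ->
  (plint h <= B%:E)%E.
Proof.
move=> mh mg h0 g0 hg gB.
have g0' k (p : mR * mR) : (0 <= (g k (toC p))%:E)%E by rewrite lee_fin.
apply: (@le_trans _ _ (\int[leb2]_p (\sum_(0 <= k <oo) (g k (toC p))%:E)%E)%E).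
  apply: ge0_le_integral => //.
  - by move=> p _; rewrite lee_fin.
  - exact: mC_E.
  - by apply: ge0_emeasurable_sum => // k *; exact: mC_E.
  move=> p _; have [N hN] := hg (toC p).
  apply: (@le_trans _ _ (\sum_(0 <= k < N) (g k (toC p))%:E)%E).
    by rewrite sumEFin lee_fin big_mkord.
  by apply: nneseries_lim_ge => k _ _; exact: g0'.
rewrite integral_nneseries//; last by move=> k; exact: mC_E.
apply: lime_le.
  by apply: is_cvg_nneseries => k _ _; exact: plint_ge0.
by near=> N; rewrite big_mkord; exact: gB.
Unshelve. all: by end_near. Qed.

(** Monotone convergence, reduced to [plint_series] by telescoping [g]. *)
Lemma plint_mono_lim (h : C -> R) (g : nat -> C -> R) (B : R) :
  mC h -> (forall k, mC (g k)) -> (forall z, 0 <= h z) -> (forall k z, 0 <= g k z) ->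
  (forall k z, g k z <= g k.+1 z) -> (forall z, exists N, h z <= g N z) ->
  (forall k, plint (g k) <= B%:E)%E -> (plint h <= B%:E)%E.
Proof.
move=> mh mg h0 g0 gS hg gB.
pose u k z := if k is k'.+1 then g k'.+1 z - g k' z else g 0%N z.
have uS N z : \sum_(k < N.+1) u k z = g N z.
  by elim: N => [|N ih]; rewrite big_ord_recr /= ?ih ?big_ord0 ?add0r// addrC subrK.
have mu k : mC (u k) by case: k => [|k]; [exact: mg|exact: mCB].
have u0 k z : 0 <= u k z by case: k => [|k] //=; rewrite subr_ge0.
apply: (plint_series mh mu h0 u0) => [z|N].
  by have [N hN] := hg z; exists N.+1; rewrite uS.
rewrite -plint_sum//; apply: le_trans (gB N); apply: plint_le => //.
- exact: mC_sum.
- by move=> z; exact: sumr_ge0.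
by move=> z; rewrite -uS big_ord_recr /= lerDl.
Qed.

End plane_integral.
Arguments plint {R} h%_R.

(** * Areas of discs and annuli *)

Section disk_area.
Context {R : realType}.
Local Notation C := R[i].
Local Notation mR := (measurableTypeR R).
Local Notation leb := (@lebesgue_measure R).
Local Notation leb2 := ((@lebesgue_measure R) \x (@lebesgue_measure R))%E.

Lemma mC_disc (t : R) : mC (fun z : C => ind (normc z < t)).
Proof. by apply: mC_ind_lt; [exact: mC_normc|exact: mC_cst]. Qed.

Lemma ind_le (b c : bool) : (b -> c) -> ind b <= ind c :> R.
Proof. by case: b c => [] [] //= /(_ isT). Qed.

Lemma leb2_square (e : R) : 0 < e ->
  (leb2 (ball (0%R : R) e `*` ball (0%R : R) e) = ((e *+ 2) ^+ 2)%R%:E)%E.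
Proof.
move=> e0; rewrite product_measure1E; try exact: measurable_ball.
have bE : leb (ball (0 : R) e) = (e *+ 2)%:E by exact: lebesgue_measure_ball (ltW e0).
by rewrite [X in (X * _)%E]bE [X in (_ * X)%E]bE -EFinM -expr2.
Qed.

Lemma plint_square (e : R) : 0 < e ->
  plint (fun z : C => ind (`|complex.Re z| < e) * ind (`|complex.Im z| < e)) =
    ((e *+ 2) ^+ 2)%:E.
Proof.
move=> e0; rewrite -leb2_square// /plint -[X in leb2 X]setIT -integral_indic//; last first.
  by apply: measurableX; exact: measurable_ball.
apply: eq_integral => -[x y] _ /=; congr (_%:E); rewrite indicE.
have -> : ((x, y) \in ball (0 : R) e `*` ball (0 : R) e) = (`|x| < e) && (`|y| < e).
  apply/idP/idP => [/set_mem [] |/andP[h1 h2]]; rewrite /ball /= ?sub0r ?normrN.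
    by move=> -> ->.
  by apply: mem_set; split; rewrite /ball /= sub0r normrN.
by rewrite /ind; case: (_ < _); case: (_ < _); rewrite ?mulr1 ?mulr0.
Qed.

Lemma mC_square (e : R) : 
  mC (fun z : C => ind (`|complex.Re z| < e) * ind (`|complex.Im z| < e)).
Proof.
have mn : measurable_fun [set: mR] (fun x : mR => `|x| : mR) by exact: normr_measurable.
apply: mCM; apply: mC_ind_lt; try exact: mC_cst.
  exact: (measurableT_comp mn measurable_fst).
exact: (measurableT_comp mn measurable_snd).
Qed.

(** The square of half-side 1/2 lies inside the disc, the one of half-side 1 contains it. *)
Lemma plint_disk_fin : exists2 A : R, 0 < A & plint (fun z : C => ind (normc z < 1)) = A%:E.
Proof.
have h0 (z : C) : 0 <= ind (normc z < 1) :> R by exact: ind_ge0.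
have s0 (e : R) (z : C) : 0 <= ind (`|complex.Re z| < e) * ind (`|complex.Im z| < e) :> R.
  by rewrite mulr_ge0 ?ind_ge0.
have up : (plint (fun z : C => ind (normc z < 1)%R) <= ((1 *+ 2) ^+ 2)%R%:E)%E.
  rewrite -plint_square//; apply: plint_le => //; [exact: mC_disc|exact: mC_square|].
  move=> z; have := ler_Re z; have := ler_Im z; rewrite /ind.
  case: ifPn => [z1 h1 h2|_ _ _]; last exact: (s0 1 z).
  by rewrite !ifT ?mulr1//; lra.
have lo : (((2^-1 *+ 2) ^+ 2)%R%:E <= plint (fun z : C => ind (normc z < 1)%R))%E.
  rewrite -plint_square ?invr_gt0//; apply: plint_le => //; [exact: mC_square|exact: mC_disc|].
  move=> z; have zRI := normc_leReIm z; rewrite /ind.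
  case: ifPn => h1; rewrite ?mul0r ?mul1r; last by case: ifP.
  by case: ifPn => h2; [rewrite ifT//; lra|case: ifP].
move: up lo; case: (plint _) => [A| |] //=; rewrite !lee_fin => _ lo.
by exists A => //; apply: lt_le_trans lo; rewrite exprn_gt0// pmulrn_lgt0// invr_gt0.
Qed.

Definition disk_area : R := fine (plint (fun z : C => ind (normc z < 1))).

Lemma disk_areaE : plint (fun z : C => ind (normc z < 1)) = disk_area%:E.
Proof. by have [A _ AE] := plint_disk_fin; rewrite /disk_area AE. Qed.

Lemma disk_area_gt0 : 0 < disk_area.
Proof. by have [A A0 AE] := plint_disk_fin; rewrite /disk_area AE. Qed.

Lemma plint_disc (t : R) : 0 < t ->
  plint (fun z : C => ind (normc z < t)) = (t ^+ 2 * disk_area)%:E.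
Proof.
move=> t0; rewrite -(plint_scale t0 (mC_disc t)); last by move=> z; exact: ind_ge0.
rewrite [RHS]EFinM; congr (_ * _)%E; rewrite -disk_areaE; congr plint; apply/funext => z.
by rewrite normcM normc_real gtr0_norm// gtr_pMr.
Qed.

Definition annulus (t : R) (z : C) : R := ind (1 - normc z < t) * ind (normc z < 1).

Lemma annulus_ge0 t z : 0 <= annulus t z.
Proof. by rewrite mulr_ge0 ?ind_ge0. Qed.

Lemma mC_annulus t : mC (annulus t).
Proof.
apply: mCM; last exact: mC_disc.
by apply: mC_ind_lt; [apply: mCB; [exact: mC_cst|exact: mC_normc]|exact: mC_cst].
Qed.

Lemma plint_annulus (t : R) : 0 < t -> (plint (annulus t) <= (2 * disk_area * t)%:E)%E.
Proof.
move=> t0; have A0 := disk_area_gt0.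
have [t1|t1] := leP 1 t.
  apply: (@le_trans _ _ (plint (fun z : C => ind (normc z < 1)))).
    apply: plint_le; [exact: mC_annulus|exact: mC_disc|exact: annulus_ge0|].
    by move=> z; rewrite /annulus ler_piMl ?ind_ge0 ?ind_le1.
  by rewrite disk_areaE lee_fin; nra.
(* The annulus is disjoint from the disc of radius [1 - t], and [1 - (1 - t)^2 <= 2 t]. *)
have u0 : 0 < 1 - t by lra.
have := @plintD R (annulus t) (fun z => ind (normc z < 1 - t)) (mC_annulus t) (mC_disc _)
  (annulus_ge0 t) (fun z => ind_ge0 _).
have le : (plint (fun z => annulus t z + ind (normc z < (1 - t)%R))%R <= disk_area%:E)%E.
  rewrite -disk_areaE; apply: plint_le.
  - by apply: mCD; [exact: mC_annulus|exact: mC_disc].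
  - exact: mC_disc.
  - by move=> z; rewrite addr_ge0 ?annulus_ge0 ?ind_ge0.
  - move=> z; rewrite /annulus /ind; case: ifPn; case: ifPn; case: ifPn; lra.
move=> E; move: le; rewrite E (plint_disc u0).
have := plint_ge0 (annulus_ge0 t); case: (plint (annulus t)) => [x| |] //= _.
by rewrite -EFinD !lee_fin; nra.
Qed.

End disk_area.

(** * Real powers *)

Section powers.
Context {R : realType}.

Lemma powR_comparable (a x y : R) : 0 < x -> 0 < y -> x <= 4 * y -> y <= 4 * x ->
  x `^ a <= 4 `^ `|a| * y `^ a.
Proof.
move=> x0 y0 xy yx; have [x0' y0'] := (ltW x0, ltW y0).
have y40 : 0 <= 4 * y by rewrite mulr_ge0.
have x40 : 0 <= 4 * x by rewrite mulr_ge0.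
have [a0|a0] := leP 0 a.
  by rewrite ger0_norm// -powRM//; apply: ge0_ler_powR => //; rewrite nnegrE.
have na : 0 <= - a by lra.
rewrite ltr0_norm//.
have e u : u `^ a = (u `^ (- a))^-1 by rewrite powRN invrK.
rewrite (e x) (e y).
rewrite ler_pdivlMr ?powR_gt0// mulrC ler_pdivrMr ?powR_gt0// -powRM//.
by apply: ge0_ler_powR => //; rewrite nnegrE.
Qed.

Lemma powR_exprn_half (t a : R) k : 0 < t ->
  (t / 2 ^+ k) `^ a = t `^ a * (2 `^ (- a)) ^+ k.
Proof.
move=> t0; rewrite powRM ?ltW ?invr_ge0 ?exprn_ge0//; congr (_ * _).
by rewrite -powR_mulrn ?powR_ge0// -powRrM -[_^-1]powR_inv1 ?exprn_ge0// -powR_mulrn// -!powRrM; congr (_ `^ _); ring.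
Qed.

Lemma powR2_lt1 (a : R) : a < 0 -> 2 `^ a < 1.
Proof.
move=> a0; rewrite -[a]opprK powRN invf_lt1 ?powR_gt0//.
rewrite [X in X < _](_ : 1 = 1 `^ (- a)); last by rewrite powR1.
apply: gt0_ltr_powR; rewrite ?nnegrE//; lra.
Qed.

End powers.

(** * Mean value properties *)

Section radial_means.
Context {R : realType}.
Local Notation C := R[i].
Implicit Types (V : C -> R) (f : C -> C).

Definition radial V := forall u z, normc u = 1 -> V (u * z) = V z.

Lemma mC_circle_mean (g : C -> R) N :
  mC g -> mC (fun z => \sum_(k < N) g (zeta_root N ^+ k * z) / N%:R).
Proof.
by move=> mg; apply: mC_sum => k; apply: mCM; [exact: mC_mul|exact: mC_cst].
Qed.

(* Averages over the N-th roots of unity replace means over circles: they only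
   need the invariance of the measure under a rotation. *)
Lemma plint_radial V (g : C -> R) N : (0 < N)%N -> radial V ->
  (forall z, 0 <= V z) -> (forall z, 0 <= g z) -> mC V -> mC g ->
  plint (fun z => V z * g z) =
  plint (fun z => V z * (\sum_(k < N) g (zeta_root N ^+ k * z) / N%:R)).
Proof.
move=> N0 rV V0 g0 mV mg; have NR : 0 < N%:R :> R by rewrite ltr0n.
have m1 : mC (fun z => V z * g z) by exact: mCM.
have n1 z : 0 <= V z * g z by rewrite mulr_ge0.
have i0 : 0 <= N%:R^-1 :> R by rewrite invr_ge0 ltW.
have -> : (fun z => V z * (\sum_(k < N) g (zeta_root N ^+ k * z) / N%:R)) =
  (fun z => \sum_(k < N) N%:R^-1 * (V (zeta_root N ^+ k * z) * g (zeta_root N ^+ k * z))).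
  apply/funext => z; rewrite mulr_sumr; apply: eq_bigr => k _.
  by rewrite (rV _ _ (normc_zeta_root N k)); ring.
rewrite plint_sum; last 2 first.
- by move=> k; apply: mCM; [exact: mC_cst|exact: (mC_mul _ m1)].
- by move=> k z; rewrite mulr_ge0.
rewrite (eq_bigr (fun=> ((N%:R^-1)%:E * plint (fun z => (V z * g z)%R))%E)); last first.
  move=> k _; rewrite (@plintZ _ _ (fun z => V (zeta_root N ^+ k * z) * g (zeta_root N ^+ k * z)))//.
    by congr (_ * _)%E; exact: (plint_rot (normc_zeta_root N k) m1 n1).
  exact: (mC_mul _ m1).
rewrite -ge0_sume_distrl; last by move=> k _; rewrite lee_fin.
have S1 : \sum_(i < N) N%:R^-1 = 1 :> R.
  by rewrite sumr_const card_ord -[LHS]mulr_natr mulVf// gt_eqF.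
by rewrite sumEFin S1 mul1e.
Qed.

Lemma fcoef_bound f r : 0 < r -> r < 1 -> holomorphic_disk f ->
  exists2 M : R, 0 <= M & forall n, normc (fcoef r f n) <= M / r ^+ n.
Proof.
move=> r0 r1 hf; have cf := holo_cont hf; have [M hM] := circ_bounded r0 r1 cf.
exists (2 * M) => [|n]; last exact: fcoef_le.
have tp := @twopi_gt0 R.
have := hM 0; rewrite lexx (ltW tp) => /(_ isT); have := normc_ge0 (f (circ r 0)); lra.
Qed.

Lemma exists_circle_mean f (r e : R) : 0 < r -> r < 1 -> holomorphic_disk f -> 0 < e ->
  exists2 N, (0 < N)%N & forall z, normc z < r ->
    normc (\sum_(k < N) f (zeta_root N ^+ k * z) / N%:R - f 0) <= e.
Proof.
(* The coefficients are taken on a larger circle, so that [r / s < 1] bounds the tail uniformly in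
   [z]. *)
move=> r0 r1 hf e0; pose s := (1 + r) / 2.
have [s0 s1 rs] : [/\ 0 < s, s < 1 & r < s] by rewrite /s; split; lra.
have [M M0 hM] := fcoef_bound s0 s1 hf.
have q1 : 0 <= r / s < 1 by rewrite divr_ge0 ?(ltW r0) ?(ltW s0)//= ltr_pdivrMr// mul1r.
have d0 : 0 < 1 - r / s by case/andP: q1 => *; lra.
have [N hN] := exists_pow_small M q1 (mulr_gt0 e0 d0).
exists N.+1 => // z zr; have zs : normc z < s by lra.
apply: le_trans (zeta_root_mean s0 s1 hf zs hM (ltn0Sn N)) _.
have /andP[z0 z1] := ratio_lt1 s0 zs.
have zq : normc z / s <= r / s by rewrite ler_pM2r ?invr_gt0// ltW.
rewrite ler_pdivrMr; last by lra.
apply: (@le_trans _ _ (M * (r / s) ^+ N.+1)).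
  by rewrite ler_wpM2l// lerXn2r// nnegrE; case/andP: q1.
apply: le_trans (ltW (hN _ (leqnSn N))) _; rewrite ler_pM2l//; lra.
Qed.

Lemma mC_disk_Re f : holomorphic_disk f -> mC (fun z => ind (normc z < 1) * complex.Re (f z)).
Proof.
move=> hf; apply: mC_disk => z dz; apply: (@continuous_comp C^o C^o R f (@complex.Re R)).
  exact/cderivable_continuous/hf.
exact: ReC_continuous.
Qed.

Lemma mC_disk_Im f : holomorphic_disk f -> mC (fun z => ind (normc z < 1) * complex.Im (f z)).
Proof.
move=> hf; apply: mC_disk => z dz; apply: (@continuous_comp C^o C^o R f (@complex.Im R)).
  exact/cderivable_continuous/hf.
exact: ImC_continuous.
Qed.

(** The mean value property of [Re f], integrated against a radial density. Averages over roots of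
    unity are uniformly accurate on smaller discs only, so [V] is cut off at radius [1 - 2^-(k+1)]
    and the bound passes to the limit in [k]. *)
Lemma radial_mean_Re V f (B : R) : holomorphic_disk f -> radial V ->
  (forall z, 0 <= V z) -> mC V -> (forall z, ~ disk z -> V z = 0) ->
  (forall z, disk z -> 0 <= complex.Re (f z)) -> (plint V <= B%:E)%E ->
  (plint (fun z => V z * (ind (normc z < 1)%R * complex.Re (f z)))%R <= (complex.Re (f 0) * B)%:E)%E.
Proof.
move=> hf rV V0 mV Vd f0 VB.
have mg := mC_disk_Re hf.
have g0 z : 0 <= ind (normc z < 1) * complex.Re (f z).
  by rewrite /ind; case: ifP => h; rewrite ?mul0r// mul1r; exact: f0.
have B0 : 0 <= B by rewrite -lee_fin; apply: le_trans VB; exact: plint_ge0.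
have Re0 : 0 <= complex.Re (f 0) by apply: f0; rewrite diskE normc0.
pose Vr (k : nat) z := V z * ind (normc z < 1 - 2 ^- k.+1).
have p2 k : 0 < 2 ^- k.+1 :> R by rewrite invr_gt0 exprn_gt0.
have p21 k : 2 ^- k.+1 < 1 :> R by rewrite invf_lt1 ?exprn_gt0// exprn_egt1// ltr1n.
have Vr0 k z : 0 <= Vr k z by rewrite mulr_ge0 ?ind_ge0.
have mVr k : mC (Vr k) by apply: mCM => //; exact: mC_disc.
apply: (@plint_mono_lim _ _ (fun k z => Vr k z * (ind (normc z < 1) * complex.Re (f z)))).
- exact: mCM.
- by move=> k; apply: mCM.
- by move=> z; rewrite mulr_ge0.
- by move=> k z; rewrite mulr_ge0.
- move=> k z; rewrite ler_wpM2r// ler_wpM2l// ind_le// => h; apply: lt_le_trans h _.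
  by rewrite lerD2l lerN2 lef_pV2 ?posrE ?exprn_gt0// ler_eXn2l// ltr1n.
- move=> z; have [z1|z1] := ltP (normc z) 1; last first.
    by exists 0%N; rewrite /ind !mul0r !mulr0.
  have d0 : 0 < 1 - normc z by lra.
  have [N hN] := exists_pow2_gt (1 - normc z)^-1; exists N.
  have hz : 2 ^- N.+1 < 1 - normc z.
    rewrite invf_plt ?posrE ?exprn_gt0//; apply: lt_trans hN _.
    by rewrite ltr_eXn2l// ltr1n.
  have -> : Vr N z = V z by rewrite /Vr /ind ifT ?mulr1//; lra.
  by [].
move=> k; apply/lee_addgt0Pr => e e0.
have B1 : 0 < B + 1 by lra.
have r0 : 0 < 1 - 2 ^- k.+1 :> R by have := p21 k; lra.
have r1 : 1 - 2 ^- k.+1 < 1 :> R by have := p2 k; lra.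
have [N N0 hN] := exists_circle_mean r0 r1 hf (divr_gt0 e0 B1).
have rVr : radial (Vr k).
  by move=> u z nu; rewrite /Vr (rV _ _ nu) normcM nu mul1r.
rewrite (@plint_radial (Vr k) _ N)//.
apply: (@le_trans _ _ (plint (fun z => (complex.Re (f 0) + e / (B + 1)) * V z))).
  apply: plint_le.
  - by apply: mCM => //; exact: (mC_circle_mean N mg).
  - by apply: mCM => //; exact: mC_cst.
  - by move=> z; rewrite mulr_ge0// sumr_ge0// => i _; rewrite divr_ge0.
  move=> z; rewrite /Vr /ind; case: ifPn => [zr|_]; last first.
    rewrite mulr0 mul0r mulr_ge0// addr_ge0// divr_ge0 ?ltW//.
  rewrite mulr1 mulrC ler_wpM2r//.
  have := hN z zr; set S := \sum_(k < N) f _ / _ => hS.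
  have -> : \sum_(i < N) ind (normc (zeta_root N ^+ i * z) < 1) *
      complex.Re (f (zeta_root N ^+ i * z)) / N%:R = complex.Re S.
    rewrite /S raddf_sum; apply: eq_bigr => i _.
    rewrite normcM normc_zeta_root mul1r /ind ifT; last by lra.
    have -> : (N%:R : C)^-1 = ((N%:R : R)^-1)%:C by rewrite -(rmorph_nat (real_complex R)) fmorphV.
    by case: (f _) => a b /=; rewrite mulr0 subr0 mul1r.
  have := le_trans (ler_Re _) hS; rewrite raddfB /= => h.
  by have := le_trans (ler_norm _) h; lra.
rewrite plintZ//; last by rewrite addr_ge0// divr_ge0 ?ltW.
apply: (@le_trans _ _ ((complex.Re (f 0) + e / (B + 1))%:E * B%:E)%E).
  by rewrite lee_wpmul2l// lee_fin addr_ge0// divr_ge0 ?ltW.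
rewrite -EFinM -EFinD lee_fin mulrDl lerD2l mulrAC ler_pdivrMr// ler_pM2l//; lra.
Qed.

Lemma mC_disk_sqr f : holomorphic_disk f ->
  mC (fun z => ind (normc z < 1) * normc (f z) ^+ 2).
Proof.
move=> hf; apply: mC_disk => z dz.
apply: (@continuous_comp C^o R R (fun z => normc (f z)) (fun x => x ^+ 2)).
  apply: (@continuous_comp C^o C^o R f (@normc R)); last exact: normc_continuous.
  exact/cderivable_continuous/hf.
exact: exprn_continuous.
Qed.

(** The circle averages are applied to the holomorphic function [f ^+ 2]: the modulus of an average
    is at most the average of [|f|^2]. *)
Lemma sub_mean_value f (r : R) : holomorphic_disk f -> 0 < r -> r < 1 ->
  ((normc (f 0) ^+ 2 * (r ^+ 2 * disk_area))%:E <=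
   plint (fun z => ind (normc z < r)%R * (ind (normc z < 1)%R * normc (f z) ^+ 2))%R)%E.
Proof.
move=> hf r0 r1.
pose g z := ind (normc z < 1) * normc (f z) ^+ 2.
have mg : mC g by exact: mC_disk_sqr.
have g0 z : 0 <= g z by rewrite mulr_ge0 ?ind_ge0 ?sqr_ge0.
have mV : mC (fun z : C => ind (normc z < r)) by exact: mC_disc.
have V0 (z : C) : 0 <= ind (normc z < r) :> R by exact: ind_ge0.
have rV : radial (fun z => ind (normc z < r)) by move=> u z nu; rewrite normcM nu mul1r.
apply/lee_addgt0Pr => e e0.
have A0 := @disk_area_gt0 R; have a0 : 0 < r ^+ 2 * @disk_area R by rewrite mulr_gt0 ?exprn_gt0.
pose e' := e / (r ^+ 2 * @disk_area R); have e'0 : 0 < e' by exact: divr_gt0.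
have hf2 : holomorphic_disk (fun z => f z ^+ 2) by move=> z dz; apply: cderivableX; exact: hf.
have [N N0 hN] := exists_circle_mean r0 r1 hf2 e'0.
rewrite (@plint_radial _ g N)//.
have H z : ind (normc z < r) * normc (f 0) ^+ 2 <=
   ind (normc z < r) * (\sum_(k < N) g (zeta_root N ^+ k * z) / N%:R) + e' * ind (normc z < r).
  rewrite /ind; case: ifPn => zr; last by rewrite !mul0r mulr0 addr0.
  rewrite !mul1r mulr1.
  have := hN z zr; set S := \sum_(k < N) f _ ^+ 2 / _ => hS.
  have -> : normc (f 0) ^+ 2 = normc (f 0 ^+ 2) by rewrite normcX.
  have SE : normc S <= \sum_(k < N) g (zeta_root N ^+ k * z) / N%:R.
    apply: le_trans (normc_sum _ _ _) _; apply: ler_sum => k _.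
    rewrite normcM normcX normcV /g normcM normc_zeta_root mul1r /ind ifT; last by lra.
    have -> : (N%:R : C) = (N%:R : R)%:C by rewrite rmorph_nat.
    by rewrite normc_real ger0_norm// mul1r.
  have := ler_normcB (f 0 ^+ 2) S; rewrite normcB; lra.
have E1 : ((normc (f 0) ^+ 2 * (r ^+ 2 * disk_area))%:E =
    plint (fun z : C => ind (normc z < r)%R * normc (f 0) ^+ 2)%R)%E.
  rewrite (_ : (fun z => _) = (fun z : C => normc (f 0) ^+ 2 * ind (normc z < r))).
    by rewrite plintZ ?sqr_ge0// plint_disc// -EFinM.
  by apply/funext => z; rewrite mulrC.
have E2 : (e%:E = plint (fun z : C => e' * ind (normc z < r)%R)%R)%E.
  by rewrite plintZ ?(ltW e'0)// plint_disc// -EFinM /e' divfK// gt_eqF.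
have mN : mC (fun z => ind (normc z < r) * (\sum_(k < N) g (zeta_root N ^+ k * z) / N%:R)).
  by apply: mCM => //; exact: mC_circle_mean.
have nN z : 0 <= ind (normc z < r) * (\sum_(k < N) g (zeta_root N ^+ k * z) / N%:R).
  by rewrite mulr_ge0// sumr_ge0// => i _; rewrite divr_ge0.
rewrite E1 E2 -plintD//; last 2 first.
- by apply: mCM => //; exact: mC_cst.
- by move=> z; rewrite mulr_ge0// ltW.
apply: plint_le => //.
- by apply: mCM => //; exact: mC_cst.
- by apply: mCD => //; apply: mCM => //; exact: mC_cst.
- by move=> z; rewrite mulr_ge0 ?sqr_ge0.
Qed.

(** The 1/3 is matched to the 1/2 of [box_ind]: [|x - w| < (1 - |w|) / 3] implies
    [(1 - |x|) / 2 > (1 - |w|) / 3], so [w] lies in the disc attached to [x]. *)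
Definition near_disc (w z : C) : R := ind (normc (z - w) < (1 - normc w) / 3).

Lemma mC_near_disc w : mC (near_disc w).
Proof. by apply: mC_ind_lt; [exact: mC_normcB|exact: mC_cst]. Qed.

Lemma sub_mean_value_at f (w : C) : holomorphic_disk f -> disk w ->
  ((normc (f w) ^+ 2 * ((1 - normc w) ^+ 2 * disk_area / 9))%:E <=
   plint (fun z => near_disc w z * (ind (normc z < 1)%R * normc (f z) ^+ 2))%R)%E.
Proof.
move=> hf; rewrite diskE => w1; pose d := 1 - normc w; have d0 : 0 < d by rewrite /d; lra.
pose g z := f (w + d%:C * z).
have nd z : normc z < 1 -> disk (w + d%:C * z).
  move=> z1; rewrite diskE; apply: le_lt_trans (le_normcD _ _) _.
  rewrite normcM normc_real gtr0_norm//.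
  have : d * normc z < d by rewrite gtr_pMr. rewrite /d; lra.
have hg : holomorphic_disk g.
  move=> z dz; apply: cderivable_comp; last by apply: hf; exact: nd.
  apply: cderivableD; first exact: cderivable_cst.
  by apply: cderivableM; [exact: cderivable_cst|exact: cderivable_id].
have t0 : 0 < 3^-1 :> R by rewrite invr_gt0.
have t1 : 3^-1 < 1 :> R by rewrite invf_lt1// ltr1n.
have := sub_mean_value hg t0 t1.
have mh : mC (fun z => near_disc w z * (ind (normc z < 1) * normc (f z) ^+ 2)).
  by apply: mCM; [exact: mC_near_disc|exact: mC_disk_sqr].
have h0 z : 0 <= near_disc w z * (ind (normc z < 1) * normc (f z) ^+ 2).
  by rewrite mulr_ge0 ?ind_ge0// mulr_ge0 ?ind_ge0 ?sqr_ge0.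
set P := plint _ => le1.
have E : ((d ^+ 2)%:E * P = plint (fun z => near_disc w z * (ind (normc z < 1)%R * normc (f z) ^+ 2))%R)%E.
  rewrite -(plint_shift w mh h0) -(plint_scale d0); last 2 first.
  - have := mC_mul 1 mh; rewrite /mC => _.
    have := measurableT_comp mh (_ : measurable_fun setT (fun p : measurableTypeR R * measurableTypeR R =>
       (p.1 + complex.Re w, p.2 + complex.Im w) : measurableTypeR R * measurableTypeR R)).
    move=> H; have : measurable_fun setT (fun p : measurableTypeR R * measurableTypeR R =>
       (p.1 + complex.Re w, p.2 + complex.Im w) : measurableTypeR R * measurableTypeR R).
      by apply: measurable_fun_pair; apply: measurable_funD.
    move=> /H; congr measurable_fun; apply/funext => -[x y] /=.
    by rewrite /toC /=; case: (w).
  - by move=> z; exact: h0.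
  congr (_ * _)%E; congr plint; apply/funext => z.
  rewrite /near_disc addrK normcM normc_real gtr0_norm//.
  have -> : (d * normc z < (1 - normc w) / 3) = (normc z < 3^-1) by rewrite -/d ltr_pM2l.
  rewrite /ind; case: ifPn => z3; last by rewrite !mul0r.
  have z1 : normc z < 1 by lra.
  by rewrite z1 addrC ifT ?mul1r//; exact: nd.
rewrite -E; apply: le_trans (lee_wpmul2l _ le1); last by rewrite lee_fin sqr_ge0.
rewrite -EFinM lee_fin /g mulr0 addr0 -/d.
by have -> : normc (f w) ^+ 2 * (d ^+ 2 * disk_area / 9) = d ^+ 2 * (normc (f w) ^+ 2 * (3^-1 ^+ 2 * disk_area)) by field.
Qed.

End radial_means.

(** * The Bergman weight *)

Section bergman_weight.
Context {R : realType} (alpha : R) (alpha_gtN1 : -1 < alpha).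
Local Notation C := R[i].
Implicit Types (f g phi : C -> C).

Definition weight (z : C) : R := (1 - normc z ^+ 2) `^ alpha.
Definition weight_cst : R := 4 `^ `|alpha|.
Definition bint f : \bar R :=
  plint (fun z => ind (normc z < 1) * normc (f z) ^+ 2 * weight z).

Lemma alpha1_gt0 : 0 < alpha + 1.
Proof. by rewrite -ltrBlDr sub0r. Qed.

Lemma weight_ge0 z : 0 <= weight z.
Proof. exact: powR_ge0. Qed.

Lemma weight_cst_gt0 : 0 < weight_cst.
Proof. exact: powR_gt0. Qed.

Lemma mC_weight : mC weight.
Proof.
apply: mC_powR; apply: mCB; first exact: mC_cst.
by apply: mCX; exact: mC_normc.
Qed.

Lemma mC_bint f : holomorphic_disk f ->
  mC (fun z => ind (normc z < 1) * normc (f z) ^+ 2 * weight z).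
Proof. by move=> hf; apply: mCM; [exact: mC_disk_sqr|exact: mC_weight]. Qed.

Lemma bint_integrand_ge0 f z : 0 <= ind (normc z < 1) * normc (f z) ^+ 2 * weight z.
Proof. by rewrite mulr_ge0 ?weight_ge0// mulr_ge0 ?ind_ge0 ?sqr_ge0. Qed.

Lemma bint_ge0 f : (0 <= bint f)%E.
Proof. by apply: plint_ge0 => z; exact: bint_integrand_ge0. Qed.

Lemma sqnorm_bint f : holomorphic_disk f ->
  bergman_sqnorm alpha f = (((alpha + 1) / pi)%:E * bint f)%E.
Proof.
move=> hf; rewrite /bergman_sqnorm EFinM -muleA; congr (_ * _)%E.
rewrite integral_mkcond /bint /plint.
have E : ((fun p : measurableTypeR R * measurableTypeR R =>
   (normc (f (toC p)) ^+ 2 * (1 - normc (toC p) ^+ 2) `^ alpha)%:E) \_ (toC @^-1` disk)) =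
  (fun p => (ind (normc (toC p) < 1) * normc (f (toC p)) ^+ 2 * weight (toC p))%:E).
  apply/funext => p.
  have E : (p \in toC @^-1` disk) = (normc (toC p) < 1).
    by apply/idP/idP => [/set_mem|h1]; [|exact: mem_set].
  by rewrite /patch E /ind /weight; case: (normc (toC p) < 1); rewrite ?mul1r ?mul0r.
rewrite E ge0_integral_mscale//.
- exact: mC_E (mC_bint hf).
- by move=> p _; rewrite lee_fin; exact: bint_integrand_ge0.
Qed.

(** [1 - |z|^2] lies between [1 - |z|] and [2 (1 - |z|)], hence within a factor 4 of [x] both ways,
    which settles either sign of [alpha]. *)
Lemma weight_comparable (z : C) (x : R) : normc z < 1 -> 0 < x ->
  (1 - normc z) <= 2 * x -> x <= 2 * (1 - normc z) ->
  weight z <= weight_cst * x `^ alpha /\ x `^ alpha <= weight_cst * weight z.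
Proof.
move=> z1 x0 h1 h2; have z0 := normc_ge0 z.
have w0 : 0 < 1 - normc z ^+ 2 by nra.
by split; apply: powR_comparable => //; nra.
Qed.

(** Dyadic layers: at distance about [t / 2^k] from the circle the area is [O(t / 2^k)] and the
    weight is of order [(t / 2^k)^alpha]. The layers form a geometric series of ratio
    [2^-(alpha+1)], which converges because [alpha > -1]. *)
Lemma annulus_weight : exists2 K : R, 0 < K & forall t : R, 0 < t ->
  (plint (fun z => annulus t z * weight z)%R <= (K * t `^ (alpha + 1))%:E)%E.
Proof.
pose q : R := 2 `^ (- (alpha + 1)).
have q0 : 0 <= q by exact: powR_ge0.
have q1 : q < 1 by apply: powR2_lt1; have := alpha1_gt0; lra.
have A0 := @disk_area_gt0 R; have c0 := weight_cst_gt0.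
exists (2 * @disk_area R * weight_cst / (1 - q)).
  by rewrite divr_gt0 ?mulr_gt0//; lra.
move=> t t0; pose y (k : nat) := t / 2 ^+ k.
have y0 k : 0 < y k by rewrite divr_gt0 ?exprn_gt0.
have yS k : y k.+1 = y k / 2 by rewrite /y exprS invfM mulrCA mulrC.
pose g k z := weight_cst * y k `^ alpha * annulus (y k) z.
have g0 k z : 0 <= g k z by rewrite mulr_ge0 ?annulus_ge0// mulr_ge0 ?powR_ge0// ltW.
have mg k : mC (g k) by apply: mCM; [exact: mC_cst|exact: mC_annulus].
apply: (@plint_series _ _ g).
- by apply: mCM; [exact: mC_annulus|exact: mC_weight].
- exact: mg.
- by move=> z; rewrite mulr_ge0 ?annulus_ge0 ?weight_ge0.
- exact: g0.
- move=> z; have [z1|z1] := ltP (normc z) 1; last first.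
    exists 0%N; rewrite /annulus [normc z < 1]ltNge z1 /= !mulr0 mul0r.
    by rewrite big_ord0.
  have [zt|zt] := ltP (1 - normc z) t; last first.
    exists 0%N; rewrite big_ord0 /annulus.
    by rewrite [1 - normc z < t]ltNge zt /= !mul0r.
  have d0 : 0 < 1 - normc z by lra.
  have [k [k1 k2]] : exists k, 1 - normc z < y k /\ y k.+1 <= 1 - normc z.
    have [N hN] := exists_pow2_gt (t / (1 - normc z)).
    have yN : y N <= 1 - normc z.
      by rewrite /y ler_pdivrMr ?exprn_gt0// mulrC -ler_pdivrMr// ltW.
    elim: N yN {hN} => [|N ih] yN; first by move: yN; rewrite /y expr0 divr1; lra.
    by have [/ih//|h] := leP (y N) (1 - normc z); exists N.
  exists k.+1; rewrite big_ord_recr /=.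
  have S0 : 0 <= \sum_(i < k) g i z by apply: sumr_ge0 => i _.
  suff : annulus t z * weight z <= g k z by lra.
  rewrite /g mulrC; have a1 : annulus t z <= 1.
    by rewrite /annulus -[leRHS]mulr1; apply: ler_pM; rewrite ?ind_ge0 ?ind_le1.
  have -> : annulus (y k) z = 1 by rewrite /annulus k1 z1 mulr1.
  rewrite mulr1.
  have yk2 := yS k.
  have [||h _] := @weight_comparable z (y k) z1 (y0 k); [lra|lra|].
  by apply: le_trans h; rewrite ler_piMr ?weight_ge0.
move=> N; apply: (@le_trans _ _ (\sum_(k < N) (2 * @disk_area R * weight_cst * t `^ (alpha + 1) * q ^+ k)%:E)%E).
  apply: lee_sum => k _; rewrite /g plintZ; last 3 first.
  - exact: mC_annulus.
  - exact: annulus_ge0.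
  - by rewrite mulr_ge0 ?powR_ge0// ltW.
  apply: (@le_trans _ _ ((weight_cst * y k `^ alpha)%:E * (2 * @disk_area R * y k)%:E)%E).
    rewrite lee_wpmul2l//; last exact: plint_annulus.
    by rewrite lee_fin mulr_ge0 ?powR_ge0// ltW.
  rewrite -EFinM lee_fin le_eqVlt; apply/orP; left; apply/eqP.
  have -> : weight_cst * y k `^ alpha * (2 * @disk_area R * y k) =
     2 * @disk_area R * weight_cst * (y k `^ alpha * y k) by ring.
  rewrite -{2}[y k]powRr1 ?(ltW (y0 k))// -powRD; last by rewrite (gt_eqF (y0 k)) implybT.
  by rewrite /y powR_exprn_half// -/q; ring.
rewrite sumEFin lee_fin -mulr_sumr.
rewrite [leRHS]mulrAC; apply: ler_wpM2l; last by apply: geo_sum_le; rewrite q0.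
by rewrite !mulr_ge0 ?powR_ge0// ltW.
Qed.

(** Sub-mean value property on [near_disc w], where the weight is comparable to [(1 - |w|)^alpha];
    the area contributes [(1 - |w|)^2]. *)
Lemma bint_pointwise : exists2 K : R, 0 < K & forall f w, holomorphic_disk f -> disk w ->
  ((normc (f w) ^+ 2 * (1 - normc w) `^ (alpha + 2))%:E <= K%:E * bint f)%E.
Proof.
have A0 := @disk_area_gt0 R; have c0 := weight_cst_gt0.
exists (weight_cst * 9 / @disk_area R); first by rewrite divr_gt0// mulr_gt0.
move=> f w hf dw; have := sub_mean_value_at hf dw.
move: dw; rewrite diskE => w1; set d := 1 - normc w; have d0 : 0 < d by rewrite /d; lra.
move=> h.
have le2 : (plint (fun z => near_disc w z * (ind (normc z < 1)%R * normc (f z) ^+ 2))%R <=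
    plint (fun z => weight_cst * d `^ (- alpha) * (ind (normc z < 1)%R * normc (f z) ^+ 2 * weight z))%R)%E.
  apply: plint_le.
  - by apply: mCM; [exact: mC_near_disc|exact: mC_disk_sqr].
  - by apply: mCM; [exact: mC_cst|exact: mC_bint].
  - by move=> z; rewrite mulr_ge0 ?ind_ge0// mulr_ge0 ?ind_ge0 ?sqr_ge0.
  move=> z; rewrite /near_disc -/d.
  have r0 : 0 <= weight_cst * d `^ (- alpha) * (ind (normc z < 1) * normc (f z) ^+ 2 * weight z).
    by rewrite mulr_ge0 ?bint_integrand_ge0// mulr_ge0 ?powR_ge0// ltW.
  have [hz|hz] := boolP (normc (z - w) < d / 3); last by rewrite /= mul0r.
  rewrite mul1r; have := ler_normcB z w; have := ler_normcB w z; rewrite normcB => a1 a2.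
  have d1 : d = 1 - normc w by [].
  have z1 : normc z < 1 by lra.
  rewrite z1 /= !mul1r.
  have [||_ h2] := @weight_comparable z d z1 d0; [lra|lra|].
  rewrite mulrCA ler_peMr ?sqr_ge0// powRN mulrAC ler_pdivlMr ?powR_gt0// mul1r.
  exact: h2.
have := le_trans h le2; rewrite plintZ; last 3 first.
- exact: mC_bint.
- by move=> z; exact: bint_integrand_ge0.
- by rewrite mulr_ge0 ?powR_ge0// ltW.
rewrite -/(bint f).
have B0 := bint_ge0 f; case: (bint f) B0 => [b| |] //.
  rewrite lee_fin => b0; rewrite -!EFinM !lee_fin => H.
  have P0 : 0 < d `^ alpha by exact: powR_gt0.
  have -> : d `^ (alpha + 2) = d `^ alpha * d ^+ 2.
    rewrite powRD; last by rewrite (gt_eqF d0) implybT.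
    by rewrite powR_mulrn// ltW.
  have := ler_wpM2l (mulr_ge0 (ltW P0) (divr_ge0 (ler0n _ 9) (ltW A0))) H.
  have -> : d `^ alpha * (9 / disk_area) * (normc (f w) ^+ 2 * (d ^+ 2 * disk_area / 9)) =
     normc (f w) ^+ 2 * (d `^ alpha * d ^+ 2) by field; rewrite gt_eqF.
  have -> : d `^ alpha * (9 / disk_area) * (weight_cst * d `^ (- alpha) * b) = weight_cst * 9 / disk_area * b.
    by rewrite powRN; field; rewrite !gt_eqF.
  by [].
by move=> _ _; rewrite gt0_muley ?leey// lte_fin divr_gt0 ?mulr_gt0.
Qed.

End bergman_weight.

(** * Boundedness from box masses *)

Section carleson.
Context {R : realType} (alpha : R) (alpha_gtN1 : -1 < alpha).
Local Notation C := R[i].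
Local Notation mR := (measurableTypeR R).
Local Notation leb2 := ((@lebesgue_measure R) \x (@lebesgue_measure R))%E.
Implicit Types (f g phi : C -> C) (m : C -> R).

Lemma leb2_sigma_finite : sigma_finite setT (leb2 : set (mR * mR) -> \bar R).
Proof.
exists (fun n => ball (0 : R) (2 ^+ n) `*` ball (0 : R) (2 ^+ n)).
  apply/seteqP; split => [[x y] _|//].
  have [n hn] := exists_pow2_gt (`|x| + `|y|).
  have := normr_ge0 x; have := normr_ge0 y => *.
  by exists n => //; split; rewrite /ball /= sub0r normrN; lra.
move=> n; split; first by apply: measurableX; exact: measurable_ball.
by have := @leb2_square R (2 ^+ n) (exprn_gt0 _ (ltr0n _ 2)) => ->; rewrite ltry.
Qed.

Lemma leb2_le (F G : mR * mR -> \bar R) : measurable_fun setT F -> measurable_fun setT G ->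
  (forall p, 0 <= F p)%E -> (forall p, F p <= G p)%E ->
  (\int[leb2]_p F p <= \int[leb2]_p G p)%E.
Proof.
move=> mF mG F0 FG; apply: ge0_le_integral => // p _; exact: le_trans (F0 p) (FG p).
Qed.

(* An alias is needed because the product measure carries no sigma-finite structure. *)
Definition plane_measure : set (mR * mR) -> \bar R := leb2.

HB.instance Definition _ := Measure.on plane_measure.
HB.instance Definition _ := @Measure_isSigmaFinite.Build _ _ _ plane_measure leb2_sigma_finite.

Lemma plint_tonelli (H : C -> C -> R) :
  measurable_fun setT (fun q : (mR * mR) * (mR * mR) => H (toC q.1) (toC q.2)) ->
  (forall z x, 0 <= H z x) ->
  [/\ measurable_fun setT (fun p : mR * mR => plint (H (toC p))),
    measurable_fun setT (fun q : mR * mR => plint (fun z => H z (toC q))) &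
  (\int[leb2]_p plint (H (toC p)) = \int[leb2]_q plint (fun z => H z (toC q)))%E].
Proof.
move=> mH H0; rewrite /plint.
pose mu : {sigma_finite_measure set (mR * mR)%type -> \bar R} := plane_measure.
pose f (q : (mR * mR) * (mR * mR)) := (H (toC q.1) (toC q.2))%:E.
have mf : measurable_fun setT f by exact/measurable_EFinP.
have f0 q : (0 <= f q)%E by rewrite lee_fin.
split.
- exact: (@measurable_fun_fubini_tonelli_F _ _ _ _ _ mu _ mf f0).
- exact: (@measurable_fun_fubini_tonelli_G _ _ _ _ _ mu _ mf f0).
- exact: (@fubini_tonelli _ _ _ _ _ mu mu _ mf f0).
Qed.

Variable phi : C -> C.
Hypothesis hphi : holomorphic_disk phi.
Hypothesis sphi : forall z, disk z -> disk (phi z).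

Definition box_ind (x z : C) : R :=
  ind (normc z < 1) * ind (normc (phi z - x) < (1 - normc x) / 2).

Lemma box_ind_ge0 x z : 0 <= box_ind x z.
Proof. by rewrite mulr_ge0 ?ind_ge0. Qed.

Lemma mC_box_ind x : mC (box_ind x).
Proof.
pose h z := normc (phi z - x).
have mh : mC (fun z => ind (normc z < 1) * h z).
  apply: mC_disk => z dz; apply: (@continuous_comp C^o C^o R (fun z => phi z - x) (@normc R)); last exact: normc_continuous.
  apply: cderivable_continuous; apply: cderivableB; last exact: cderivable_cst.
  exact: hphi.
suff -> : box_ind x = fun z => ind (normc z < 1) * ind (ind (normc z < 1) * h z < (1 - normc x) / 2).
  by apply: mCM; [exact: mC_disc|apply: mC_ind_lt => //; exact: mC_cst].
apply/funext => z; rewrite /box_ind /h; have [z1|z1] := boolP (normc z < 1); first by rewrite !mul1r.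
by rewrite !mul0r.
Qed.

Lemma mC_box_ind_slice z : mC (fun x => box_ind x z).
Proof.
rewrite /box_ind; apply: mCM; first exact: mC_cst.
apply: mC_ind_lt; last by apply: mCM; [apply: mCB; [exact: mC_cst|exact: mC_normc]|exact: mC_cst].
by under eq_fun do rewrite normcB; exact: mC_normcB.
Qed.

Definition box_mass m x : \bar R := plint (fun z => box_ind x z * m z).

Lemma box_mass_ge0 m x : (forall z, 0 <= m z) -> (0 <= box_mass m x)%E.
Proof. by move=> m0; apply: plint_ge0 => z; rewrite mulr_ge0 ?box_ind_ge0. Qed.

Lemma normc_ltr_sqr (u : C) (r : R) : 0 <= r ->
  (normc u < r) = (complex.Re u ^+ 2 + complex.Im u ^+ 2 < r ^+ 2).
Proof. by move=> r0; rewrite -normc_sqr ltr_sqr ?nnegrE ?normc_ge0. Qed.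

Lemma measurable_box_ind_pair :
  measurable_fun setT (fun q : (mR * mR) * (mR * mR) =>
    ind (normc (toC q.2) < 1) * box_ind (toC q.2) (toC q.1)).
Proof.
(* The cut-off parts of [phi] are measurable on the whole plane, and joint measurability is read off
   the squared distance written with them. *)
pose a z := ind (normc z < 1) * complex.Re (phi z).
pose b z := ind (normc z < 1) * complex.Im (phi z).
have mfst h : mC h -> measurable_fun setT (fun q : (mR * mR) * (mR * mR) => h (toC q.1)).
  by move=> mh; exact: (measurableT_comp mh measurable_fst).
have msnd h : mC h -> measurable_fun setT (fun q : (mR * mR) * (mR * mR) => h (toC q.2)).
  by move=> mh; exact: (measurableT_comp mh measurable_snd).
have mRe : mC (@complex.Re R) by exact: measurable_fst.
have mIm : mC (@complex.Im R) by exact: measurable_snd.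
have E : (fun q : (mR * mR) * (mR * mR) => ind (normc (toC q.2) < 1) * box_ind (toC q.2) (toC q.1)) =
  (fun q => ind (normc (toC q.2) < 1) * (ind (normc (toC q.1) < 1) *
    ind ((a (toC q.1) - complex.Re (toC q.2)) ^+ 2 + (b (toC q.1) - complex.Im (toC q.2)) ^+ 2
       < ((1 - normc (toC q.2)) / 2) ^+ 2))).
  apply/funext => -[p q] /=; rewrite /box_ind /a /b.
  have [q1|_] := boolP (normc (toC q) < 1); last by rewrite !mul0r.
  have [p1|_] := boolP (normc (toC p) < 1); last by rewrite !mul0r.
  rewrite normc_ltr_sqr; last by lra.
  by rewrite !raddfB !mul1r.
rewrite E; apply: measurable_funM; first by apply: (msnd (fun z => ind (normc z < 1))); exact: mC_disc.
apply: measurable_funM; first by apply: (mfst (fun z => ind (normc z < 1))); exact: mC_disc.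
apply: measurable_ind; apply: measurable_fun_ltr.
  apply: measurable_funD; apply: measurable_funX; apply: measurable_funB.
  - exact: (mfst a (mC_disk_Re hphi)).
  - exact: (msnd _ mRe).
  - exact: (mfst b (mC_disk_Im hphi)).
  - exact: (msnd _ mIm).
apply: measurable_funX; apply: (msnd (fun z => (1 - normc z) / 2)).
by apply: mCM; [apply: mCB; [exact: mC_cst|exact: mC_normc]|exact: mC_cst].
Qed.

(* The kernel obtained from the sub-mean value property of |f|^2 on the disc of
   radius (1 - |phi z|) / 3 about phi z. *)
Definition kern f (x : C) : R :=
  16 / @disk_area R * (1 - normc x) `^ (- 2) * (ind (normc x < 1) * normc (f x) ^+ 2).

Lemma kern_ge0 f x : 0 <= kern f x.
Proof.
have A0 := @disk_area_gt0 R; rewrite /kern; apply: mulr_ge0; last by rewrite mulr_ge0 ?ind_ge0 ?sqr_ge0.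
by rewrite mulr_ge0 ?powR_ge0// divr_ge0// ltW.
Qed.

Lemma mC_kern f : holomorphic_disk f -> mC (kern f).
Proof.
move=> hf; apply: mCM; last exact: mC_disk_sqr.
apply: mCM; first exact: mC_cst.
by apply: mC_powR; apply: mCB; [exact: mC_cst|exact: mC_normc].
Qed.

Lemma sqr_comp_le_kern f z : holomorphic_disk f -> disk z ->
  ((normc (f (phi z)) ^+ 2)%:E <=
    plint (fun x => ind (normc x < 1)%R * box_ind x z * kern f x)%R)%E.
Proof.
move=> hf dz; have A0 := @disk_area_gt0 R.
have dw := sphi dz; have := sub_mean_value_at hf dw.
move: dz dw; rewrite !diskE; set w := phi z => z1 w1.
set d := 1 - normc w; have dE : d = 1 - normc w by []. have d0 : 0 < d by rewrite /d; lra.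
move=> h; have d2 : 0 < d ^+ 2 * disk_area / 9 :> R by rewrite divr_gt0 ?mulr_gt0 ?exprn_gt0.
set c := d ^+ 2 * disk_area / 9 in h d2.
have c0 : 0 <= c^-1 by rewrite invr_ge0 ltW.
have -> : ((normc (f w) ^+ 2)%:E = (c^-1)%:E * (normc (f w) ^+ 2 * c)%:E)%E.
  by rewrite -EFinM; congr (_%:E); field; rewrite gt_eqF.
apply: (@le_trans _ _ ((c^-1)%:E * plint (fun x => near_disc w x * (ind (normc x < 1)%R * normc (f x) ^+ 2))%R)%E).
  by rewrite lee_wpmul2l// lee_fin.
have mn : mC (fun x => near_disc w x * (ind (normc x < 1) * normc (f x) ^+ 2)).
  by apply: mCM; [exact: mC_near_disc|exact: mC_disk_sqr].
have n0 x : 0 <= near_disc w x * (ind (normc x < 1) * normc (f x) ^+ 2).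
  by rewrite mulr_ge0 ?ind_ge0// mulr_ge0 ?ind_ge0 ?sqr_ge0.
rewrite -plintZ//; apply: plint_le.
- by apply: mCM => //; exact: mC_cst.
- apply: mCM; last exact: mC_kern.
  by apply: mCM; [exact: mC_disc|exact: mC_box_ind_slice].
- by move=> x; rewrite mulr_ge0.
move=> x; have rhs0 : 0 <= ind (normc x < 1) * box_ind x z * kern f x.
  by rewrite mulr_ge0 ?kern_ge0// mulr_ge0 ?ind_ge0 ?box_ind_ge0.
have [nx|nx] := boolP (normc (x - w) < d / 3); last by rewrite /near_disc -/d (negbTE nx) mul0r mulr0.
have [x1|x1] := boolP (normc x < 1); last by rewrite /= mul0r mulr0 mulr0 !mul0r.
have := ler_normcB x w; have := ler_normcB w x; rewrite [normc (w - x)]normcB => a1 a2.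
have px : box_ind x z = 1.
  have h1 : normc (w - x) < (1 - normc x) / 2 by rewrite normcB; lra.
  by rewrite /box_ind z1 -/w h1 mul1r.
rewrite /near_disc nx px /kern x1 !mul1r mulrC -[leRHS]mulrC ler_wpM2l ?sqr_ge0//.
rewrite powRN powR_mulrn; last by lra.
(* [|x - w| < d / 3] gives [y <= 4 d / 3]; the constant 16 of [kern] is there because
   [16 (3/4)^2 = 9]. *)
set y := 1 - normc x; have y0 : 0 < y by rewrite /y; lra.
have yd : 3 * y <= 4 * d by rewrite /y; lra.
rewrite /c invf_div ler_pdivrMr ?mulr_gt0 ?exprn_gt0//.
have -> : 16 / disk_area / y ^+ 2 * (d ^+ 2 * disk_area) = 16 * (d / y) ^+ 2.
  by field; rewrite !gt_eqF.
have : 3 / 4 <= d / y by rewrite ler_pdivlMr//; lra.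
nra.
Qed.

Lemma mC_comp_sqr m f : mC m -> (forall z, ~ disk z -> m z = 0) -> holomorphic_disk f ->
  mC (fun z => m z * normc (f (phi z)) ^+ 2).
Proof.
move=> mm md hf.
have hfp : holomorphic_disk (f \o phi).
  by move=> z dz; apply: cderivable_comp; [exact: hphi|exact/hf/sphi].
have -> : (fun z => m z * normc (f (phi z)) ^+ 2) =
    (fun z => m z * (ind (normc z < 1) * normc ((f \o phi) z) ^+ 2)).
  apply/funext => z /=; have [z1|z1] := boolP (normc z < 1); first by rewrite mul1r.
  by rewrite md ?mul0r// diskE; exact/negP.
by apply: mCM => //; exact: mC_disk_sqr.
Qed.

Lemma carleson_bound : exists2 K : R, 0 < K & forall m f (B : R),
  mC m -> (forall z, 0 <= m z) -> (forall z, ~ disk z -> m z = 0) -> 0 <= B ->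
  holomorphic_disk f ->
  (forall x, disk x -> (box_mass m x <= (B * (1 - normc x) `^ (alpha + 2))%:E)%E) ->
  (plint (fun z => m z * normc (f (phi z)) ^+ 2)%R <= (K * B)%:E * bint alpha f)%E.
Proof.
have A0 := @disk_area_gt0 R; have cm0 := @weight_cst_gt0 R alpha.
exists (16 / @disk_area R * weight_cst alpha); first by rewrite mulr_gt0 ?divr_gt0.
move=> m f B mm m0 md B0 hf hB.
have mL := mC_comp_sqr mm md hf.
have pk0 z x : 0 <= ind (normc x < 1) * box_ind x z * kern f x.
  by rewrite mulr_ge0 ?kern_ge0// mulr_ge0 ?ind_ge0 ?box_ind_ge0.
pose H z x := m z * (ind (normc x < 1) * box_ind x z * kern f x).
have H0 z x : 0 <= H z x.
  by rewrite mulr_ge0 ?m0// mulr_ge0 ?kern_ge0// mulr_ge0 ?ind_ge0 ?box_ind_ge0.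
have mpk z : mC (fun x => ind (normc x < 1) * box_ind x z * kern f x).
  apply: mCM; last exact: mC_kern.
  by apply: mCM; [exact: mC_disc|exact: mC_box_ind_slice].
have mH : measurable_fun setT (fun q : (mR * mR) * (mR * mR) => H (toC q.1) (toC q.2)).
  apply: measurable_funM; first exact: (measurableT_comp mm measurable_fst).
  apply: measurable_funM; first exact: measurable_box_ind_pair.
  exact: (measurableT_comp (mC_kern hf) measurable_snd).
have [mF mG EFG] := plint_tonelli mH H0.
apply: (@le_trans _ _ (\int[leb2]_p plint (H (toC p)))%E).
  apply: leb2_le; [exact: (mC_E mL)|exact: mF| |] => p.
    by rewrite lee_fin mulr_ge0 ?sqr_ge0.
  rewrite /H (plintZ (mpk _) (pk0 _) (m0 _)) EFinM; have [dp|dp] := pselect (disk (toC p)); last by rewrite md// !mul0e.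
  by rewrite lee_wpmul2l ?lee_fin//; exact: sqr_comp_le_kern.
rewrite EFG.
pose W x := ind (normc x < 1) * normc (f x) ^+ 2 * weight alpha x.
have mW : mC W by exact: mC_bint.
have W0 x : 0 <= W x by exact: bint_integrand_ge0.
have c0 : 0 <= 16 / @disk_area R * weight_cst alpha * B.
  by apply: mulr_ge0; [apply: mulr_ge0; [apply: divr_ge0|]|]; rewrite ?(ltW A0) ?(ltW cm0).
rewrite /bint -(plintZ mW W0 c0).
have mcW : mC (fun z => 16 / @disk_area R * weight_cst alpha * B * W z) by exact: (mCM (mC_cst _) mW).
apply: leb2_le; [exact: mG|exact: (mC_E mcW)| |] => q; first by apply: plint_ge0 => z; exact: H0.
set x := toC q.
(* Integrating in [z] first produces the box mass at [x]; the exponents then combine as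
   [-2 + (alpha + 2) = alpha]. *)
have -> : plint (fun z => H z x) = ((ind (normc x < 1) * kern f x)%:E * box_mass m x)%E.
  have mpm : mC (fun z => box_ind x z * m z) by exact: (mCM (mC_box_ind x) mm).
  have pm0 z : 0 <= box_ind x z * m z by exact: (mulr_ge0 (box_ind_ge0 x z) (m0 z)).
  rewrite /box_mass -(plintZ mpm pm0); last by rewrite mulr_ge0 ?ind_ge0 ?kern_ge0.
  by congr plint; apply/funext => z; rewrite /H; ring.
have [x1|x1] := boolP (normc x < 1); last first.
  by rewrite !mul0r mul0e lee_fin mulr_ge0 ?W0.
rewrite mul1r.
apply: (@le_trans _ _ ((kern f x)%:E * (B * (1 - normc x) `^ (alpha + 2))%:E)%E).
  by rewrite lee_wpmul2l ?lee_fin ?kern_ge0//; apply: hB; rewrite diskE.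
rewrite -EFinM lee_fin /kern /W x1 !mul1r.
have d0 : 0 < 1 - normc x by lra.
have -> : 16 / disk_area * (1 - normc x) `^ (- 2) * normc (f x) ^+ 2 * (B * (1 - normc x) `^ (alpha + 2)) =
   16 / disk_area * B * normc (f x) ^+ 2 * ((1 - normc x) `^ (- 2) * (1 - normc x) `^ (alpha + 2)) :> R by ring.
rewrite -powRD; last by rewrite (gt_eqF d0) implybT.
rewrite (_ : - 2 + (alpha + 2) = alpha); last by ring.
have -> : 16 / disk_area * weight_cst alpha * B * (normc (f x) ^+ 2 * weight alpha x) =
   16 / disk_area * B * normc (f x) ^+ 2 * (weight_cst alpha * weight alpha x) :> R by ring.
apply: ler_wpM2l.
  apply: mulr_ge0; last exact: sqr_ge0.
  by apply: mulr_ge0; [apply: divr_ge0|]; rewrite ?(ltW A0).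
by have [||_] := @weight_comparable _ alpha x (1 - normc x) x1 d0; [lra|lra|].
Qed.

End carleson.

(** * Kernels *)

Section kernels.
Context {R : realType} (alpha : R) (alpha_gtN1 : -1 < alpha).
Local Notation C := R[i].
Implicit Types (f g : C -> C) (x z : C).

Definition den x z : C := 1 - conjc x * z.
(** A natural exponent avoids branches of complex powers; [m] is chosen later with
    [2m > alpha + 2]. *)
Definition ker (m : nat) x z : C := (den x z)^-1 ^+ m.

Lemma Re_ge_den x z : 1 - normc x * normc z <= complex.Re (den x z).
Proof.
have := ler_Re (conjc x * z); rewrite normcM normc_conj => h.
rewrite /den raddfB /=; have := ler_norm (complex.Re (conjc x * z)); lra.
Qed.

Lemma den_ge x z : normc x < 1 -> normc z < 1 ->
  1 - normc x <= complex.Re (den x z) /\ 1 - normc z <= complex.Re (den x z).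
Proof.
move=> x1 z1; have := Re_ge_den x z; have := normc_ge0 x; have := normc_ge0 z.
by move=> *; split; nra.
Qed.

Lemma normc_den_ge x z : complex.Re (den x z) <= normc (den x z).
Proof. exact: le_trans (ler_norm _) (ler_Re _). Qed.

Lemma normc_ker m x z : normc (ker m x z) = (normc (den x z))^-1 ^+ m.
Proof. by rewrite /ker normcX normcV. Qed.

(** Split off the diagonal value: [1 - |x|^2 <= 2 (1 - |x|)] and [|x| |x - z| <= (1 - |x|) / 2],
    together 5/2. *)
Lemma den_le x z : normc x < 1 -> normc (z - x) < (1 - normc x) / 2 ->
  normc (den x z) <= 5 / 2 * (1 - normc x).
Proof.
move=> x1 xz; have x0 := normc_ge0 x.
have -> : den x z = (1 - conjc x * x) + conjc x * (x - z) by rewrite /den; ring.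
apply: le_trans (le_normcD _ _) _; rewrite mulrC mulcC normcM normc_conj.
have -> : 1 - ((normc x) ^+ 2)%:C = ((1 - normc x ^+ 2) : R)%:C :> C by rewrite rmorphB.
rewrite normc_real ger0_norm; last by nra.
rewrite [normc (x - _)]normcB; nra.
Qed.

Lemma cderivable_den x z : cderivable (den x) z.
Proof.
apply: cderivableB; first exact: cderivable_cst.
by apply: cderivableM; [exact: cderivable_cst|exact: cderivable_id].
Qed.

Lemma den_neq0 x z : normc x < 1 -> normc z < 1 -> den x z != 0.
Proof.
move=> x1 z1; apply/eqP => h; have [] := den_ge x1 z1; rewrite h /=; lra.
Qed.

Lemma ker_holo m x : normc x < 1 -> holomorphic_disk (ker m x).
Proof.
move=> x1 z; rewrite diskE => z1; apply: cderivableX; apply: cderivableV; first exact: den_neq0.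
exact: cderivable_den.
Qed.

Lemma exists_double_gt (a : R) : exists m : nat, a < m.*2%:R.
Proof.
exists (Num.bound `|a|); apply: le_lt_trans (ler_norm _) _.
apply: lt_le_trans (archi_boundP (normr_ge0 _)) _.
by rewrite ler_nat -addnn leq_addr.
Qed.

Lemma powR_exprn (a : R) k : (2 ^+ k) `^ a = (2 `^ a) ^+ k.
Proof. by rewrite -powR_mulrn// -powRrM mulrC powRrM powR_mulrn// powR_ge0. Qed.

(* [|1 - conj x z|^(-2m) <= Re (1 - conj x z)^-1 * r^(1-2m)] with [r] the mean of
   [1 - |x|] and [1 - |z|]; the first factor has mean 1 on circles and the integral
   of the radial factor is split over dyadic annuli. *)
Lemma ker_norm m : alpha + 2 < m.*2%:R -> exists2 K : R, 0 < K &
  forall x, disk x -> (bint alpha (ker m x) <= (K * (1 - normc x) `^ (alpha + 2 - m.*2%:R))%:E)%E.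
Proof.
move=> hm; have [K K0 hK] := annulus_weight alpha_gtN1.
have a1 := alpha1_gt0 alpha_gtN1.
have m0 : (0 < m)%N by rewrite lt0n; apply/eqP => m00; move: hm; rewrite m00 double0 => hm; have := a1; lra.
pose s : R := m.*2%:R - 1; have s0 : 0 < s by rewrite /s; lra.
(* The ratio of the dyadic series in [VB], below 1 because [alpha + 2 < 2m]. *)
pose q : R := 2 `^ (alpha + 1 - s).
have q0 : 0 <= q by exact: powR_ge0.
have q1 : q < 1 by apply: powR2_lt1; rewrite /s; lra.
have c40 : 0 < 4 `^ s :> R by exact: powR_gt0.
exists (4 `^ s * K / (1 - q)); first by rewrite divr_gt0 ?mulr_gt0//; lra.
move=> x; rewrite diskE => x1; pose d := 1 - normc x; have d0 : 0 < d by rewrite /d; lra.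
pose r z := (d + (1 - normc z)) / 2.
have mr : mC r.
  apply: mCM; last exact: mC_cst.
  by apply: mCD; [exact: mC_cst|apply: mCB; [exact: mC_cst|exact: mC_normc]].
pose V z := ind (normc z < 1) * (r z) `^ (- s) * weight alpha z.
have V0 z : 0 <= V z by rewrite mulr_ge0 ?weight_ge0// mulr_ge0 ?ind_ge0 ?powR_ge0.
have mV : mC V.
  by apply: mCM; [apply: mCM; [exact: mC_disc|exact: mC_powR]|exact: mC_weight].
have VB : (plint V <= (4 `^ s * K / (1 - q) * d `^ (alpha + 1 - s))%:E)%E.
  pose y (k : nat) : R := 2 ^+ k * d.
  have y0 k : 0 < y k by rewrite mulr_gt0 ?exprn_gt0.
  pose g k z := (y k / 4) `^ (- s) * (annulus (y k) z * weight alpha z).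
  have maw k : mC (fun z => annulus (y k) z * weight alpha z).
    by apply: mCM; [exact: mC_annulus|exact: mC_weight].
  have aw0 k z : 0 <= annulus (y k) z * weight alpha z.
    by rewrite mulr_ge0 ?annulus_ge0 ?weight_ge0.
  apply: (@plint_series _ V g); [exact: mV| |exact: V0| | |].
  - by move=> k; apply: mCM; [exact: mC_cst|exact: maw].
  - by move=> k z; rewrite mulr_ge0 ?powR_ge0.
  - move=> z; have [z1|z1] := ltP (normc z) 1; last first.
      exists 0%N; rewrite /V [normc z < 1]ltNge z1 /= !mul0r.
      by rewrite big_ord0.
    (* For the least such [k], either [k = 0] and [r z >= d / 2], or [1 - |z| >= y k / 2]. *)
    have [k [k1 k2]] : exists k, 1 - normc z < y k /\ y k / 4 <= r z.
      have [N hN] := exists_pow2_gt ((1 - normc z) / d).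
      have yN : 1 - normc z < y N by rewrite /y -ltr_pdivrMr.
      elim: N yN {hN} => [|N ih] yN.
        by exists 0%N; split => //; rewrite /r /y expr0 mul1r; lra.
      have [/ih//|h] := ltP (1 - normc z) (y N).
      by exists N.+1; split => //; move: h; rewrite /r /y exprS; lra.
    exists k.+1; rewrite big_ord_recr /=.
    have S0 : 0 <= \sum_(i < k) g i z by apply: sumr_ge0 => i _; rewrite mulr_ge0 ?powR_ge0.
    suff : V z <= g k z by lra.
    have -> : g k z = (y k / 4) `^ (- s) * weight alpha z.
      by rewrite /g /annulus k1 z1 !mul1r.
    rewrite /V z1 mul1r ler_wpM2r ?weight_ge0// !powRN lef_pV2 ?posrE.
    + by apply: ge0_ler_powR; rewrite ?nnegrE; [exact: ltW| |rewrite /r; lra|exact: k2]; rewrite divr_ge0// ltW.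
    + by apply: powR_gt0; have := y0 k; lra.
    + by apply: powR_gt0; have := y0 k; lra.
  move=> N; apply: (@le_trans _ _ (\sum_(k < N) (4 `^ s * K * d `^ (alpha + 1 - s) * q ^+ k)%:E)%E).
    apply: lee_sum => k _; rewrite /g (plintZ (maw k) (aw0 k) (powR_ge0 _ _)).
    apply: (@le_trans _ _ (((y k / 4) `^ (- s))%:E * (K * y k `^ (alpha + 1))%:E)%E).
      by rewrite lee_wpmul2l ?lee_fin ?powR_ge0//; exact: hK.
    rewrite -EFinM lee_fin le_eqVlt; apply/orP; left; apply/eqP.
    have -> : (y k / 4) `^ (- s) = y k `^ (- s) * 4 `^ s.
      rewrite powRM ?invr_ge0 ?(ltW (y0 k))//; congr (_ * _).
      by rewrite -[4^-1]powR_inv1// -powRrM mulN1r opprK.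
    have -> : y k `^ (- s) * 4 `^ s * (K * y k `^ (alpha + 1)) =
       4 `^ s * K * (y k `^ (- s) * y k `^ (alpha + 1)) by ring.
    rewrite -powRD; last by rewrite (gt_eqF (y0 k)) implybT.
    rewrite addrC /y powRM ?exprn_ge0 ?(ltW d0)// powR_exprn -/q; ring.
  rewrite sumEFin lee_fin -mulr_sumr.
  have -> : 4 `^ s * K / (1 - q) * d `^ (alpha + 1 - s) =
    4 `^ s * K * d `^ (alpha + 1 - s) * (1 - q)^-1 by ring.
  apply: ler_wpM2l; last by apply: geo_sum_le; rewrite q0.
  by rewrite !mulr_ge0 ?powR_ge0// ltW.
have -> : alpha + 2 - m.*2%:R = alpha + 1 - s by rewrite /s; ring.
have hh : holomorphic_disk (fun z => (den x z)^-1).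
  move=> z; rewrite diskE => z1; apply: cderivableV; first exact: den_neq0.
  exact: cderivable_den.
have rV : radial V.
  by move=> u z u1; rewrite /V /r /weight !normcM u1 mul1r.
have Vd z : ~ disk z -> V z = 0.
  by rewrite diskE => /negP/negbTE z1; rewrite /V z1 !mul0r.
have h0 z : disk z -> 0 <= complex.Re (den x z)^-1.
  rewrite diskE => z1; apply: ReV_ge0; have [? _] := den_ge x1 z1; lra.
have := radial_mean_Re hh rV V0 mV Vd h0 VB.
have -> : complex.Re (den x 0)^-1 = 1 by rewrite /den mulr0 subr0 invr1.
rewrite mul1r; apply: le_trans.
apply: plint_le.
- by apply: mC_bint; exact: ker_holo.
- by apply: mCM => //; exact: mC_disk_Re.
- by move=> z; exact: bint_integrand_ge0.
move=> z; rewrite /V; have [z1|z1] := boolP (normc z < 1); last by rewrite !mul0r.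
rewrite !mul1r [leRHS]mulrAC; apply: ler_wpM2r; first exact: weight_ge0.
rewrite normc_ker Re_inv -exprM muln2.
set w := den x z; have [w1 w2] := den_ge x1 z1.
have w3 := normc_den_ge x z.
have rz : r z <= normc w by rewrite /r /d -/w in w1 w2 w3 *; lra.
have r0 : 0 < r z by rewrite /r; lra.
have rw : r z <= complex.Re w by rewrite /r /d -/w in w1 w2 w3 *; lra.
have nw : 0 < normc w by lra.
(* Two factors [1 / |w|] are kept for [Re w^-1 = Re w / |w|^2], at the price of one [1 / r z] since
   [Re w >= r z]; each of the other [2m - 2] is at most [1 / r z]. *)
have -> : m.*2 = (m.-1.*2 + 2)%N by rewrite -{1}(prednK m0) doubleS addn2.
have -> : r z `^ (- s) = (r z ^+ (m.-1.*2 + 1))^-1.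
  rewrite powRN -powR_mulrn ?(ltW r0)//; congr (_ `^ _)^-1.
  rewrite /s -{1}(prednK m0) doubleS addn1; lra.
have e1 : (normc w ^+ m.-1.*2)^-1 <= (r z ^+ m.-1.*2)^-1.
  by rewrite lef_pV2 ?posrE ?exprn_gt0// lerXn2r ?nnegrE ?(ltW r0) ?(ltW nw).
have e2 : 1 <= (r z)^-1 * complex.Re w by rewrite mulrC ler_pdivlMr// mul1r.
have e3 : 0 < (normc w ^+ 2)^-1 by rewrite invr_gt0 exprn_gt0.
have e4 : 0 < (r z ^+ m.-1.*2)^-1 by rewrite invr_gt0 exprn_gt0.
set B := (normc w ^+ 2)^-1 in e3 *; set A := (r z ^+ m.-1.*2)^-1 in e1 e4 *.
apply: (@le_trans _ _ (A * B)).
  rewrite exprVn exprD [X in X <= _](_ : _ = (normc w ^+ m.-1.*2)^-1 * B).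
    by apply: ler_wpM2r => //; exact: ltW.
  by rewrite /B -invfM.
have -> : (r z ^+ (m.-1.*2 + 1))^-1 = A * (r z)^-1 by rewrite exprD expr1 invfM.
rewrite -mulrA; apply: ler_wpM2l; first exact: ltW.
by rewrite mulrA ler_peMl// ltW.
Qed.

End kernels.

(** * Littlewood's estimate and bumps *)

Section bumps.
Context {R : realType} (alpha : R) (alpha_gtN1 : -1 < alpha).
Local Notation C := R[i].
Implicit Types (f g : C -> C) (x z : C).
Variable phi : C -> C.
Hypothesis hphi : holomorphic_disk phi.
Hypothesis sphi : forall z, disk z -> disk (phi z).

Definition dens (w : C -> C) z : R := ind (normc z < 1) * normc (w z) ^+ 2 * weight alpha z.

Lemma dens_ge0 w z : 0 <= dens w z.
Proof. exact: bint_integrand_ge0. Qed.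

Lemma mC_dens w : holomorphic_disk w -> mC (dens w).
Proof. exact: mC_bint. Qed.

Lemma dens_out w z : ~ disk z -> dens w z = 0.
Proof. by rewrite diskE => /negP/negbTE z1; rewrite /dens z1 !mul0r. Qed.

Lemma holo_one : holomorphic_disk (fun=> 1 : C).
Proof. by move=> z _; exact: cderivable_cst. Qed.

Lemma mC_box_dens w x : holomorphic_disk w -> mC (fun z => box_ind phi x z * dens w z).
Proof. by move=> hw; exact: (mCM (mC_box_ind hphi x) (mC_dens hw)). Qed.

Lemma box_dens_ge0 w x z : 0 <= box_ind phi x z * dens w z.
Proof. exact: (mulr_ge0 (box_ind_ge0 _ _ _) (dens_ge0 _ _)). Qed.

Lemma box_ind_le1 x z : box_ind phi x z <= 1.
Proof. by rewrite /box_ind -[leRHS]mulr1; apply: ler_pM; rewrite ?ind_ge0 ?ind_le1. Qed.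

Lemma box_mass_le_bint w x : holomorphic_disk w -> (box_mass phi (dens w) x <= bint alpha w)%E.
Proof.
move=> hw; apply: plint_le; [exact: mC_box_dens|exact: mC_dens|exact: box_dens_ge0|].
move=> z; rewrite ler_piMl ?dens_ge0 ?box_ind_le1//.
Qed.

Lemma box_mass_le_bounded w x (M : R) : holomorphic_disk w ->
  (forall z, disk z -> normc (w z) <= M) ->
  (box_mass phi (dens w) x <= (M ^+ 2)%:E * box_mass phi (dens (fun=> 1%R)) x)%E.
Proof.
move=> hw hM; have h1 := holo_one.
rewrite /box_mass -(plintZ (mC_box_dens x h1) (box_dens_ge0 _ _) (sqr_ge0 _)).
apply: plint_le; [exact: mC_box_dens| |exact: box_dens_ge0|].
  by apply: mCM; [exact: mC_cst|exact: mC_box_dens].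
move=> z; rewrite [leRHS]mulrCA; apply: ler_wpM2l; first exact: box_ind_ge0.
rewrite /dens; have [z1|z1] := boolP (normc z < 1); last by rewrite !mul0r mulr0.
rewrite normc1 expr1n !mul1r; apply: ler_wpM2r; first exact: weight_ge0.
have hz := hM z z1; have := normc_ge0 (w z) => n0.
by rewrite lerXn2r// nnegrE; lra.
Qed.

(** The harmonic function is at most [1 / (1 - |phi 0|)] at 0 for every [x], and at least
    [4 / (25 d)] on the box, with [d = 1 - |x|]. The quotient supplies the missing factor [d], the
    annulus having mass [O(d^(alpha+1))]. *)
Lemma littlewood : exists2 K : R, 0 < K &
  forall x, disk x -> (box_mass phi (dens (fun=> 1%R)) x <= (K * (1 - normc x) `^ (alpha + 2))%:E)%E.
Proof.
have [K K0 hK] := annulus_weight alpha_gtN1.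
have [S S0 hS] := schwarz_pick hphi sphi.
have d0 : disk (0 : C) by rewrite diskE normc0.
have p0 : 0 < 1 - normc (phi 0) by have := sphi d0; rewrite diskE; lra.
exists (25 / 4 / (1 - normc (phi 0)) * K * (2 * S) `^ (alpha + 1)).
  by rewrite !mulr_gt0 ?invr_gt0 ?powR_gt0 ?mulr_gt0.
move=> x; rewrite diskE => x1; pose d := 1 - normc x; have dd : 0 < d by rewrite /d; lra.
have x0 := normc_ge0 x.
(* On the box [1 - |phi z| <= 3 d / 2], so the Schwarz-Pick bound gives
   [1 - |z| <= 3 S d / 2 < t]. *)
pose t := 2 * S * d; have t0 : 0 < t by rewrite !mulr_gt0.
pose V z := annulus t z * weight alpha z.
have V0 z : 0 <= V z by rewrite mulr_ge0 ?annulus_ge0 ?weight_ge0.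
have mV : mC V by apply: mCM; [exact: mC_annulus|exact: mC_weight].
have rV : radial V by move=> u z u1; rewrite /V /annulus /weight !normcM u1 mul1r.
have Vd z : ~ disk z -> V z = 0.
  by rewrite diskE => /negP/negbTE z1; rewrite /V /annulus z1 mulr0 mul0r.
pose h z := (den x (phi z))^-1.
have hh : holomorphic_disk h.
  move=> z dz; have pz := sphi dz; rewrite diskE in pz.
  apply: cderivableV; first exact: den_neq0.
  by apply: cderivable_comp; [exact: hphi|exact: cderivable_den].
have h0 z : disk z -> 0 <= complex.Re (h z).
  move=> dz; have := sphi dz; rewrite diskE => pz.
  by apply: ReV_ge0; have [? _] := den_ge x1 pz; lra.
have := radial_mean_Re hh rV V0 mV Vd h0 (hK t t0) => H.
have mH : mC (fun z => V z * (ind (normc z < 1) * complex.Re (h z))).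
  by apply: mCM => //; exact: mC_disk_Re.
have H0 z : 0 <= V z * (ind (normc z < 1) * complex.Re (h z)).
  rewrite mulr_ge0//; have [z1|_] := boolP (normc z < 1); last by rewrite mul0r.
  by rewrite mul1r h0.
(* On the box [den x (phi z)] has real part at least [d] and modulus at most [5 d / 2], so
   [25 / 4 * d * Re (h z) >= 1]. *)
have c0 : 0 <= 25 / 4 * d by rewrite mulr_ge0 ?(ltW dd).
apply: (@le_trans _ _ ((25 / 4 * d)%:E * plint (fun z => V z * (ind (normc z < 1)%R * complex.Re (h z)))%R)%E).
  rewrite -(plintZ mH H0 c0); apply: plint_le; [exact: mC_box_dens holo_one| |exact: box_dens_ge0|].
    by apply: mCM => //; exact: mC_cst.
  move=> z; have R0 : 0 <= 25 / 4 * d * (V z * (ind (normc z < 1) * complex.Re (h z))) by exact: mulr_ge0.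
  have [z1|z1] := boolP (normc z < 1); last by rewrite /box_ind (negbTE z1) /= !mul0r !mulr0.
  have [pz|pz] := boolP (normc (phi z - x) < (1 - normc x) / 2); last first.
    by move: R0; rewrite z1; apply: le_trans; rewrite /box_ind (negbTE pz) mulr0 mul0r.
  have -> : box_ind phi x z * dens (fun=> 1) z = weight alpha z.
    by rewrite /box_ind /dens z1 pz normc1 expr1n !mul1r.
  have sz := sphi z1; rewrite diskE in sz.
  have := ler_normcB x (phi z); rewrite normcB => a1.
  have := hS z z1 => a2.
  have a3 : S * (1 - normc (phi z)) <= S * (3 / 2 * d) by rewrite ler_wpM2l ?(ltW S0)// /d; lra.
  have zt : 1 - normc z < t by have := mulr_gt0 S0 dd; rewrite /t; lra.
  have -> : V z = weight alpha z by rewrite /V /annulus zt z1 !mul1r.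
  rewrite mul1r mulrCA ler_peMr ?weight_ge0// /h Re_inv.
  have [b1 _] := den_ge x1 sz; have b2 := normc_den_ge x (phi z).
  have b3 : normc (den x (phi z)) <= 5 / 2 * d by exact: den_le.
  set n := normc (den x (phi z)) in b2 b3 *.
  have n0 : 0 < n by lra.
  rewrite mulrA ler_pdivlMr ?exprn_gt0// mul1r.
  have c1 : n ^+ 2 <= (5 / 2 * d) ^+ 2 by rewrite lerXn2r// nnegrE; lra.
  apply: le_trans c1 _; have c2 : d * d <= d * complex.Re (den x (phi z)) by rewrite ler_wpM2l// /d; lra.
  have -> : (5 / 2 * d) ^+ 2 = 25 / 4 * (d * d) by field.
  by rewrite -[leRHS]mulrA ler_wpM2l.
apply: (@le_trans _ _ ((25 / 4 * d)%:E * (complex.Re (h 0) * (K * t `^ (alpha + 1)))%:E)%E).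
  by rewrite lee_wpmul2l.
rewrite -EFinM lee_fin.
have hR : complex.Re (h 0) <= (1 - normc (phi 0))^-1.
  apply: le_trans (ler_norm _) _; apply: le_trans (ler_Re _) _; rewrite normcV.
  have dp := sphi d0; rewrite diskE in dp.
  have [_ b1] := den_ge x1 dp; have b2 := normc_den_ge x (phi 0).
  by rewrite lef_pV2 ?posrE; lra.
rewrite /t powRM ?mulr_ge0 ?(ltW S0) ?(ltW dd)//.
have -> : (1 - normc x) `^ (alpha + 2) = d * d `^ (alpha + 1).
  rewrite -/d -{2}[d]powRr1 ?(ltW dd)// -powRD; last by rewrite (gt_eqF dd) implybT.
  by congr (_ `^ _); ring.
have -> : 25 / 4 * d * (complex.Re (h 0) * (K * ((2 * S) `^ (alpha + 1) * d `^ (alpha + 1)))) =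
  complex.Re (h 0) * (25 / 4 * K * (2 * S) `^ (alpha + 1) * (d * d `^ (alpha + 1))) by ring.
have -> : 25 / 4 / (1 - normc (phi 0)) * K * (2 * S) `^ (alpha + 1) * (d * d `^ (alpha + 1)) =
  (1 - normc (phi 0))^-1 * (25 / 4 * K * (2 * S) `^ (alpha + 1) * (d * d `^ (alpha + 1))) by ring.
by rewrite ler_wpM2r// !mulr_ge0 ?powR_ge0// ltW.
Qed.

Lemma mC_dens_comp w f : holomorphic_disk w -> holomorphic_disk f ->
  mC (fun z => dens w z * normc (f (phi z)) ^+ 2).
Proof.
by move=> hw hf; apply: (mC_comp_sqr hphi sphi) => //; [exact: mC_dens|exact: dens_out].
Qed.

Lemma bint_comp w f :
  bint alpha (fun z => w z * f (phi z)) = plint (fun z => dens w z * normc (f (phi z)) ^+ 2).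
Proof.
by congr plint; apply/funext => z; rewrite /dens normcM exprMn; ring.
Qed.

(** The prefactor times [|ker m x (phi z)|^2] is at least 1 on the box, by [den_le]. *)
Lemma box_mass_le_test m w x : holomorphic_disk w -> disk x ->
  (box_mass phi (dens w) x <= ((5 / 2 * (1 - normc x)) ^+ m.*2)%:E *
    bint alpha (fun z => w z * ker m x (phi z))%R)%E.
Proof.
move=> hw; rewrite diskE => x1; rewrite bint_comp.
have x0 := normc_ge0 x; pose d := 1 - normc x; have d0 : 0 < d by rewrite /d; lra.
have c0 : 0 <= (5 / 2 * (1 - normc x)) ^+ m.*2 by rewrite exprn_ge0// -/d; lra.
have hk := @ker_holo R m x x1.
have mm := mC_dens_comp hw hk.
have m0 z : 0 <= dens w z * normc (ker m x (phi z)) ^+ 2 by rewrite mulr_ge0 ?dens_ge0 ?sqr_ge0.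
rewrite -(plintZ mm m0 c0); apply: plint_le; [exact: mC_box_dens| |exact: box_dens_ge0|].
  by apply: mCM => //; exact: mC_cst.
move=> z; have R0 := mulr_ge0 c0 (m0 z).
have [z1|z1] := boolP (normc z < 1); last first.
  by rewrite dens_out ?mulr0 ?mul0r ?mulr0// diskE; exact/negP.
have [pz|pz] := boolP (normc (phi z - x) < (1 - normc x) / 2); last first.
  by apply: le_trans R0; rewrite /box_ind (negbTE pz) mulr0 mul0r.
have -> : box_ind phi x z = 1 by rewrite /box_ind z1 pz mul1r.
rewrite mul1r mulrCA ler_peMr ?dens_ge0//.
have sz := sphi z1; rewrite diskE in sz.
have [b1 _] := den_ge x1 sz; have b2 := normc_den_ge x (phi z).
have b3 : normc (den x (phi z)) <= 5 / 2 * d by exact: den_le.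
rewrite normc_ker -exprM muln2 exprVn -/d ler_pdivlMr ?mul1r; last by rewrite exprn_gt0//; lra.
by rewrite lerXn2r// nnegrE; lra.
Qed.

Lemma normc_ker_diag m x : normc x < 1 ->
  ((2 * (1 - normc x)) ^+ m.*2)^-1 <= normc (ker m x x) ^+ 2.
Proof.
move=> x1; have x0 := normc_ge0 x; rewrite normc_ker -exprM muln2 exprVn.
have -> : den x x = ((1 - normc x ^+ 2) : R)%:C by rewrite /den mulrC mulcC rmorphB.
rewrite normc_real ger0_norm; last by nra.
have h1 : 0 < 1 - normc x ^+ 2 by nra.
rewrite lef_pV2 ?posrE ?exprn_gt0//; last by lra.
by apply: lerXn2r; rewrite ?nnegrE ?(ltW h1)//; nra.
Qed.

(* Boundedness on a kernel, evaluated at z, bounds the supremum of the box mass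
   quotients of the weight [ker m z] from below. *)
Lemma bump_exists : exists2 K : R, 0 < K & forall z, disk z -> exists w,
  [/\ holomorphic_disk w, exists M, forall z, disk z -> normc (w z) <= M,
    (bint alpha w <= (K * (1 - normc (phi z)) `^ (alpha + 2))%:E)%E,
    forall x, disk x -> (box_mass phi (dens w) x <= ((1 - normc x) `^ (alpha + 2))%:E)%E &
    exists2 x, disk x & (((1 - normc x) `^ (alpha + 2) / 2)%:E <= box_mass phi (dens w) x)%E].
Proof.
have [m hm] := exists_double_gt (alpha + 2).
have [Kn Kn0 hn] := ker_norm alpha_gtN1 hm.
have [Kp Kp0 hp] := bint_pointwise alpha.
have [Kc Kc0 hc] := carleson_bound alpha hphi sphi.
have [L L0 hL] := littlewood.
exists (Kn * (4 ^+ m.*2 * Kp * Kc * Kn)); first by rewrite !mulr_gt0 ?exprn_gt0.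
move=> z0; rewrite diskE => z1; have d0 := sphi z1; rewrite diskE in d0.
set y := phi z0 in d0 *.
pose e := 1 - normc z0; pose d := 1 - normc y.
have e0 : 0 < e by rewrite /e; lra.
have dd : 0 < d by rewrite /d; lra.
pose u := ker m z0; have hu : holomorphic_disk u by exact: ker_holo.
pose M := e^-1 ^+ m.
have uM z : disk z -> normc (u z) <= M.
  rewrite diskE => zz; rewrite normc_ker lerXn2r ?nnegrE ?invr_ge0 ?normc_ge0 ?(ltW e0)//.
  have [b1 _] := den_ge z1 zz; have b2 := normc_den_ge z0 z.
  by rewrite lef_pV2 ?posrE// /e; lra.
have be x : disk x -> 0 < (1 - normc x) `^ (alpha + 2).
  by rewrite diskE => x1; apply: powR_gt0; lra.
have carM x : disk x -> (box_mass phi (dens u) x <= (M ^+ 2 * L * (1 - normc x) `^ (alpha + 2))%:E)%E.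
  move=> dx; apply: le_trans (box_mass_le_bounded _ hu uM) _.
  by rewrite -[M ^+ 2 * L * _]mulrA [leRHS]EFinM lee_wpmul2l ?lee_fin ?sqr_ge0//; exact: hL.
have car0 x : (0 <= box_mass phi (dens u) x)%E by apply: box_mass_ge0; exact: dens_ge0.
have carfin x : disk x -> box_mass phi (dens u) x \is a fin_num.
  by move=> dx; rewrite ge0_fin_numE//; apply: le_lt_trans (carM x dx) _; rewrite ltry.
(* Littlewood's estimate bounds these quotients because [u] is bounded; [u] is later divided by the
   square root of their supremum [B]. *)
pose q x := fine (box_mass phi (dens u) x) / (1 - normc x) `^ (alpha + 2).
pose S := [set q x | x in disk].
have hS : has_sup S.
  split; first by exists (q z0); exists z0.
  exists (M ^+ 2 * L) => _ [x dx <-]; rewrite ler_pdivrMr ?be//.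
  by rewrite -lee_fin fineK ?carfin//; exact: carM.
pose B := sup S.
have carB x : disk x -> (box_mass phi (dens u) x <= (B * (1 - normc x) `^ (alpha + 2))%:E)%E.
  move=> dx; rewrite -(fineK (carfin x dx)) lee_fin -ler_pdivrMr ?be//.
  by apply: (sup_upper_bound hS); exists x.
have B0 : 0 <= B.
  apply: le_trans (_ : q z0 <= _); last by apply: (sup_upper_bound hS); exists z0.
  by rewrite divr_ge0 ?powR_ge0 ?fine_ge0.
(* Since [y = phi z0], both the weight [u] and [f \o phi] are large at [z0]. *)
pose f := ker m y; have hf : holomorphic_disk f by exact: ker_holo.
have hF : holomorphic_disk (fun z => u z * f (phi z)).
  move=> z dz; apply: cderivableM; first exact: hu.
  by apply: cderivable_comp; [exact: hphi|exact/hf/sphi].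
have hcB := hc (dens u) f B (mC_dens hu) (dens_ge0 _) (@dens_out _) B0 hf carB.
rewrite -bint_comp in hcB.
have hn1 := hn y d0.
(* Point evaluation at [z0] against [carleson_bound]: the two kernels have modulus at least
   [(2 e)^-m] and [(2 d)^-m], whence [4 ^+ m.*2]. The result is a lower bound for [B]; it gives both
   [B > 0] and the small norm of the normalized weight. *)
have ineq : e `^ (alpha + 2 - m.*2%:R) <= 4 ^+ m.*2 * Kp * Kc * Kn * B * d `^ (alpha + 2).
  have h1 := hp _ z0 hF z1.
  have h2 : ((normc (u z0 * f (phi z0)) ^+ 2 * e `^ (alpha + 2))%:E <=
     (Kp * (Kc * B * (Kn * d `^ (alpha + 2 - m.*2%:R))))%:E)%E.
    apply: le_trans h1 _; rewrite [leRHS]EFinM lee_wpmul2l ?lee_fin ?(ltW Kp0)//.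
    apply: le_trans hcB _; rewrite [leRHS]EFinM lee_wpmul2l//.
    by rewrite lee_fin mulr_ge0// ltW.
  rewrite lee_fin normcM exprMn in h2.
  have h3 := normc_ker_diag m z1; have h4 := normc_ker_diag m d0; rewrite -/e -/u in h3.
  rewrite -/d -/f in h4.
  have P (t : R) : 0 < t -> t `^ (alpha + 2 - m.*2%:R) = t `^ (alpha + 2) * (t ^+ m.*2)^-1.
    by move=> t0; rewrite powRD ?powRN ?powR_mulrn ?(ltW t0)// (gt_eqF t0) implybT.
  rewrite P// in h2; rewrite P//.
  have T (t : R) : 0 < t -> 0 < (t ^+ m.*2)^-1 by move=> t0; rewrite invr_gt0 exprn_gt0.
  have te := T _ e0; have td := T _ dd.
  have h5 : ((2 * e) ^+ m.*2)^-1 * ((2 * d) ^+ m.*2)^-1 <= normc (u z0) ^+ 2 * normc (f y) ^+ 2.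
    by apply: ler_pM => //; rewrite invr_ge0 exprn_ge0// mulr_ge0// ltW.
  have h6 := le_trans (ler_wpM2r (powR_ge0 e (alpha + 2)) h5) h2.
  have g0 : 0 <= 4 ^+ m.*2 * d ^+ m.*2 by rewrite mulr_ge0 ?exprn_ge0// ltW.
  have h7 := ler_wpM2l g0 h6.
  apply: le_trans (_ : _ <= 4 ^+ m.*2 * d ^+ m.*2 *
       (((2 * e) ^+ m.*2)^-1 * ((2 * d) ^+ m.*2)^-1 * e `^ (alpha + 2))) _.
    rewrite le_eqVlt; apply/orP; left; apply/eqP.
    have -> : (4 : R) = 2 * 2 by ring.
    rewrite !exprMn; field; rewrite !expf_neq0 ?gt_eqF//.
  apply: le_trans h7 _; rewrite le_eqVlt; apply/orP; left; apply/eqP.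
  by field; rewrite expf_neq0// gt_eqF.
have Bp : 0 < B.
  rewrite lt_neqAle B0 andbT; apply/negP => /eqP B00.
  have := powR_gt0 (alpha + 2 - m.*2%:R) e0; move: ineq; rewrite -B00 mulr0 mul0r; lra.
have sB : 0 < Num.sqrt B by rewrite sqrtr_gt0.
pose w z := ((Num.sqrt B)^-1)%:C * u z.
have hw : holomorphic_disk w.
  by move=> z dz; apply: cderivableM; [exact: cderivable_cst|exact: hu].
have nw z : normc (w z) = (Num.sqrt B)^-1 * normc (u z).
  by rewrite normcM normc_real ger0_norm// invr_ge0 ltW.
have dw z : dens w z = B^-1 * dens u z.
  by rewrite /dens nw exprMn exprVn sqr_sqrtr//; ring.
have iB : 0 <= B^-1 by rewrite invr_ge0.
have carw x : box_mass phi (dens w) x = ((B^-1)%:E * box_mass phi (dens u) x)%E.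
  rewrite /box_mass -(plintZ (mC_box_dens x hu) (box_dens_ge0 _ _) iB).
  by congr plint; apply/funext => z; rewrite dw mulrCA.
exists w; split => //.
- exists ((Num.sqrt B)^-1 * M) => z dz; rewrite nw ler_wpM2l ?invr_ge0 ?(ltW sB)//.
  exact: uM.
- have -> : bint alpha w = ((B^-1)%:E * bint alpha u)%E.
    rewrite /bint -(plintZ (mC_dens hu) (dens_ge0 _) iB).
    by congr plint; apply/funext => z; exact: dw.
  apply: (@le_trans _ _ ((B^-1)%:E * (Kn * e `^ (alpha + 2 - m.*2%:R))%:E)%E).
    by rewrite lee_wpmul2l ?lee_fin//; exact: hn.
  rewrite -EFinM lee_fin mulrC ler_pdivrMr// -!mulrA ler_wpM2l ?(ltW Kn0)//.
  by apply: le_trans ineq _; rewrite -/d le_eqVlt; apply/orP; left; apply/eqP; ring.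
- move=> x dx; rewrite carw; apply: (@le_trans _ _ ((B^-1)%:E * (B * (1 - normc x) `^ (alpha + 2))%:E)%E).
    by rewrite lee_wpmul2l ?lee_fin//; exact: carB.
  by rewrite -EFinM mulKf// gt_eqF.
have [_ [x dx <-] hx] := sup_adherent (divr_gt0 Bp (ltr0n _ 2)) hS.
exists x => //; rewrite carw -(fineK (carfin x dx)) -EFinM lee_fin.
rewrite mulrC ler_pdivlMl// mulrC; have := be x dx => bx.
have : B / 2 <= q x by rewrite -/B in hx; lra.
rewrite /q ler_pdivlMr//; lra.
Qed.

End bumps.

(** * The gliding hump *)

Section gliding_hump.
Context {R : realType} (alpha : R) (alpha_gtN1 : -1 < alpha).
Local Notation C := R[i].
Implicit Types (x y z : C).

Lemma sqr_normcD (z w : C) : normc (z + w) ^+ 2 <= 2 * normc z ^+ 2 + 2 * normc w ^+ 2.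
Proof.
have h := le_normcD z w; have := normc_ge0 (z + w) => h0.
have h1 : normc (z + w) ^+ 2 <= (normc z + normc w) ^+ 2 by rewrite lerXn2r// nnegrE; lra.
have := sqr_ge0 (normc z - normc w); nra.
Qed.

Lemma sqr_normc_sum (v : nat -> C) N :
  normc (\sum_(k < N) v k) ^+ 2 <= \sum_(k < N) 2 ^+ k.+1 * normc (v k) ^+ 2.
Proof.
elim: N v => [|N ih] v; first by rewrite !big_ord0 normc0 expr0n.
rewrite !big_ord_recl /= expr1; apply: le_trans (sqr_normcD _ _) _.
rewrite lerD2l; apply: le_trans (ler_wpM2l (ler0n _ 2) (ih (fun k => v k.+1))) _.
by rewrite mulr_sumr; apply: ler_sum => i _; rewrite /bump /= add1n [2 ^+ _.+2]exprS mulrA.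
Qed.

Lemma sum_omit (v : nat -> C) k0 N : (k0 < N)%N ->
  \sum_(k < N) v k = v k0 + \sum_(k < N) (if k == k0 :> nat then 0 else v k).
Proof.
move=> kN; rewrite (bigD1 (Ordinal kN))//= [in RHS](bigD1 (Ordinal kN))//= eqxx add0r.
congr (_ + _); apply: eq_bigr => i; case: ifPn => // /eqP ik /eqP; case.
exact: val_inj.
Qed.

(* Cauchy-Schwarz with weights 2^-k; the term of index k0 is kept apart so that it
   only costs a constant factor. *)
Lemma csums_split (v : nat -> C) (l : C) k0 : csums v l ->
  let t N := \sum_(k < N) 16 * 2 ^+ k * normc (if k == k0 :> nat then 0 else v k) ^+ 2 in
  (exists N, normc l ^+ 2 <= 8 * normc (v k0) ^+ 2 + t N) /\
  (exists N, normc (v k0) ^+ 2 <= 8 * normc l ^+ 2 + t N).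
Proof.
move=> hl t.
have t0 N : 0 <= t N by apply: sumr_ge0 => k _; rewrite !mulr_ge0 ?exprn_ge0 ?normc_ge0.
have tE N : 8 * normc (\sum_(k < N) (if k == k0 :> nat then 0 else v k)) ^+ 2 <= t N.
  have := sqr_normc_sum (fun k => if k == k0 then 0 else v k) N => h.
  apply: le_trans (ler_wpM2l (ler0n _ 8) h) _; rewrite mulr_sumr; apply: ler_sum => i _.
  rewrite exprS le_eqVlt; apply/orP; left; apply/eqP; ring.
split.
- have [l0|l0] := eqVneq l 0.
    exists 0%N; rewrite l0 normc0 expr0n addr_ge0// mulr_ge0 ?sqr_ge0//.
  have n0 : 0 < normc l by rewrite normc_gt0.
  (* A partial sum within [|l| / 2] of [l] has at least half its modulus: the limit becomes a finite
     sum, at the cost of a factor 4 after squaring. *)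
  have [N0 hN] := hl _ (divr_gt0 n0 (ltr0n _ 2)).
  pose N := maxn N0 k0.+1; exists N.
  have := hN N (leq_maxl _ _); have := tE N; rewrite (sum_omit v (leq_maxr N0 k0.+1 : (k0 < N)%N)).
  set S := \sum_(k < N) _; move=> h1; rewrite normcB => h2.
  have h3 := ler_normcB l (v k0 + S).
  have h4 : normc l <= 2 * normc (v k0 + S) by lra.
  have h5 := sqr_normcD (v k0) S.
  have h6 : normc l ^+ 2 <= (2 * normc (v k0 + S)) ^+ 2.
    by rewrite lerXn2r// nnegrE; lra.
  rewrite exprMn in h6; lra.
- have [v0|v0] := eqVneq (v k0) 0.
    exists 0%N; rewrite v0 normc0 expr0n addr_ge0// mulr_ge0 ?sqr_ge0//.
  have n0 : 0 < normc (v k0) by rewrite normc_gt0.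
  have [N0 hN] := hl _ (divr_gt0 n0 (ltr0n _ 2)).
  pose N := maxn N0 k0.+1; exists N.
  have := hN N (leq_maxl _ _); have := tE N; rewrite (sum_omit v (leq_maxr N0 k0.+1 : (k0 < N)%N)).
  set S := \sum_(k < N) _; move=> h1 h2.
  have h3 : normc (v k0) <= normc (v k0 + S - l) + normc (l - S).
    have -> : v k0 = (v k0 + S - l) + (l - S) by ring.
    by rewrite {2}(_ : v k0 + S - l + (l - S) = v k0) ?le_normcD//; ring.
  have h4 : normc (v k0) <= 2 * normc (l - S) by lra.
  have := sqr_normcD l (- S); rewrite normcN => h5.
  have h6 : normc (v k0) ^+ 2 <= (2 * normc (l - S)) ^+ 2.
    by rewrite lerXn2r// nnegrE; lra.
  rewrite exprMn in h6; lra.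
Qed.

(* Chosen so that [\sum_k 16 * 2 ^ k * eta k <= 1 / 4]. *)
Definition eta (k : nat) : R := (8 ^+ k)^-1 / 100.

Lemma eta_gt0 k : 0 < eta k.
Proof. by rewrite divr_gt0 ?invr_gt0 ?exprn_gt0. Qed.

(** The integrated form of [csums_split]: [a] carries the term kept apart, and the others cost at
    most [c / 4] by the choice of [eta]. *)
Lemma plint_series_dom (h a : C -> R) (g : nat -> C -> R) (A c : R) :
  mC h -> mC a -> (forall k, mC (g k)) -> (forall z, 0 <= h z) -> (forall z, 0 <= a z) ->
  (forall k z, 0 <= g k z) ->
  (forall z, exists N, h z <= 8 * a z + \sum_(k < N) 16 * 2 ^+ k * g k z) ->
  (plint a <= A%:E)%E -> (forall k, plint (g k) <= (eta k * c)%:E)%E -> 0 <= c ->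
  (plint h <= (8 * A + c / 4)%:E)%E.
Proof.
move=> mh ma mg h0 a0 g0 hd hA hg c0.
pose f k z := if k is k'.+1 then 16 * 2 ^+ k' * g k' z else 8 * a z.
have p0 k : 0 <= 16 * 2 ^+ k :> R by rewrite mulr_ge0 ?exprn_ge0.
apply: (@plint_series _ h f _ mh _ h0).
- by case=> [|k]; apply: mCM => //; exact: mC_cst.
- by case=> [|k] z; rewrite /f ?mulr_ge0// exprn_ge0.
- by move=> z; have [N hN] := hd z; exists N.+1; rewrite big_ord_recl.
have A0 : 0 <= A by rewrite -lee_fin; apply: le_trans hA; exact: plint_ge0.
case=> [|N]; first by rewrite big_ord0 lee_fin addr_ge0 ?mulr_ge0 ?divr_ge0.
rewrite big_ord_recl EFinD; apply: leeD.
  by rewrite /f (plintZ ma a0)// EFinM lee_wpmul2l.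
apply: (@le_trans _ _ (\sum_(k < N) (16 / 100 * c * (1 / 4) ^+ k)%:E)%E).
  apply: lee_sum => k _; have -> : f (lift ord0 k) = (fun z => 16 * 2 ^+ k * g k z) by [].
  rewrite (plintZ (mg k) (g0 k))//; apply: le_trans (lee_wpmul2l _ (hg k)) _; first by rewrite lee_fin.
  rewrite -EFinM lee_fin le_eqVlt; apply/orP; left; apply/eqP.
  rewrite /eta expr_div_n expr1n.
  have -> : (8 : R) = 2 * 4 by ring.
  by rewrite exprMn; field; rewrite !expf_neq0 ?pnatr_eq0.
rewrite sumEFin lee_fin -mulr_sumr.
have q1 : 0 <= (1 / 4 : R) < 1 by apply/andP; split; lra.
have := geo_sum_le N q1; have -> : (1 - 1 / 4)^-1 = 4 / 3 :> R by field.
move=> hs; have c1 : 0 <= 16 / 100 * c by rewrite mulr_ge0.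
have := ler_wpM2l c1 hs; lra.
Qed.

Variable phi : C -> C.
Hypothesis hphi : holomorphic_disk phi.
Hypothesis sphi : forall z, disk z -> disk (phi z).
Hypothesis phi_sup : forall r, r < 1 -> exists2 z, disk z & r < normc (phi z).
Hypothesis box_mass_vanish : forall e, 0 < e -> exists2 r, r < 1 & forall x, disk x -> r < normc x ->
  (box_mass phi (dens alpha (fun=> 1%R)) x <= (e * (1 - normc x) `^ (alpha + 2))%:E)%E.

(** A bump whose norm is tiny against [(1 - r)^(alpha+2)] is negligible for [|y| <= r], since even
    its total mass is; being bounded, it inherits the vanishing assumed for the weight [1], which
    makes it negligible beyond some [s]. *)
Lemma hump_step (k : nat) (r : R) : 0 <= r < 1 -> exists (w : C -> C) (x : C) (s : R),
  [/\ holomorphic_disk w, (bint alpha w <= (eta k * (1 - r) `^ (alpha + 2))%:E)%E,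
    forall y, disk y -> (box_mass phi (dens alpha w) y <= ((1 - normc y) `^ (alpha + 2))%:E)%E,
    disk x /\ (((1 - normc x) `^ (alpha + 2) / 2)%:E <= box_mass phi (dens alpha w) x)%E &
    [/\ (1 + r) / 2 <= s < 1,
      forall y, disk y -> s <= normc y ->
        (box_mass phi (dens alpha w) y <= (eta k * (1 - normc y) `^ (alpha + 2))%:E)%E &
      forall y, disk y -> normc y <= r ->
        (box_mass phi (dens alpha w) y <= (eta k * (1 - normc y) `^ (alpha + 2))%:E)%E]].
Proof.
case/andP=> r0 r1; have [K K0 hK] := bump_exists alpha_gtN1 hphi sphi.
have e0 := eta_gt0 k; have b1 : 0 < 1 - r by lra.
have p0 : 0 < (1 - r) `^ (alpha + 2) by exact: powR_gt0.
(* As [alpha + 2 >= 1], the power [(1 - |phi z|)^(alpha+2)] is at most [1 - |phi z|], so this choice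
   makes the norm of the bump small enough. *)
have [z dz hz] : exists2 z, disk z & 1 - Num.min 1 (eta k * (1 - r) `^ (alpha + 2) / K) < normc (phi z).
  by apply: phi_sup; rewrite ltrBlDr ltrDl lt_min ltr01 divr_gt0 ?mulr_gt0.
have [w [hw [M hM] bw cw [x dx hx]]] := hK z dz.
have sz := sphi dz; rewrite diskE in sz.
have bw' : (bint alpha w <= (eta k * (1 - r) `^ (alpha + 2))%:E)%E.
  apply: le_trans bw _; rewrite lee_fin mulrC -ler_pdivlMr//.
  apply: (@le_trans _ _ (1 - normc (phi z))).
    have d0 : 0 < 1 - normc (phi z) by lra.
    rewrite -[leRHS]powRr1 ?(ltW d0)//; apply: ger_powR.
      by rewrite d0 /=; have := normc_ge0 (phi z); lra.
    have := alpha1_gt0 alpha_gtN1; lra.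
  have := ge_min (eta k * (1 - r) `^ (alpha + 2) / K) 1 (eta k * (1 - r) `^ (alpha + 2) / K).
  rewrite lexx orbT => ?; lra.
have M1 : 0 < M ^+ 2 + 1 by have := sqr_ge0 M; lra.
have [s s1 hs] := box_mass_vanish (divr_gt0 e0 M1).
(* The first midpoint turns the strict condition [s < |y|] into a weak one; the second at least
   halves [1 - r], so that the radii tend to 1. *)
exists w, x, (Num.max ((1 + s) / 2) ((1 + r) / 2)); split => //; split.
- by rewrite le_max lexx orbT /= gt_max; apply/andP; split; lra.
- move=> y dy; rewrite ge_max => /andP[sy _].
  apply: le_trans (box_mass_le_bounded alpha hphi _ hw hM) _.
  apply: (@le_trans _ _ ((M ^+ 2)%:E * (eta k / (M ^+ 2 + 1) * (1 - normc y) `^ (alpha + 2))%:E)%E).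
    by rewrite lee_wpmul2l ?lee_fin ?sqr_ge0//; apply: hs => //; lra.
  rewrite -EFinM lee_fin mulrA ler_wpM2r ?powR_ge0//.
  rewrite mulrA ler_pdivrMr//; nra.
- move=> y dy yr; apply: le_trans (box_mass_le_bint alpha hphi _ hw) _; apply: le_trans bw' _.
  rewrite lee_fin ler_wpM2l ?(ltW e0)//; apply: ge0_ler_powR.
  + by have := alpha1_gt0 alpha_gtN1; lra.
  + by rewrite nnegrE ltW.
  + by rewrite nnegrE; lra.
  + lra.
Qed.

Lemma hump_sequence : exists (w : nat -> C -> C) (x : nat -> C) (r : nat -> R),
  [/\ forall k, holomorphic_disk (w k) /\ (bint alpha (w k) <= (eta k)%:E)%E,
    forall k y, disk y -> (box_mass phi (dens alpha (w k)) y <= ((1 - normc y) `^ (alpha + 2))%:E)%E,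
    forall k, disk (x k) /\ (((1 - normc (x k)) `^ (alpha + 2) / 2)%:E <= box_mass phi (dens alpha (w k)) (x k))%E,
    forall k, r k < 1 /\ 1 - r k <= (2 ^+ k)^-1 &
    (forall k, r k <= r k.+1) /\ forall k y, disk y -> ~~ (r k < normc y < r k.+1) ->
      (box_mass phi (dens alpha (w k)) y <= (eta k * (1 - normc y) `^ (alpha + 2))%:E)%E].
Proof.
pose P (q : nat * R) (t : (C -> C) * C * R) := 0 <= q.2 < 1 ->
 [/\ holomorphic_disk t.1.1, (bint alpha t.1.1 <= (eta q.1 * (1 - q.2) `^ (alpha + 2))%:E)%E,
    forall y, disk y -> (box_mass phi (dens alpha t.1.1) y <= ((1 - normc y) `^ (alpha + 2))%:E)%E,
    disk t.1.2 /\ (((1 - normc t.1.2) `^ (alpha + 2) / 2)%:E <= box_mass phi (dens alpha t.1.1) t.1.2)%E &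
    [/\ (1 + q.2) / 2 <= t.2 < 1,
      forall y, disk y -> t.2 <= normc y ->
        (box_mass phi (dens alpha t.1.1) y <= (eta q.1 * (1 - normc y) `^ (alpha + 2))%:E)%E &
      forall y, disk y -> normc y <= q.2 ->
        (box_mass phi (dens alpha t.1.1) y <= (eta q.1 * (1 - normc y) `^ (alpha + 2))%:E)%E]].
(* The choice is made for all pairs of an index and a radius, with a dummy triple for radii out of
   range; the radii are then defined by recursion. *)
have [F hF] : {F & forall q, P q (F q)}.
  apply: choice => -[k r]; have [h|h] := pselect (0 <= r < 1); last first.
    by exists (fun=> 0, 0, 0) => /= h'.
  by have [w [x [s H]]] := hump_step k h; exists (w, x, s) => _.
pose r := fix r k := if k is k'.+1 then (F (k', r k')).2 else 0.
have r01 k : 0 <= r k < 1.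
  elim: k => [|k ih]; first by rewrite lexx ltr01.
  have [_ _ _ _ [/andP[h1 h2] _ _]] := hF (k, r k) ih.
  by case/andP: ih => h3 h4; rewrite /= in h1 h2 *; rewrite h2 andbT; lra.
have H k := hF (k, r k) (r01 k).
exists (fun k => (F (k, r k)).1.1), (fun k => (F (k, r k)).1.2), r; split.
- move=> k; have [h1 h2 _ _ _] := H k; split => //; apply: le_trans h2 _.
  rewrite lee_fin ger_pMr ?eta_gt0//=.
  have /andP[g1 g2] := r01 k; have := alpha1_gt0 alpha_gtN1 => a1.
  rewrite [leRHS](_ : 1 = 1 `^ (alpha + 2)); last by rewrite powR1.
  by apply: ge0_ler_powR; rewrite ?nnegrE; lra.
- by move=> k; have [_ _ h _ _] := H k.
- by move=> k; have [_ _ _ h _] := H k.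
- elim=> [|k [ih1 ih2]]; first by rewrite /= expr0 invr1; split => //; lra.
  have /andP[g1 g2] := r01 k.+1; split => //.
  have [_ _ _ _ [/andP[h1 h2] _ _]] := H k; rewrite exprS invfM /= in h1 h2 *; lra.
split => [k|k y dy].
  have [_ _ _ _ [/andP[h1 h2] _ _]] := H k; have /andP[g1 g2] := r01 k.
  by rewrite /= in h1 h2 *; lra.
have [_ _ _ _ [_ h1 h2]] := H k; rewrite negb_and -!leNgt => /orP[h|h].
  exact: h2.
exact: h1.
Qed.

Lemma hump_sum : exists w : C -> C,
  [/\ holomorphic_disk w, (bint alpha w < +oo)%E,
    exists2 K, 0 <= K & forall x, disk x -> (box_mass phi (dens alpha w) x <= (K * (1 - normc x) `^ (alpha + 2))%:E)%E &
    exists2 e, 0 < e & forall r, r < 1 -> exists x, [/\ disk x, r < normc x &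
      ((e * (1 - normc x) `^ (alpha + 2))%:E <= box_mass phi (dens alpha w) x)%E]].
Proof.
have [v [x [r [hv cv cx hr [rS rbad]]]]] := hump_sequence.
have [Kp Kp0 hp] := bint_pointwise alpha.
(* Point evaluation and [eta k <= 4^-k] bound the terms by [A z * 2^-k], and [A] is bounded on
   smaller discs. *)
pose A (z : C) := Num.sqrt (Kp / (1 - normc z) `^ (alpha + 2)).
have vA k z : disk z -> normc (v k z) <= A z * (1 / 2) ^+ k.
  move=> dz; have [hk bk] := hv k; have := hp _ z hk dz.
  move=> /le_trans /(_ (lee_wpmul2l _ bk)) => /(_ (ltac:(by rewrite lee_fin ltW))).
  rewrite -EFinM lee_fin; rewrite diskE in dz.
  have P0 : 0 < (1 - normc z) `^ (alpha + 2) by apply: powR_gt0; lra.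
  rewrite -ler_pdivlMr// => h.
  have A0 : 0 <= A z * (1 / 2) ^+ k by rewrite mulr_ge0 ?sqrtr_ge0 ?exprn_ge0.
  rewrite -(@ler_sqr _ _ _ (normc_ge0 _) A0) exprMn sqr_sqrtr; last by rewrite divr_ge0 ?ltW.
  apply: le_trans h _; rewrite -exprM mulnC exprM.
  rewrite mulrAC ler_wpM2l ?divr_ge0 ?(ltW Kp0) ?(ltW P0)//.
  rewrite /eta -exprVn; apply: (@le_trans _ _ (8^-1 ^+ k)).
    by rewrite ler_piMr ?exprn_ge0//; lra.
  by apply: lerXn2r; rewrite ?nnegrE ?expr2; lra.
have q1 : 0 <= (1 / 2 : R) < 1 by apply/andP; split; lra.
have sb (a : R) N : 0 <= a -> \sum_(k < N) a * (1 / 2) ^+ k <= a * (1 - 1 / 2)^-1.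
  by move=> a0; rewrite -mulr_sumr ler_wpM2l//; exact: geo_sum_le.
have [w hw] : {w : C -> C & forall z, disk z -> csums (v ^~ z) (w z)}.
  apply: (@choice _ _ (fun z l => disk z -> csums (v ^~ z) l)) => z.
  have [dz|dz] := pselect (disk z); last by exists 0.
  have [|l hl _] := @csums_exists R (v ^~ z) (A z * (1 - 1 / 2)^-1); last by exists l.
  move=> N; apply: le_trans (sb _ N (sqrtr_ge0 _)).
  by apply: ler_sum => k _; exact: vA.
have hol : holomorphic_disk w.
  apply: (@holo_sum R v w); [by move=> k; have [] := hv k| |exact: hw].
  move=> s /andP[s0 s1]; pose a := Num.sqrt (Kp / (1 - s) `^ (alpha + 2)).
  exists (fun k => a * (1 / 2) ^+ k); last first.
    by exists (a * (1 - 1 / 2)^-1) => N; apply: sb; exact: sqrtr_ge0.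
  move=> k z zs; have dz : disk z by rewrite diskE; lra.
  apply: le_trans (vA k z dz) _; rewrite ler_wpM2r ?exprn_ge0//.
  have P0 : 0 < (1 - s) `^ (alpha + 2) by apply: powR_gt0; lra.
  have P1 : (1 - s) `^ (alpha + 2) <= (1 - normc z) `^ (alpha + 2).
    apply: ge0_ler_powR; rewrite ?nnegrE; try lra.
    by have := alpha1_gt0 alpha_gtN1; lra.
  rewrite /A /a ler_sqrt ?divr_ge0 ?(ltW Kp0) ?(ltW P0)//.
  by rewrite ler_wpM2l ?(ltW Kp0)// lef_pV2 ?posrE//; lra.
have zero_holo : holomorphic_disk (fun=> 0 : C) by move=> z _; exact: cderivable_cst.
(* Comparison, in both directions, of the sum [w] with its term of index [k0], for a density [m]
   against which the other terms are small. The full weight gives the norm of [w], box densities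
   give its box masses. *)
have dom (m : C -> R) (c : R) k0 : mC m -> (forall z, 0 <= m z) -> (forall z, ~ disk z -> m z = 0) -> 0 <= c ->
    (forall f, holomorphic_disk f -> mC (fun z => m z * normc (f z) ^+ 2)) ->
    (forall k, k != k0 -> (plint (fun z => m z * normc (v k z) ^+ 2)%R <= (eta k * c)%:E)%E) ->
    (forall B : R, (plint (fun z => m z * normc (v k0 z) ^+ 2)%R <= B%:E)%E ->
      (plint (fun z => m z * normc (w z) ^+ 2)%R <= (8 * B + c / 4)%:E)%E) /\
    (forall B : R, (plint (fun z => m z * normc (w z) ^+ 2)%R <= B%:E)%E ->
      (plint (fun z => m z * normc (v k0 z) ^+ 2)%R <= (8 * B + c / 4)%:E)%E).
  move=> mm m0 mD c0 mh hk.
  pose v' k z := if k == k0 then 0 else v k z.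
  have hv' k : holomorphic_disk (v' k).
    by rewrite /v'; case: eqP => _; [exact: zero_holo|have [] := hv k].
  have n0 f z : 0 <= m z * normc (f z) ^+ 2 by rewrite mulr_ge0 ?sqr_ge0.
  have gk k : (plint (fun z => m z * normc (v' k z) ^+ 2)%R <= (eta k * c)%:E)%E.
    rewrite /v'; case: (eqVneq k k0) => [_|kk]; last exact: hk.
    rewrite (_ : (fun z => _) = fun=> 0); last by apply/funext => z; rewrite normc0 expr0n mulr0.
    rewrite /plint integral0 lee_fin mulr_ge0// ltW//; exact: eta_gt0.
  have ex (f g : C -> C) : (forall z, disk z -> exists N, normc (f z) ^+ 2 <= 8 * normc (g z) ^+ 2 +
        \sum_(k < N) 16 * 2 ^+ k * normc (v' k z) ^+ 2) ->
      forall z, exists N, m z * normc (f z) ^+ 2 <= 8 * (m z * normc (g z) ^+ 2) +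
        \sum_(k < N) 16 * 2 ^+ k * (m z * normc (v' k z) ^+ 2).
    move=> H z; have [dz|dz] := pselect (disk z); last first.
      by exists 0%N; rewrite big_ord0 mD// !mul0r mulr0 addr0.
    have [N hN] := H z dz; exists N.
    rewrite (_ : 8 * (m z * _) = m z * (8 * normc (g z) ^+ 2)); last by ring.
    have -> : \sum_(k < N) 16 * 2 ^+ k * (m z * normc (v' k z) ^+ 2) =
        m z * \sum_(k < N) 16 * 2 ^+ k * normc (v' k z) ^+ 2.
      by rewrite mulr_sumr; apply: eq_bigr => k _; rewrite mulrCA.
    by rewrite -mulrDr ler_wpM2l.
  have hv0 : holomorphic_disk (v k0) by have [] := hv k0.
  split=> B hB; apply: (@plint_series_dom _ _ (fun k z => m z * normc (v' k z) ^+ 2) B c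
    (mh _ _) (mh _ _) (fun k => mh _ (hv' k)) (n0 _) (n0 _) (fun k => n0 (v' k)) _ hB gk c0) => //;
    apply: ex => z dz; have [h1 h2] := csums_split k0 (hw z dz).
  - by have [N hN] := h1; exists N.
  - by have [N hN] := h2; exists N.
have mono k j : (k <= j)%N -> r k <= r j.
  by move=> kj; rewrite -(subnK kj); elim: (j - k)%N => // n ih; rewrite addSn; exact: le_trans ih (rS _).
have bad y k j : r k < normc y < r k.+1 -> r j < normc y < r j.+1 -> k = j.
  move=> /andP[a1 a2] /andP[b1 b2]; case: (ltngtP k j) => // kj.
  - by exfalso; have := mono _ _ kj; lra.
  - by exfalso; have := mono _ _ kj; lra.
(* The annuli are disjoint, so at most one term fails to be small at [y]. If [y] lies in none, any
   index can be set apart, because [cv] bounds every term. *)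
have exk y : exists k0, forall k, k != k0 -> ~~ (r k < normc y < r k.+1).
  have [[k0 h0]|h0] := pselect (exists k0, r k0 < normc y < r k0.+1).
    by exists k0 => k kk; apply/negP => h; move/eqP: kk; apply; exact: bad h h0.
  by exists 0%N => k _; apply/negP => h; apply: h0; exists k.
have carE (f : C -> C) y : box_mass phi (dens alpha f) y =
    plint (fun z => box_ind phi y z * (ind (normc z < 1) * weight alpha z) * normc (f z) ^+ 2)%R.
  by congr plint; apply/funext => z; rewrite /dens; ring.
have mIW : mC (fun z => ind (normc z < 1) * weight alpha z) by apply: mCM; [exact: mC_disc|exact: mC_weight].
have IW0 z : 0 <= ind (normc z < 1) * weight alpha z by rewrite mulr_ge0 ?ind_ge0 ?weight_ge0.
have IWD z : ~ disk z -> ind (normc z < 1) * weight alpha z = 0.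
  by rewrite diskE => /negP/negbTE ->; rewrite mul0r.
have cdom y (c : R) k0 : 0 <= c -> 
    (forall k, k != k0 -> (box_mass phi (dens alpha (v k)) y <= (eta k * c)%:E)%E) ->
    (forall B : R, (box_mass phi (dens alpha (v k0)) y <= B%:E)%E -> (box_mass phi (dens alpha w) y <= (8 * B + c / 4)%:E)%E) /\
    (forall B : R, (box_mass phi (dens alpha w) y <= B%:E)%E -> (box_mass phi (dens alpha (v k0)) y <= (8 * B + c / 4)%:E)%E).
  move=> c0 hc; rewrite !carE; apply: dom => //.
  - by apply: mCM => //; exact: mC_box_ind.
  - by move=> z; rewrite mulr_ge0 ?box_ind_ge0.
  - by move=> z dz; rewrite IWD ?mulr0.
  - move=> f hf; have := mC_box_dens alpha hphi y hf; congr mC; apply/funext => z; rewrite /dens; ring.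
  - by move=> k /hc; rewrite carE.
have P0 y : 0 <= (1 - normc y) `^ (alpha + 2) by exact: powR_ge0.
exists w; split => //.
- have bE (f : C -> C) : bint alpha f = plint (fun z => ind (normc z < 1) * weight alpha z * normc (f z) ^+ 2)%R.
    by congr plint; apply/funext => z; ring.
  have [h _] := dom (fun z => ind (normc z < 1) * weight alpha z) 1 0%N mIW IW0 IWD ler01
    (fun f hf => ltac:(by have := mC_bint alpha hf; congr mC; apply/funext => z; ring))
    (fun k _ => ltac:(by rewrite -bE mulr1; have [] := hv k)).
  rewrite bE; apply: le_lt_trans (h (eta 0) _) _; last by rewrite ltry.
  by rewrite -bE; have [] := hv 0%N.
- exists (8 + 1 / 4); first by lra.
  move=> y dy; have [k0 hk0] := exk y.
  have [h _] := cdom y _ k0 (P0 y) (fun k kk => rbad k y dy (hk0 k kk)).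
  by apply: le_trans (h _ (cv k0 y dy)) _; rewrite lee_fin; lra.
(* Let [P = (1 - |x k|)^(alpha+2)]. If the box mass of [w] at [x k] were below [P / 64], that of
   [v k] would be at most [(8 / 64 + 1 / 4) P < P / 2]. *)
- exists (1 / 64); first by lra.
  move=> s s1; have [k hk] := exists_pow2_gt (1 - s)^-1.
  have s0 : 0 < 1 - s by lra.
  have k1 : (2 ^+ k)^-1 < 1 - s by rewrite invf_plt ?posrE ?exprn_gt0.
  have [dx hx] := cx k; exists (x k); have [rk1 rk2] := hr k.
  have dx' : normc (x k) < 1 by move: dx; rewrite diskE.
  have Px : 0 < (1 - normc (x k)) `^ (alpha + 2) by apply: powR_gt0; lra.
  (* Outside its annulus [v k] has box mass at most [eta k] times the power, and [eta k <= 1 / 100]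
     contradicts the peak 1/2. *)
  have inr : r k < normc (x k) < r k.+1.
    apply: contraT => nb; have := le_trans hx (rbad k _ dx nb); rewrite lee_fin.
    have e1 : eta k <= 1 / 100.
      by rewrite /eta mul1r ler_piMl// invf_le1 ?exprn_gt0// exprn_ege1//; lra.
    nra.
  have oth j : j != k -> ~~ (r j < normc (x k) < r j.+1).
    by move=> jk; apply/negP => h; move/eqP: jk; apply; exact: bad h inr.
  have [_ h] := cdom (x k) _ k (P0 _) (fun j jk => rbad j _ dx (oth j jk)).
  split => //; first by case/andP: inr; lra.
  rewrite leNgt; apply/negP => lt1.
  have := le_trans hx (h _ (ltW lt1)); rewrite lee_fin; lra.
Qed.

End gliding_hump.

(** * Elements and operators of the Bergman space *)

Section bergman_elements.
Context {R : realType} (alpha : R) (alpha_gtN1 : -1 < alpha).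
Local Notation C := R[i].
Local Notation B := (bergman alpha_gtN1).
Implicit Types (f g : B) (z : C) (u v : C -> C).

Definition area_cst : R := (alpha + 1) / pi.

Lemma area_cst_gt0 : 0 < area_cst.
Proof. by rewrite divr_gt0 ?pi_gt0// (alpha1_gt0 alpha_gtN1). Qed.

Lemma in_bergmanE u : in_bergman alpha u <->
  [/\ holomorphic_disk u, (bint alpha u < +oo)%E & forall z, ~ disk z -> u z = 0].
Proof.
have c0 := area_cst_gt0.
have E : holomorphic_disk u -> (bergman_sqnorm alpha u < +oo)%E <-> (bint alpha u < +oo)%E.
  move=> hu; rewrite sqnorm_bint// -/area_cst; have := bint_ge0 alpha u.
  case: (bint alpha u) => [b| |] //= _; first by rewrite -EFinM !ltry.
  by rewrite gt0_muley ?lte_fin// ltxx; split.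
by split=> -[h1 h2 h3]; split=> //; apply/(E h1).
Qed.

Lemma bergman_inP f :
  [/\ holomorphic_disk f, (bint alpha f < +oo)%E & forall z, ~ disk z -> f z = 0].
Proof. by apply/in_bergmanE/asboolP; exact: bergman_funP. Qed.

Lemma bint_fineK f : ((fine (bint alpha f))%:E = bint alpha f)%E.
Proof.
have [_ h _] := bergman_inP f; rewrite fineK// ge0_fin_numE//; exact: bint_ge0.
Qed.

(** The norm of the space takes values in [R[i]]; this is its real form. *)
Definition fnorm f : R := Num.sqrt (area_cst * fine (bint alpha f)).

Lemma fnorm_ge0 f : 0 <= fnorm f.
Proof. exact: sqrtr_ge0. Qed.

Lemma bergman_norm_fnorm f : `|f| = (fnorm f)%:C.
Proof.
rewrite bergman_normE /bergman_norm; congr ((Num.sqrt _)%:C).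
have [h1 h2 _] := bergman_inP f.
by rewrite sqnorm_bint// -/area_cst -bint_fineK -EFinM.
Qed.

Lemma fnorm_sqr f : fnorm f ^+ 2 = area_cst * fine (bint alpha f).
Proof.
rewrite sqr_sqrtr// mulr_ge0 ?(ltW area_cst_gt0)// fine_ge0//; exact: bint_ge0.
Qed.

Lemma bint_fnorm f : bint alpha f = (fnorm f ^+ 2 / area_cst)%:E.
Proof.
by rewrite fnorm_sqr mulrAC mulfV ?mul1r ?bint_fineK// gt_eqF// area_cst_gt0.
Qed.

(** Elements of the space vanish off the disc, so a function given by a formula is cut off before it
    becomes one. *)
Definition disk_restrict u z : C := if normc z < 1 then u z else 0.

Lemma disk_restrictE u z : disk z -> disk_restrict u z = u z.
Proof. by rewrite diskE /disk_restrict => ->. Qed.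

Lemma disk_restrict_holo u : holomorphic_disk u -> holomorphic_disk (disk_restrict u).
Proof.
move=> hu z dz; have := dz; rewrite diskE => z1.
apply: (@eq_cderivable R u (disk_restrict u) z (1 - normc z)); [lra| |exact: hu].
move=> y hy; have := ler_normcB y z => h; rewrite disk_restrictE// diskE; lra.
Qed.

Lemma eq_bint u v : (forall z, disk z -> u z = v z) -> bint alpha u = bint alpha v.
Proof.
move=> uv; congr plint; apply/funext => z.
by have [z1|z1] := boolP (normc z < 1); [rewrite uv|rewrite !mul0r].
Qed.

Lemma disk_restrict_in u : holomorphic_disk u -> (bint alpha u < +oo)%E ->
  disk_restrict u \in bergman_pred alpha_gtN1.
Proof.
move=> hu bu; apply/asboolP/in_bergmanE; split.
- exact: disk_restrict_holo.
- by rewrite (@eq_bint _ u)// => z dz; rewrite disk_restrictE.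
- by move=> z; rewrite diskE /disk_restrict => /negP/negbTE ->.
Qed.

Lemma bergman_ext f g : (forall z, disk z -> f z = g z) -> f = g.
Proof.
move=> fg; apply: val_inj; apply/funext => z /=.
have [_ _ f0] := bergman_inP f; have [_ _ g0] := bergman_inP g.
by have [dz|dz] := pselect (disk z); [exact: fg|rewrite f0// g0].
Qed.

Lemma bergmanDE f g z : (f + g) z = f z + g z.
Proof. by []. Qed.

Lemma bergmanBE f g z : (f - g) z = f z - g z.
Proof. by []. Qed.

Lemma bergmanZE (a : C) f z : (a *: f) z = a * f z.
Proof. by []. Qed.

Lemma eval_bound z : disk z -> exists2 M : R, 0 < M & forall f, normc (f z) <= M * fnorm f.
Proof.
move=> dz; have [K K0 hK] := bint_pointwise alpha; have c0 := area_cst_gt0.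
have P0 : 0 < (1 - normc z) `^ (alpha + 2) by apply: powR_gt0; move: dz; rewrite diskE; lra.
have K1 : 0 < K / area_cst / (1 - normc z) `^ (alpha + 2) by exact: divr_gt0 (divr_gt0 K0 c0) P0.
exists (Num.sqrt (K / area_cst / (1 - normc z) `^ (alpha + 2))); first by rewrite sqrtr_gt0.
move=> f; have [hf _ _] := bergman_inP f; have := hK f z hf dz.
rewrite bint_fnorm -EFinM lee_fin -ler_pdivlMr// => h.
have m0 : 0 <= Num.sqrt (K / area_cst / (1 - normc z) `^ (alpha + 2)) * fnorm f.
  by rewrite mulr_ge0 ?sqrtr_ge0 ?fnorm_ge0.
rewrite -(@ler_sqr _ _ _ (normc_ge0 _) m0) exprMn sqr_sqrtr ?(ltW K1)//.
by apply: le_trans h _; rewrite le_eqVlt; apply/orP; left; apply/eqP; ring.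
Qed.

Lemma bounded_setP (A : set B) (M : R) : (forall f, A f -> fnorm f <= M) -> bounded_set A.
Proof.
move=> hM; exists M%:C; split; first by rewrite realE; case: (lerP 0 M) => h; rewrite !lecR ?h// (ltW h) orbT.
move=> x /ltW Mx f /hM fM /=; rewrite bergman_norm_fnorm; apply: le_trans Mx.
by rewrite lecR.
Qed.

Lemma bounded_set_fnorm (A : set B) : bounded_set A -> exists2 M : R, 0 < M & forall f, A f -> fnorm f <= M.
Proof.
move=> [M [Mr hM]]; pose N := `|complex.Re M| + 1.
have MN : M < N%:C.
  have [m mE] : exists m : R, M = m%:C.
    by exists (complex.Re M); case: M Mr {hM N} => a b; rewrite complex_real => /eqP /= ->.
  by rewrite /N mE ltcR /=; have := ler_norm m; lra.
exists N => [|f Af]; first by rewrite /N; have := normr_ge0 (complex.Re M); lra.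
by have := hM _ MN f Af; rewrite /= bergman_norm_fnorm lecR.
Qed.

Section operator.
Variables (phi w : C -> C) (K : R).
Hypothesis hphi : holomorphic_disk phi.
Hypothesis sphi : forall z, disk z -> disk (phi z).
Hypothesis hw : holomorphic_disk w.
Hypothesis hK : forall u, holomorphic_disk u ->
  (bint alpha (fun z => w z * u (phi z))%R <= K%:E * bint alpha u)%E.

Definition wcomp_fun f : C -> C := disk_restrict (fun z => w z * f (phi z)).

Lemma holo_wcomp u : holomorphic_disk u -> holomorphic_disk (fun z => w z * u (phi z)).
Proof.
move=> hu z dz; apply: cderivableM; first exact: hw.
by apply: cderivable_comp; [exact: hphi|exact/hu/sphi].
Qed.

Lemma wcomp_in f : wcomp_fun f \in bergman_pred alpha_gtN1.
Proof.
have [hf _ _] := bergman_inP f; apply: disk_restrict_in; first exact: holo_wcomp.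
by apply: le_lt_trans (hK hf) _; rewrite bint_fnorm -EFinM ltry.
Qed.

Definition wcomp f : B := Bergman (wcomp_in f).

Lemma wcompE f z : disk z -> wcomp f z = w z * f (phi z).
Proof. by move=> dz; rewrite /= /wcomp_fun disk_restrictE. Qed.

Lemma wcomp_linear : linear wcomp.
Proof.
move=> a f g; apply: bergman_ext => z dz.
by rewrite bergmanDE bergmanZE !wcompE// bergmanDE bergmanZE; ring.
Qed.

Lemma wcomp_bounded : 0 <= K -> bounded_operator wcomp.
Proof.
move=> K0; exists (Num.sqrt K) => f; rewrite !bergman_norm_fnorm -rmorphM lecR.
have r0 : 0 <= Num.sqrt K * fnorm f by rewrite mulr_ge0 ?sqrtr_ge0 ?fnorm_ge0.
rewrite -(@ler_sqr _ _ _ (fnorm_ge0 _) r0) exprMn [Num.sqrt K ^+ 2]sqr_sqrtr// !fnorm_sqr mulrCA.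
rewrite ler_wpM2l ?(ltW area_cst_gt0)//.
have [hf _ _] := bergman_inP f; have := hK hf.
rewrite -(@eq_bint (wcomp f)); last by move=> z dz; rewrite wcompE.
by rewrite -(bint_fineK f) -bint_fineK -EFinM lee_fin !bint_fineK.
Qed.

End operator.
End bergman_elements.

(** * Noncompactness *)

Section noncompact.
Context {R : realType} (alpha : R) (alpha_gtN1 : -1 < alpha).
Local Notation C := R[i].
Local Notation B := (bergman alpha_gtN1).
Implicit Types (z : C).
Variables (phi w : C -> C) (K e : R).
Hypothesis hphi : holomorphic_disk phi.
Hypothesis sphi : forall z, disk z -> disk (phi z).
Hypothesis hw : holomorphic_disk w.
Hypothesis hK : forall u : C -> C, holomorphic_disk u ->
  (bint alpha (fun z => w z * u (phi z))%R <= K%:E * bint alpha u)%E.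
Hypothesis e0 : 0 < e.
Hypothesis low : forall r, r < 1 -> exists x, [/\ disk x, r < normc x &
  ((e * (1 - normc x) `^ (alpha + 2))%:E <= box_mass phi (dens alpha w) x)%E].

Let T := wcomp (alpha_gtN1 := alpha_gtN1) hphi sphi hw hK.

Lemma bint_scale (a : C) u : holomorphic_disk u ->
  bint alpha (fun z => a * u z) = ((normc a ^+ 2)%:E * bint alpha u)%E.
Proof.
move=> hu; rewrite /bint -(plintZ (mC_bint alpha hu) (bint_integrand_ge0 _ _) (sqr_ge0 _)).
by congr plint; apply/funext => z; rewrite normcM exprMn; ring.
Qed.

(** The functions are kernels at points [x n] tending to the circle, scaled by [d n ^ s]. Norms are
    bounded by [ker_norm]; images are bounded below because [box_mass_le_test] detects the box mass
    of [w]; images tend to 0 at each [z] because [1 - conj (x n) * phi z] stays away from 0. *)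
Lemma wcomp_test_functions : exists2 M : R, 0 < M & exists2 c : R, 0 < c &
  exists f : nat -> B, (forall n, fnorm (f n) <= M /\ c <= fnorm (T (f n))) /\
    forall z, disk z -> forall eps, 0 < eps -> exists N, forall n, (N <= n)%N -> normc (T (f n) z) < eps.
Proof.
have a1 := alpha1_gt0 alpha_gtN1; have c0 := area_cst_gt0 alpha_gtN1.
have [m hm] := exists_double_gt (alpha + 2).
have [Kn Kn0 hn] := ker_norm alpha_gtN1 hm.
(* [2 s] is the opposite of the exponent in [ker_norm], which bounds the norms, and [s > 0] gives
   the pointwise decay. *)
pose s := m%:R - (alpha + 2) / 2.
have m2 : m.*2%:R = 2 * m%:R :> R by rewrite -mul2n natrM.
have s0 : 0 < s by rewrite /s; lra.
have [x hx] : {x : nat -> C & forall n, [/\ disk (x n), 1 - (2 ^+ n)^-1 < normc (x n) &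
    ((e * (1 - normc (x n)) `^ (alpha + 2))%:E <= box_mass phi (dens alpha w) (x n))%E]}.
  apply: (@choice _ _ (fun n x => [/\ disk x, 1 - (2 ^+ n)^-1 < normc x &
    ((e * (1 - normc x) `^ (alpha + 2))%:E <= box_mass phi (dens alpha w) x)%E])) => n.
  by apply: low; rewrite ltrBlDr ltrDl invr_gt0 exprn_gt0.
pose d n := 1 - normc (x n).
have d0 n : 0 < d n by have [] := hx n; rewrite diskE /d => *; lra.
have dn n : d n <= 1 / 2 ^+ n by have [_ h _] := hx n; rewrite /d mul1r; lra.
have dx n : normc (x n) < 1 by have := d0 n; rewrite /d; lra.
pose u n z : C := ((d n) `^ s)%:C * ker m (x n) z.
have hu n : holomorphic_disk (u n).
  by move=> z dz; apply: cderivableM; [exact: cderivable_cst|exact: (@ker_holo R m (x n) (dx n) z dz)].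
have nd n : normc ((d n `^ s)%:C : C) = d n `^ s by rewrite normc_real ger0_norm ?powR_ge0.
have sqd n : (d n `^ s) ^+ 2 = d n `^ (m.*2%:R - (alpha + 2)).
  by rewrite -powR_mulrn ?powR_ge0// -powRrM; congr (_ `^ _); rewrite m2 /s; field.
have bu n : (bint alpha (u n) <= Kn%:E)%E.
  rewrite bint_scale; last exact: ker_holo.
  rewrite nd sqd; apply: (@le_trans _ _ ((d n `^ (m.*2%:R - (alpha + 2)))%:E * (Kn * d n `^ (alpha + 2 - m.*2%:R))%:E)%E).
    by rewrite lee_wpmul2l ?lee_fin ?powR_ge0//; apply: hn; rewrite diskE.
  rewrite -EFinM lee_fin mulrCA -powRD; last by rewrite (gt_eqF (d0 n)) implybT.
  by rewrite (_ : m.*2%:R - (alpha + 2) + (alpha + 2 - m.*2%:R) = 0) ?powRr0 ?mulr1//; ring.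
have bfin n : (bint alpha (u n) < +oo)%E by apply: le_lt_trans (bu n) _; rewrite ltry.
pose f n : B := Bergman (disk_restrict_in alpha_gtN1 (hu n) (bfin n)).
have fE n z : disk z -> f n z = u n z by move=> dz; rewrite /= disk_restrictE.
(* The lower bound [e] for box masses, reduced by the factor that [box_mass_le_test] loses. *)
pose c2 := e / (5 / 2) ^+ m.*2.
have c20 : 0 < c2 by rewrite divr_gt0 ?exprn_gt0//; lra.
exists (Num.sqrt (area_cst alpha * Kn)); first by rewrite sqrtr_gt0 mulr_gt0.
exists (Num.sqrt (area_cst alpha * c2)); first by rewrite sqrtr_gt0 mulr_gt0.
exists f; split=> [n|z dz eps eps0].
  split.
    apply: ler_wsqrtr; apply: ler_wpM2l; first exact: ltW.
    by rewrite -lee_fin bint_fineK (@eq_bint _ _ (f n) (u n) (fE n)).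
  have hk := @ker_holo R m (x n) (dx n).
  apply: ler_wsqrtr; apply: ler_wpM2l; first exact: ltW.
  rewrite -lee_fin bint_fineK.
  have -> : bint alpha (T (f n)) = ((d n `^ (m.*2%:R - (alpha + 2)))%:E *
     bint alpha (fun z => w z * ker m (x n) (phi z))%R)%E.
    rewrite -sqd -nd -bint_scale; last exact: holo_wcomp.
    apply: eq_bint => z dz; rewrite wcompE// fE; last exact: sphi.
    by rewrite /u mulrCA.
  have [dxn _ l1] := hx n.
  have l2 := le_trans l1 (box_mass_le_test alpha hphi sphi m hw dxn).
  have p5 : 0 < (5 / 2 * d n) ^+ m.*2 by rewrite exprn_gt0// mulr_gt0//; lra.
  have l3 : ((c2 * d n `^ (alpha + 2 - m.*2%:R))%:E <= bint alpha (fun z => w z * ker m (x n) (phi z))%R)%E.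
    set b := bint alpha _ in l2 *; rewrite -/(d n) in l2; set t := (5 / 2 * d n) ^+ m.*2 in l2 p5.
    have -> : b = ((t^-1)%:E * (t%:E * b))%E by rewrite muleA -EFinM mulVf ?mul1e// gt_eqF.
    apply: le_trans (lee_wpmul2l _ l2); last by rewrite lee_fin invr_ge0 ltW.
    rewrite -EFinM lee_fin le_eqVlt; apply/orP; left; apply/eqP; rewrite /t.
    rewrite powRD; last by rewrite (gt_eqF (d0 n)) implybT.
    rewrite powRN powR_mulrn ?(ltW (d0 n))// exprMn /c2 invfM; ring.
  apply: le_trans (lee_wpmul2l _ l3); last by rewrite lee_fin powR_ge0.
  rewrite -EFinM lee_fin mulrCA -powRD; last by rewrite (gt_eqF (d0 n)) implybT.
  by rewrite (_ : m.*2%:R - (alpha + 2) + (alpha + 2 - m.*2%:R) = 0) ?powRr0 ?mulr1//; ring.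
have sz := sphi dz; rewrite diskE in sz.
have pz : 0 < 1 - normc (phi z) by lra.
have q1 : 0 <= (2 `^ (- s) : R) < 1 by rewrite powR_ge0 powR2_lt1//; lra.
have [N hN] := exists_pow_small (normc (w z) * (1 - normc (phi z))^-1 ^+ m) q1 eps0.
exists N => n Nn; rewrite wcompE// fE; last exact: sphi.
apply: le_lt_trans (hN n Nn); rewrite normcM -mulrA ler_wpM2l ?normc_ge0//.
rewrite /u normcM nd mulrC normc_ker.
have [_ b1] := den_ge (dx n) sz; have b2 := normc_den_ge (x n) (phi z).
apply: ler_pM; rewrite ?powR_ge0 ?exprn_ge0 ?invr_ge0 ?normc_ge0//.
  rewrite lerXn2r ?nnegrE ?invr_ge0 ?normc_ge0 ?(ltW pz)//.
  by rewrite lef_pV2 ?posrE; lra.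
apply: (@le_trans _ _ ((1 / 2 ^+ n) `^ s)).
  apply: ge0_ler_powR; [exact: ltW|by rewrite nnegrE ltW| |exact: dn].
  by rewrite nnegrE divr_ge0 ?exprn_ge0.
by rewrite powR_exprn_half// powR1 mul1r.
Qed.

(** Compactness gives the images a cluster point [g]. Point evaluations are continuous, so pointwise
    decay forces [g = 0], against the lower bound on the norms. *)
Lemma wcomp_not_compact : ~ compact_operator T.
Proof.
move=> cT; have [M M0 [c c0 [f [fM fT]]]] := wcomp_test_functions.
have bA : bounded_set (range f).
  by apply: (@bounded_setP _ _ _ _ M) => _ [n _ <-]; have [] := fM n.
have [Q QA [cQ _]] := cT _ bA.
have FQ : ((fun n => T (f n)) @ \oo) Q.
  by exists 0%N => // n _; apply: QA; exists (f n) => //; exists n.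
have [g [_ gcl]] := cQ _ (fmap_proper_filter _ eventually_filter) FQ.
have close N (eps : R) : 0 < eps -> exists2 n, (N <= n)%N & fnorm (T (f n) - g) < eps.
  move=> eps0.
  have h1 : ((fun n => T (f n)) @ \oo) [set T (f n) | n in [set n | (N <= n)%N]].
    by exists N => // n Nn; exists n.
  have h2 : nbhs g (ball g eps%:C) by apply: nbhsx_ballx; rewrite ltcR.
  have [_ [[n Nn <-] hb]] := gcl _ _ h1 h2; exists n => //.
  by move: hb; rewrite -ball_normE /ball_ /= distrC bergman_norm_fnorm ltcR.
have g0 z : disk z -> g z = 0.
  move=> dz; apply/eq0_normc/le_anti; rewrite normc_ge0 andbT.
  apply/ler_addgt0Pr => eps eps0; rewrite add0r.
  have [D D0 hD] := eval_bound alpha_gtN1 dz.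
  have [N hN] := fT z dz (eps / 2) (divr_gt0 eps0 (ltr0n _ 2)).
  have [n Nn hn] := close N (eps / 2 / D) (divr_gt0 (divr_gt0 eps0 (ltr0n _ 2)) D0).
  have h1 := hN n Nn; have := hD (T (f n) - g); rewrite bergmanBE => h2.
  have h3 : D * fnorm (T (f n) - g) < eps / 2 by rewrite mulrC -ltr_pdivlMr.
  have := ler_normcB (g z) (T (f n) z); rewrite normcB; lra.
have gE : g = 0 by apply: bergman_ext => z dz; rewrite g0.
have [n _] := close 0%N c c0; rewrite gE subr0.
by have [_ h] := fM n; lra.
Qed.

End noncompact.

(** * Decompactifiability when the supremum is one *)

Section sup_one.
Context {R : realType} (alpha : R) (alpha_gtN1 : -1 < alpha).
Local Notation C := R[i].
Local Notation B := (bergman alpha_gtN1).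
Variables (phi : C -> C).
Hypothesis hphi : holomorphic_disk phi.
Hypothesis sphi : forall z, disk z -> disk (phi z).
Hypothesis phi_sup : forall r, r < 1 -> exists2 z, disk z & r < normc (phi z).

Lemma bint_one_lty : (bint alpha (fun=> 1%R) < +oo)%E.
Proof.
(* The annulus of width 2 is the whole disc. *)
have [K K0 hK] := annulus_weight alpha_gtN1; have := hK 2 (ltr0n _ 2).
move=> h; apply: le_lt_trans (_ : (_ <= (K * 2 `^ (alpha + 1))%:E)%E) _; last exact: ltry.
apply: le_trans h; rewrite le_eqVlt; apply/orP; left; apply/eqP.
congr plint; apply/funext => z; rewrite /annulus normc1 expr1n mulr1.
have z0 := normc_ge0 z; have -> : 1 - normc z < 2 by lra.
by rewrite mul1r.
Qed.

Lemma exists_weight : exists w : C -> C,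
  [/\ holomorphic_disk w, (bint alpha w < +oo)%E,
    exists2 K, 0 <= K & forall x, disk x -> (box_mass phi (dens alpha w) x <= (K * (1 - normc x) `^ (alpha + 2))%:E)%E &
    exists2 e, 0 < e & forall r, r < 1 -> exists x, [/\ disk x, r < normc x &
      ((e * (1 - normc x) `^ (alpha + 2))%:E <= box_mass phi (dens alpha w) x)%E]].
Proof.
pose van e := exists2 r, r < 1 & forall x, disk x -> r < normc x ->
  (box_mass phi (dens alpha (fun=> 1%R)) x <= (e * (1 - normc x) `^ (alpha + 2))%:E)%E.
have [h|h] := pselect (forall e, 0 < e -> van e).
  exact: (hump_sum alpha_gtN1 hphi sphi phi_sup h).
move/existsNP: h => [e /not_implyP [e0 he]].
exists (fun=> 1); split; [exact: holo_one|exact: bint_one_lty| |].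
  by have [K K0 hK] := littlewood alpha_gtN1 hphi sphi; exists K => //; exact: ltW.
exists e => // r r1; apply: contrapT => hn; apply: he; exists r => // x dx rx.
by rewrite leNgt; apply/negP => lt1; apply: hn; exists x; split => //; exact: ltW.
Qed.

Lemma decompactifiable_sup_one : decompactifiable alpha_gtN1 phi.
Proof.
have [w [hw bw [K K0 hK] [e e0 he]]] := exists_weight.
have [Kc Kc0 hc] := carleson_bound alpha hphi sphi.
have hB (u : C -> C) : holomorphic_disk u ->
    (bint alpha (fun z => w z * u (phi z))%R <= (Kc * K)%:E * bint alpha u)%E.
  move=> hu; have := hc (dens alpha w) u K (mC_dens alpha hw) (dens_ge0 alpha _) (@dens_out _ alpha w) K0 hu hK.
  by rewrite -bint_comp.
pose T := wcomp (alpha_gtN1 := alpha_gtN1) hphi sphi hw hB.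
pose L : {linear B -> B} := HB.pack T (GRing.isLinear.Build _ _ _ _ T (wcomp_linear hphi sphi hw hB)).
exists (Bergman (disk_restrict_in alpha_gtN1 hw bw)), L; split.
- by move=> f z dz; rewrite [LHS](wcompE hphi sphi hw hB)//= disk_restrictE.
- exact: (wcomp_bounded alpha_gtN1 hphi sphi hw hB (mulr_ge0 (ltW Kc0) K0)).
- exact: (@wcomp_not_compact _ _ alpha_gtN1 _ _ _ _ hphi sphi hw hB e0 he).
Qed.

End sup_one.

(** * Compactness when the range is relatively compact *)

Section sup_lt_one.
Context {R : realType} (alpha : R) (alpha_gtN1 : -1 < alpha).
Local Notation C := R[i].
Local Notation B := (bergman alpha_gtN1).

(** As the image of a product of segments it is visibly compact; the price is a factor 2 in
    [square_normc]. *)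
Definition square (a : R) : set C^o := toC @` (`[- a, a] `*` `[- a, a]).

Lemma square_compact a : compact (square a).
Proof.
apply: continuous_compact; first by apply: continuous_subspaceT; exact: toC_continuous.
by apply: compact_setX; exact: segment_compact.
Qed.

Lemma square_normc a z : square a z -> normc z <= 2 * a.
Proof.
move=> [[x y] [/= hx hy] <-]; move: hx hy; rewrite !in_itv /= -!ler_norml => hx hy.
by apply: le_trans (normc_toC (x, y)) _ => /=; lra.
Qed.

Lemma normc_square a (z : C) : normc z <= a -> square a z.
Proof.
move=> za; exists (complex.Re z, complex.Im z); last by case: z za.
by split; rewrite /= in_itv /= -ler_norml; apply: le_trans za; [exact: ler_Re|exact: ler_Im].
Qed.

Lemma fnorm_le (f g : B) (E : R) : 0 <= E -> (forall z, disk z -> normc (f z) <= E * normc (g z)) ->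
  fnorm f <= E * fnorm g.
Proof.
move=> E0 h; have c0 := area_cst_gt0 alpha_gtN1.
have Eg0 : 0 <= E * fnorm g by rewrite mulr_ge0 ?fnorm_ge0.
rewrite -(@ler_sqr _ _ _ (fnorm_ge0 _) Eg0) exprMn !fnorm_sqr mulrCA; apply: ler_wpM2l; first exact: ltW.
rewrite -lee_fin EFinM !bint_fineK.
have [hf _ _] := bergman_inP f; have [hg _ _] := bergman_inP g.
have mg := mC_bint alpha hg.
rewrite /bint -(plintZ mg (bint_integrand_ge0 _ _) (sqr_ge0 _)).
apply: plint_le; [exact: mC_bint|exact: (mCM (mC_cst _) mg)|exact: bint_integrand_ge0|].
move=> z; rewrite mulrA; apply: ler_wpM2r; first exact: weight_ge0.
have [z1|z1] := boolP (normc z < 1); last by rewrite !mul0r mulr0.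
rewrite !mul1r -exprMn; have := h z z1; have := normc_ge0 (f z) => f0 hz.
by rewrite lerXn2r// nnegrE; lra.
Qed.

Lemma bint_le_bounded (w h : C -> C) (H : R) : holomorphic_disk w -> holomorphic_disk (fun z => w z * h z) ->
  (forall z, disk z -> normc (h z) <= H) ->
  (bint alpha (fun z => w z * h z)%R <= (H ^+ 2)%:E * bint alpha w)%E.
Proof.
move=> hw hwh hH; have mw := mC_bint alpha hw.
rewrite /bint -(plintZ mw (bint_integrand_ge0 _ _) (sqr_ge0 _)).
apply: plint_le; [exact: mC_bint|exact: (mCM (mC_cst _) mw)|exact: bint_integrand_ge0|].
move=> z; rewrite mulrA; apply: ler_wpM2r; first exact: weight_ge0.
have [z1|z1] := boolP (normc z < 1); last by rewrite !mul0r mulr0.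
rewrite !mul1r normcM exprMn mulrC; apply: ler_wpM2r; first exact: sqr_ge0.
have := hH z z1; have := normc_ge0 (h z) => f0 hz.
by rewrite lerXn2r// nnegrE; lra.
Qed.

Variables (phi : C -> C) (w : B) (r rho : R).
Hypothesis hphi : holomorphic_disk phi.
Hypothesis phi_le : forall z, disk z -> normc (phi z) <= r.
Hypothesis r0 : 0 <= r.
Hypothesis r_rho : r < rho.
Hypothesis rho1 : rho < 1.

Local Notation q := (r / rho).
Local Notation seqC := (prod_topology (fun _ : nat => C^o)).

Lemma rho0 : 0 < rho.
Proof. exact: le_lt_trans r0 r_rho. Qed.

Lemma q01 : 0 <= q < 1.
Proof. by have h := rho0; rewrite divr_ge0 ?(ltW h)//= ltr_pdivrMr// mul1r. Qed.

(** The growth [rho^-k] is that of Cauchy estimates at radius [rho]; where [|phi z| <= r < rho],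
    such series converge with geometric ratio [q = r / rho]. *)
Definition coef_box (M : R) : set seqC := [set c | forall k, square (M / rho ^+ k) (c k)].

Lemma nbhs_normc (a : C^o) (dl : R) : 0 < dl -> nbhs a [set y : C^o | normc (a - y) < dl].
Proof.
by move=> dl0; apply/nbhsCP; exists dl => // y; rewrite normcB.
Qed.

Lemma near_coords (c : seqC) N (dl : R) : 0 < dl ->
  nbhs c [set c' : seqC | forall k, (k < N)%N -> normc (c k - c' k) < dl].
Proof.
move=> dl0; elim: N => [|n ih].
  rewrite (_ : [set _ | _] = setT); first exact: filterT.
  by apply/seteqP; split=> // c' _ k.
have hn : nbhs c [set c' : seqC | normc (c n - c' n) < dl].
  apply: (@proj_continuous nat (fun=> C^o) n c [set y : C^o | normc (c n - y) < dl]).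
  exact: nbhs_normc.
apply: filterS2 ih hn => c' h1 h2 k; rewrite ltnS leq_eqVlt => /orP[/eqP ->|kn]; first exact: h2.
exact: h1.
Qed.

Lemma coef_bound (M : R) c k : coef_box M c -> normc (c k) <= 2 * M / rho ^+ k.
Proof. by move=> /(_ k)/square_normc; rewrite mulrA. Qed.

Lemma tail_term (L : R) (c : nat -> C) z k : 0 <= L -> (forall k, normc (c k) <= L / rho ^+ k) -> disk z ->
  normc (c k * phi z ^+ k) <= L * q ^+ k.
Proof.
move=> L0 hc dz; rewrite normcM normcX /q expr_div_n mulrA -mulrAC; apply: ler_pM => //.
- exact: normc_ge0.
- by rewrite exprn_ge0// normc_ge0.
- by rewrite lerXn2r ?nnegrE ?normc_ge0//; exact: phi_le.
Qed.

Lemma power_series_element (M : R) c : 0 <= M -> coef_box M c -> exists g : B,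
  forall z, disk z -> csums (fun k => w z * (c k * phi z ^+ k)) (g z).
Proof.
move=> M0 hc; have cb k := coef_bound k hc.
have M20 : 0 <= 2 * M by rewrite mulr_ge0.
have [h hh] : {h : C -> C & forall z, normc z < rho -> csums (fun k => c k * z ^+ k) (h z)}.
  apply: (@choice _ _ (fun z l => normc z < rho -> csums (fun k => c k * z ^+ k) l)) => z.
  have [zr|zr] := boolP (normc z < rho); last by exists 0.
  have q1 := ratio_lt1 rho0 zr.
  have [|l hl _] := @csums_exists R (fun k => c k * z ^+ k) (2 * M * (1 - normc z / rho)^-1); last by exists l.
  move=> N; apply: (@le_trans _ _ (\sum_(k < N) 2 * M * (normc z / rho) ^+ k)).
    apply: ler_sum => k _; rewrite normcM normcX expr_div_n mulrA -mulrAC.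
    by rewrite ler_wpM2r ?exprn_ge0 ?normc_ge0.
  by rewrite -mulr_sumr; apply: ler_wpM2l => //; exact: geo_sum_le.
have [hw bw _] := bergman_inP w.
have pr z : disk z -> normc (phi z) < rho by move=> dz; exact: le_lt_trans (phi_le dz) r_rho.
have hu : holomorphic_disk (fun z => w z * h (phi z)).
  move=> z dz; apply: cderivableM; first exact: hw.
  apply: cderivable_comp; first exact: hphi.
  exact: (power_series_cderivable cb hh (pr _ dz)).
have hb z : disk z -> normc (h (phi z)) <= 2 * M * (1 - q)^-1.
  move=> dz; have q1 := q01; apply: (csums_le (hh _ (pr _ dz))) => N.
  apply: le_trans (normc_sum _ _ _) _.
  apply: (@le_trans _ _ (\sum_(k < N) 2 * M * q ^+ k)).
    by apply: ler_sum => k _; exact: tail_term.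
  by rewrite -mulr_sumr; apply: ler_wpM2l => //; exact: geo_sum_le.
have bu : (bint alpha (fun z => w z * h (phi z))%R < +oo)%E.
  apply: le_lt_trans (bint_le_bounded hw hu hb) _.
  by rewrite bint_fnorm -EFinM ltry.
exists (Bergman (disk_restrict_in alpha_gtN1 hu bu)) => z dz.
by rewrite /= disk_restrictE//; apply: csumsZ; apply: hh; exact: pr.
Qed.

(** A neighbourhood in the product topology controls finitely many coefficients; the tail is small
    uniformly on [coef_box M] because of the ratio [q]. *)
Lemma power_series_map (M : R) : 0 <= M -> {S : seqC -> B |
  (forall c, coef_box M c -> forall z, disk z -> csums (fun k => w z * (c k * phi z ^+ k)) (S c z)) &
  {within coef_box M, continuous S}}.
Proof.
move=> M0.
have [S hS] : {S : seqC -> B & forall c, coef_box M c ->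
    forall z, disk z -> csums (fun k => w z * (c k * phi z ^+ k)) (S c z)}.
  apply: (@choice _ _ (fun c (g : B) => coef_box M c ->
    forall z, disk z -> csums (fun k => w z * (c k * phi z ^+ k)) (g z))) => c.
  have [hc|hc] := pselect (coef_box M c); last by exists 0.
  by have [g hg] := power_series_element M0 hc; exists g.
exists S => //; apply/subspace_continuousP => c hc.
apply/cvgrPdist_lt => e /complex_gt0E[-> /= e0]; set eps := complex.Re e in e0 *.
(* The added 1 makes [eta' * fnorm w < eps], also when [w = 0]. *)
pose eta' := eps / (fnorm w + 1).
have w1 : 0 < fnorm w + 1 by have := fnorm_ge0 w; lra.
have eta0 : 0 < eta' by rewrite divr_gt0.
have /andP[q0 q1] := q01; have d0 : 0 < 1 - q by lra.
(* The tail from [N] on costs at most [eta' / 2], each of the two coefficients contributing [2 M];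
   [dl] is chosen so that the first [N] terms cost the other half. *)
have [N hN] := exists_pow_small (4 * M / (1 - q)) q01 (divr_gt0 eta0 (ltr0n _ 2)).
have N1 : 0 < 2 * N.+1%:R :> R by rewrite mulr_gt0.
pose dl := eta' / (2 * N.+1%:R); have dl0 : 0 < dl by rewrite divr_gt0.
have near_c := near_coords (c : seqC) N dl0.
rewrite /within /=; apply: filterS near_c => c' h hc'.
rewrite bergman_norm_fnorm ltcR.
apply: (@le_lt_trans _ _ (eta' * fnorm w)); last first.
  rewrite /eta' mulrAC ltr_pdivrMr// ltr_pM2l//; lra.
apply: fnorm_le => [|z dz]; first exact: ltW.
have := csumsB (hS c hc z dz) (hS c' hc' z dz); rewrite -bergmanBE => hcs.
apply: (csums_le hcs) => n.
have -> : \sum_(k < n) (w z * (c k * phi z ^+ k) - w z * (c' k * phi z ^+ k)) =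
   w z * \sum_(k < n) (c k - c' k) * phi z ^+ k.
  by rewrite mulr_sumr; apply: eq_bigr => k _; rewrite -mulrBr mulrBl.
rewrite normcM mulrC; apply: ler_wpM2r; first exact: normc_ge0.
apply: le_trans (normc_sum _ _ _) _.
have cb k := coef_bound k hc; have cb' k := coef_bound k hc'.
have pz k : normc (phi z ^+ k) <= 1.
  rewrite normcX exprn_ile1 ?normc_ge0//; have := phi_le dz; have := r_rho; have := rho1; lra.
have M40 : 0 <= 4 * M by rewrite mulr_ge0.
have small k : (k < N)%N -> normc ((c k - c' k) * phi z ^+ k) <= dl.
  move=> kN; rewrite normcM -[leRHS]mulr1; apply: ler_pM; rewrite ?normc_ge0//.
  by apply: ltW; exact: h.
have tail k : normc ((c k - c' k) * phi z ^+ k) <= 4 * M * q ^+ k.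
  apply: (@tail_term _ (fun k => c k - c' k)) => // j.
  apply: le_trans (le_normcD _ _) _; rewrite normcN.
  have := cb j; have := cb' j; rewrite -!mulrA; lra.
have Ndl : N%:R * dl <= eta' / 2.
  have -> : eta' / 2 = N.+1%:R * dl.
    have : N.+1%:R != 0 :> R by rewrite pnatr_eq0.
    by rewrite /dl; move: (N.+1%:R : R) => a a0; field.
  by rewrite ler_pM2r// ler_nat.
have nN : (n <= N + n)%N by rewrite leq_addl.
apply: (@le_trans _ _ (\sum_(k < N + n) normc ((c k - c' k) * phi z ^+ k))).
  rewrite -!(big_mkord xpredT (fun k => normc ((c k - c' k) * phi z ^+ k))).
  rewrite [leRHS](big_cat_nat _ nN)//= lerDl.
  by apply: sumr_ge0 => k _; exact: normc_ge0.
rewrite big_split_ord /=; apply: (@le_trans _ _ (eta' / 2 + eta' / 2)); last by lra.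
apply: lerD.
  apply: le_trans Ndl; apply: (@le_trans _ _ (\sum_(k < N) dl)).
    by apply: ler_sum => k _; exact: small.
  by rewrite sumr_const card_ord -[leLHS]mulr_natl.
apply: le_trans (_ : _ <= 4 * M / (1 - q) * q ^+ N) _; last exact/ltW/hN.
apply: (@le_trans _ _ (\sum_(k < n) 4 * M * q ^+ N * q ^+ k)).
  by apply: ler_sum => k _; rewrite -mulrA -exprD; exact: tail.
rewrite -mulr_sumr [leRHS](_ : _ = 4 * M * q ^+ N * (1 - q)^-1); last by ring.
apply: ler_wpM2l; last by apply: geo_sum_le; exact: q01.
by rewrite mulr_ge0// exprn_ge0.
Qed.

Lemma weighted_composition_compact (T : {linear B -> B}) :
  is_weighted_composition w phi T -> compact_operator T.
Proof.
move=> hT A bA; have [M0 M00 hM0] := bounded_set_fnorm bA.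
have [K K0 hK] := bint_pointwise alpha; have c0 := area_cst_gt0 alpha_gtN1.
pose P := (1 - rho) `^ (alpha + 2).
have P0 : 0 < P by apply: powR_gt0; rewrite subr_gt0.
(* Point evaluation at radius [rho] bounds all of [A] by [D] on that circle, and the Cauchy
   estimates put the coefficients in [coef_box (2 * D)]. *)
pose D := Num.sqrt (K * (M0 ^+ 2 / area_cst alpha) / P).
have fD (f : B) z : A f -> normc z = rho -> normc (f z) <= D.
  move=> Af zr; have [hf _ _] := bergman_inP f.
  have dz : disk z by rewrite diskE zr.
  have := hK f z hf dz; rewrite bint_fnorm -EFinM lee_fin zr -/P -ler_pdivlMr// => h.
  rewrite -[leLHS]ger0_norm ?normc_ge0// -sqrtr_sqr; apply: ler_wsqrtr; apply: le_trans h _.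
  rewrite ler_pM2r ?invr_gt0// ler_pM2l// ler_pM2r ?invr_gt0//.
  by rewrite lerXn2r ?nnegrE ?fnorm_ge0 ?(ltW M00)//; exact: hM0.
have D0 : 0 <= 2 * D by rewrite mulr_ge0 ?sqrtr_ge0.
have [S hS cS] := power_series_map D0.
(* [T f] is the value of [S] at the Taylor coefficients of [f], so the image of [A] lies in the
   image of a compact set. *)
apply: (@precompact_subset _ _ (S @` coef_box (2 * D))); last first.
  apply: compact_precompact; first exact: norm_hausdorff.
  apply: continuous_compact; first exact: cS.
  have := @tychonoff nat (fun=> C^o) (fun k => square (2 * D / rho ^+ k)) (fun k => @square_compact (2 * D / rho ^+ k)).
  exact.
move=> _ [f Af <-]; have [hf _ _] := bergman_inP f.
have hc : coef_box (2 * D) (fun k => fcoef rho f k).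
  move=> k; apply: normc_square; apply: (fcoef_le rho0 rho1); first exact: holo_cont.
  by move=> t _; apply: fD => //; exact: normc_circ rho0.
exists (fun k => fcoef rho f k) => //; apply: bergman_ext => z dz.
apply: (csums_unique (hS _ hc z dz)); rewrite (hT f z dz); apply: csumsZ.
exact: (taylor_csums rho0 rho1 hf (le_lt_trans (phi_le dz) r_rho)).
Qed.

End sup_lt_one.

Theorem theorem4p2 (R : realType) (alpha : R) (alpha_gtN1 : -1 < alpha)
    (phi : R[i] -> R[i])
    (phi_holomorphic : holomorphic_disk phi)
    (phi_self_map : forall z, disk z -> disk (phi z)) :
  decompactifiable alpha_gtN1 phi <-> disk_supnorm phi = 1.
Proof.
rewrite /disk_supnorm; set S := [set normc (phi z) | z in disk].
have d0 : disk (0 : R[i]) by rewrite diskE normc0.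
have S_le1 : ubound S 1.
  by move=> _ [z dz <-]; have := phi_self_map z dz; rewrite diskE; exact: ltW.
have hS : has_sup S by split; [exists (normc (phi 0)), 0|exists 1].
split=> [[w [T [hT _ T_not_compact]]]|supS]; last first.
  apply: decompactifiable_sup_one => // r r1.
  have e0 : 0 < sup S - r by rewrite supS subr_gt0.
  by have [_ [z dz <-] hz] := sup_adherent e0 hS; exists z => //; rewrite subKr in hz.
apply/eqP; apply: contrapT => /negP sup_neq1; apply: T_not_compact.
have sup_lt1 : sup S < 1 by rewrite lt_neqAle sup_neq1 ge_sup//; have [] := hS.
have phi_le z : disk z -> normc (phi z) <= sup S.
  by move=> dz; apply: (sup_upper_bound hS); exists z.
have sup_ge0 : 0 <= sup S by apply: le_trans (phi_le 0 d0); exact: normc_ge0.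
(* [rho] has to lie strictly between [sup S] and 1; the midpoint is taken. *)
apply: (@weighted_composition_compact R alpha alpha_gtN1 phi w (sup S) ((1 + sup S) / 2)) => //; lra.
Qed.
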